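(* Let $(\mathcal{P},\omega)$ be a substitution tiling system in $\mathbb{R}^d$ (satisfying the standing assumptions listed in the context) and suppose that $G$ is a symmetry group for $(\mathcal{P},\omega)$ that acts freely on $\mathcal{P}$. Then the action of $G$ on $A_\omega$ has the weak Rokhlin property.
   Context: TILINGS. Fix $d\ge 1$. A tile is a subset of $\mathbb{R}^d$ homeomorphic to the closed unit ball, possibly carrying a label (tiles with different labels are different; translates keep the label). A partial tiling is a collection of tiles with pairwise disjoint interiors; a patch is a finite partial tiling; $\mathrm{supp}(P)$ is the union of the tiles of $P$; a tiling is a partial tiling with support $\mathbb{R}^d$. For a partial tiling $T$, $U\subset\mathbb{R}^d$ and $x\in\mathbb{R}^d$, put $T(U)=\{t\in T: t\cap U\ne\emptyset\}$ and $T+x=\{t+x: t\in T\}$. $\mathcal{P}$ is a finite set of tiles (prototiles), each containing the origin in its interior, such that $p+x=q$ with $p,q\in\mathcal{P}$ forces $x=0$; moreover there are an integer $n_{\mathrm{cap}}<d$ and a constant $K$ such that for every $0<\varepsilon\le1$ the boundary of each prototile can be covered by at most $K\varepsilon^{-n_{\mathrm{cap}}}$ balls of radius $\varepsilon$. $\mathcal{P}^*$ is the set of partial tilings consisting of translates of prototiles. A substitution rule is a map $\omega:\mathcal{P}\to\mathcal{P}^*$ for which there is $\lambda>1$ with $\mathrm{supp}(\omega(p))=\lambda p$ for all $p$; it extends to $\mathcal{P}^*\to\mathcal{P}^*$ by $\omega(p+x)=\omega(p)+\lambda x$ and taking unions. $(\mathcal{P},\omega)$ is a substitution tiling system. $\Omega$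 is the set of tilings $T\in\mathcal{P}^*$ such that every patch in $T$ is contained in $\omega^n(p)+x$ for some $n\in\mathbb{N}$, $p\in\mathcal{P}$, $x\in\mathbb{R}^d$. Standing assumptions: (primitivity) there is $N$ such that $\omega^N(p)$ contains a translate of $q$ for all $p,q\in\mathcal{P}$; (finite local complexity) for every $T\in\Omega$ and $R>0$ there are, up to translation, finitely many patches in $T$ with support of diameter less than $R$; (injectivity) $\omega:\Omega\to\Omega$ is injective; (border forcing) there is $n$ such that for all $p\in\mathcal{P}$, whenever $\omega^n(p)+x\subset T$ and $\omega^n(p)+x'\subset T'$ with $T,T'\in\Omega$, then $T(\mathrm{supp}(\omega^n(p)+x))-x=T'(\mathrm{supp}(\omega^n(p)+x'))-x'$. The puncture of a tile $t=p+x$ ($p\in\mathcal{P}$) is $\mathbf{x}(t)=x$. $\Omega_{\mathrm{punc}}$ is the set of $T\in\Omega$ containing a tile whose puncture is $0$; its topology has as a basis of clopen sets the $U(P,t)=\{T\in\Omega_{\mathrm{punc}}: P-\mathbf{x}(t)\subset T\}$, $P$ a patch of a tiling in $\Omega$, $t\in P$; it is a Cantor set. SYMMETRY GROUPS. A symmetry group for $(\mathcal{P},\omega)$ is a subgroup $G$ of $O(d,\mathbb{R})$ such that $G$ acts on $\mathcal{P}$ from the left by $p\mapsto gp=\{gx:x\in p\}$ and $\omega(gp)=g\omega(p)$ for $g\in G$, $p\in\mathcal{P}$. It then acts on tiles by $g(p+x)=gp+gx$ and on (partial) tilings by $gT=\{gt:t\in T\}$. (A group acting freely on the finite set $\mathcal{P}$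 is finite.) C*-ALGEBRAS. $\mathcal{R}_{\mathrm{punc}}=\{(T,T+x): T,T+x\in\Omega_{\mathrm{punc}}, x\in\mathbb{R}^d\}$ is an equivalence relation, viewed as a groupoid with unit space $\Omega_{\mathrm{punc}}$, $r(T,T')=T$, $s(T,T')=T'$; its (étale) topology is generated by the sets $V(P,t_1,t_2)=\{(T,T')\in\mathcal{R}_{\mathrm{punc}}: P-\mathbf{x}(t_1)\subset T,\ T'=T+\mathbf{x}(t_1)-\mathbf{x}(t_2)\}$, $P$ a patch of a tiling in $\Omega$, $t_1,t_2\in P$. $A_\omega=C^*_r(\mathcal{R}_{\mathrm{punc}})$ is its reduced groupoid C*-algebra, a simple unital C*-algebra with a unique tracial state. $G$ acts on $A_\omega$ by automorphisms determined on $f\in C_c(\mathcal{R}_{\mathrm{punc}})$ by $\alpha_g(f)(T,T')=f(g^{-1}T,g^{-1}T')$. WEAK ROKHLIN PROPERTY. Let $A$ be a unital simple C*-algebra whose space $\mathfrak{T}(A)$ of normalized traces is nonempty and let $\alpha:G\to\mathrm{Aut}(A)$ be an action of a finite group. Then $\alpha$ has the weak Rokhlin property if there is a central sequence $(f_n)_{n\in\mathbb{N}}$ in $A$ (i.e. $\|f_na-af_n\|\to0$ for all $a\in A$) with $0\le f_n\le1$, $\lim_n\|\alpha_g(f_n)\alpha_h(f_n)\|=0$ for all $g\ne h$ in $G$, and $\lim_n\max_{\tau\in\mathfrak{T}(A)}|\tau(f_n)-(\#G)^{-1}|=0$. *)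

(* Defs.v *)
From HB Require Import structures.
From mathcomp Require Import all_boot all_order all_algebra finmap.
From mathcomp Require Import all_classical all_reals all_analysis.
From mathcomp Require Import complex.
Set Implicit Arguments.
Unset Strict Implicit.
Unset Printing Implicit Defensive.
Import Order.TTheory GRing.Theory Num.Theory.
Import numFieldNormedType.Exports.
Local Open Scope classical_set_scope.
Local Open Scope ring_scope.
Local Open Scope complex_scope.

(* The modulus as an element of R: `|z| itself is an element of R[i]. *)
Definition cmod {R : realType} (z : R[i]) : R := complex.Re `|z|.

Section Euclid.
Context {R : realType} {d : nat}.
Implicit Types X : set 'cV[R]_d.

(* The library norm on matrices is the sup norm; it induces the same topology,
   but balls and diameters are meant for the Euclidean norm. *)
Definition enorm (x : 'cV[R]_d) : R := Num.sqrt (\sum_(i < d) x i 0 ^+ 2).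

Definition eball (c : 'cV[R]_d) (r : R) : set 'cV[R]_d :=
  [set x | enorm (x - c) < r].

Definition unit_disc : set 'cV[R]_d := [set x | enorm x <= 1].

Definition diameter X : \bar R :=
  ereal_sup [set (enorm (x - y))%:E | x in X & y in X].

Definition boundary X : set 'cV[R]_d := closure X `\` interior X.

End Euclid.

Definition homeomorphic {X Y : topologicalType} (A : set X) (B : set Y) :=
  exists (f : X -> Y) (g : Y -> X),
    [/\ {within A, continuous f}, {within B, continuous g},
        set_fun A B f, set_fun B A g &
        {in A, cancel f g} /\ {in B, cancel g f}].

Section Tiles.
Variables (R : realType) (d : nat) (L : Type).

(* A label together with the underlying set; L := unit for unlabelled tiles. *)
Definition tile := (L * set 'cV[R]_d)%type.

Definition is_tile (t : tile) := homeomorphic t.2 (@unit_disc R d).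

Definition translate_tile (t : tile) (x : 'cV[R]_d) : tile :=
  (t.1, [set y + x | y in t.2]).

Definition translate (T : set tile) (x : 'cV[R]_d) : set tile :=
  [set translate_tile t x | t in T].

Definition supp (T : set tile) : set 'cV[R]_d := \bigcup_(t in T) t.2.

(* T(U), the tiles of T that meet U *)
Definition tiles_meeting (T : set tile) (U : set 'cV[R]_d) : set tile :=
  [set t | T t /\ t.2 `&` U !=set0].

Definition partial_tiling (T : set tile) :=
  (forall t, T t -> is_tile t) /\
  (forall t t', T t -> T t' -> t <> t' ->
     interior t.2 `&` interior t'.2 = set0).

Definition is_patch (Q : set tile) := finite_set Q /\ partial_tiling Q.

Definition tiling (T : set tile) := partial_tiling T /\ supp T = setT.

Record tiling_data := TilingData {
  proto : set tile;
  subst : tile -> set tile;   (* only its values on proto matter *)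
  scale : R }.

Variable S : tiling_data.

Definition Pstar (T : set tile) :=
  partial_tiling T /\
  (forall t, T t -> exists p x, proto S p /\ t = translate_tile p x).

(* omega on Pstar: omega(p + x) = omega(p) + lambda x, and unions *)
Definition subst_ext (T : set tile) : set tile :=
  [set u | exists p x, [/\ proto S p, T (translate_tile p x) &
                           translate (subst S p) (scale S *: x) u]].

Definition supertile (n : nat) (p : tile) : set tile :=
  iter n subst_ext [set p].

Definition Omega : set (set tile) :=
  [set T | [/\ Pstar T, tiling T &
    forall Q, is_patch Q -> Q `<=` T ->
      exists n p x, proto S p /\ Q `<=` translate (supertile n p) x]].

(* A nonempty set of prototiles is implicit in Omega_punc being a Cantor set. *)
Record substitution_tiling_system : Prop := SubstitutionTilingSystem {
  proto_nonempty : proto S !=set0;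
  proto_finite : finite_set (proto S);
  proto_tile : forall p, proto S p -> is_tile p;
  proto_origin : forall p, proto S p -> interior p.2 0;
  proto_translate : forall p q x,
    proto S p -> proto S q -> translate_tile p x = q -> x = 0;
  proto_boundary : exists (ncap : int) (K : R), (ncap < d%:Z) /\
    forall (e : R) p, 0 < e <= 1 -> proto S p ->
      exists s : seq 'cV[R]_d,
        ((size s)%:R <= K * e ^ (- ncap)) /\
        boundary p.2 `<=` \bigcup_(c in [set` s]) eball c e;
  subst_Pstar : forall p, proto S p -> Pstar (subst S p);
  scale_gt1 : 1 < scale S;
  subst_supp : forall p, proto S p ->
    supp (subst S p) = [set scale S *: x | x in p.2] }.

Definition primitive := exists N, forall p q, proto S p -> proto S q ->
  exists x, supertile N p (translate_tile q x).

Definition finite_local_complexity := forall T (r : R), Omega T -> 0 < r ->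
  exists F : set (set tile), finite_set F /\
    forall Q, is_patch Q -> Q `<=` T -> (diameter (supp Q) < r%:E)%E ->
      exists Q0 x, F Q0 /\ Q = translate Q0 x.

Definition subst_injective := forall T T', Omega T -> Omega T' ->
  subst_ext T = subst_ext T' -> T = T'.

Definition forces_border := exists n, forall p T T' x x',
  proto S p -> Omega T -> Omega T' ->
  translate (supertile n p) x `<=` T -> translate (supertile n p) x' `<=` T' ->
  translate (tiles_meeting T (supp (translate (supertile n p) x))) (- x) =
  translate (tiles_meeting T' (supp (translate (supertile n p) x'))) (- x').

Definition standing_assumptions :=
  [/\ primitive, finite_local_complexity, subst_injective & forces_border].

(* The puncture of a translate of a prototile; 0 is a dummy value for other
   tiles. It is well defined by proto_translate. *)
Definition puncture (t : tile) : 'cV[R]_d :=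
  xget 0 [set x | exists2 p, proto S p & t = translate_tile p x].

Definition Omega_punc : set (set tile) :=
  [set T | Omega T /\ exists2 t, T t & puncture t = 0].

Definition orthogonal_subgroup (G : set 'M[R]_d) :=
  [/\ G 1%:M, (forall g h, G g -> G h -> G (g *m h)),
      (forall g, G g -> G (invmx g)) & (forall g, G g -> g^T *m g = 1%:M)].

(* lact says how a symmetry moves labels: gp has underlying set
   {gx : x in p}, and label lact g l. Labels kept by symmetries correspond to
   lact g l := l. *)
Variable lact : 'M[R]_d -> L -> L.

Definition gtile (g : 'M[R]_d) (t : tile) : tile :=
  (lact g t.1, [set g *m x | x in t.2]).

Definition gtiling (g : 'M[R]_d) (T : set tile) : set tile :=
  [set gtile g t | t in T].

Record symmetry_group (G : set 'M[R]_d) : Prop := SymmetryGroup {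
  sym_subgroup : orthogonal_subgroup G;
  sym_proto : forall g p, G g -> proto S p -> proto S (gtile g p);
  sym_act1 : forall p, proto S p -> gtile 1%:M p = p;
  sym_actM : forall g h p, G g -> G h -> proto S p ->
    gtile (g *m h) p = gtile g (gtile h p);
  sym_subst : forall g p, G g -> proto S p ->
    subst S (gtile g p) = gtiling g (subst S p) }.

Definition acts_freely (G : set 'M[R]_d) := forall g p,
  G g -> proto S p -> gtile g p = p -> g = 1%:M.

Definition Rset : set (set tile * set tile) :=
  [set TT | [/\ Omega_punc TT.1, Omega_punc TT.2 &
                exists x, TT.2 = translate TT.1 x]].

Definition Rpunc : Type := set_type Rset.

HB.instance Definition _ := Choice.copy Rpunc (set_type Rset).

Definition rng (y : Rpunc) : set tile := (set_val y).1.
Definition src (y : Rpunc) : set tile := (set_val y).2.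

Definition Vset (Q : set tile) (t1 t2 : tile) : set Rpunc :=
  [set y | translate Q (- puncture t1) `<=` rng y /\
           src y = translate (rng y) (puncture t1 - puncture t2)].

Definition Rpunc_subbase : set (set Rpunc) :=
  [set V | exists Q t1 t2,
    [/\ is_patch Q, (exists2 T, Omega T & Q `<=` T), Q t1, Q t2 &
        V = Vset Q t1 t2]].

HB.instance Definition _ :=
  isSubBaseTopological.Build Rpunc Rpunc_subbase id.

Definition Cc (f : Rpunc -> R[i]) :=
  continuous (f : Rpunc -> R[i]^o) /\ compact (closure [set y | f y != 0]).

(* f (T, T') for a pair of tilings, and 0 off R_punc *)
Definition at_pair (f : Rpunc -> R[i]) (TT : set tile * set tile) : R[i] :=
  oapp f 0 (insub TT : option (set_type Rset)).

(* The sum over the factorizations y = y1 y2; it has finite support as soon as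
   f is in C_c, whatever h is. *)
Definition convol (f h : Rpunc -> R[i]) (y : Rpunc) : R[i] :=
  \sum_(yy \in [set yy : Rpunc * Rpunc |
      [/\ rng yy.1 = rng y, src yy.1 = rng yy.2 & src yy.2 = src y]])
    f yy.1 * h yy.2.

Definition involution_Cc (f : Rpunc -> R[i]) (y : Rpunc) : R[i] :=
  conjc (at_pair f (src y, rng y)).

(* squared norm in l^2(s^-1(T)) *)
Definition l2sq (T : set tile) (xi : Rpunc -> R[i]) : \bar R :=
  \esum_(y in [set y | src y = T]) (cmod (xi y) ^+ 2)%:E.

(* The supremum over T in Omega_punc of the operator norm of the regular
   representation xi |-> f * xi on l^2(s^-1(T)). *)
Definition reduced_norm (f : Rpunc -> R[i]) : \bar R :=
  ereal_sup [set z | exists T xi,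
    [/\ Omega_punc T, (l2sq T xi <= 1)%E & z = sqrte (l2sq T (convol f xi))]].

Definition gfun (g : 'M[R]_d) (f : Rpunc -> R[i]) (y : Rpunc) : R[i] :=
  at_pair f (gtiling (invmx g) (rng y), gtiling (invmx g) (src y)).

End Tiles.

(* The norm is real-valued; the library's algebra and complete normed module
   structures have no common join, so the norm axioms are listed here. *)
HB.mixin Record isCStarAlgebra (R : realType) A of GRing.Algebra R[i] A := {
  cnorm : A -> R;
  star : A -> A;
  cnormD : forall a b : A, cnorm (a + b) <= cnorm a + cnorm b;
  cnormZ : forall (c : R[i]) (a : A), cnorm (c *: a) = cmod c * cnorm a;
  cnorm0_eq0 : forall a : A, cnorm a = 0 -> a = 0;
  cnormM : forall a b : A, cnorm (a * b) <= cnorm a * cnorm b;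
  cnorm_complete : forall u : nat -> A,
    (forall e : R, 0 < e -> exists N, forall m n,
       (N <= m)%N -> (N <= n)%N -> cnorm (u m - u n) < e) ->
    exists l : A, cnorm (u n - l) @[n --> \oo] --> (0 : R);
  starD : forall a b : A, star (a + b) = star a + star b;
  starZ : forall (c : R[i]) (a : A), star (c *: a) = conjc c *: star a;
  starM : forall a b : A, star (a * b) = star b * star a;
  starK : forall a : A, star (star a) = a;
  cnorm_star : forall a : A, cnorm (star a * a) = cnorm a ^+ 2 }.

#[short(type="cstarAlgType")]
HB.structure Definition CStarAlgebra (R : realType) :=
  { A of isCStarAlgebra R A & GRing.Algebra R[i] A }.

Section CStar.
Variables (R : realType) (A : cstarAlgType R).

Definition cpositive (a : A) := exists b : A, a = star b * b.

Record star_automorphism (phi : A -> A) : Prop := StarAutomorphism {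
  aut_linear : forall (c : R[i]) (a b : A),
    phi (c *: a + b) = c *: phi a + phi b;
  aut_mul : forall a b : A, phi (a * b) = phi a * phi b;
  aut_star : forall a : A, phi (star a) = star (phi a);
  aut_bij : bijective phi }.

Definition normalized_traces : set {scalar A} :=
  [set tau : {scalar A} | [/\ (forall a : A, 0 <= tau (star a * a)),
      (forall a b : A, tau (a * b) = tau (b * a)) & tau 1 = 1]].

(* The notion is meant for simple A and for finite groups G (fset_set is empty
   on infinite sets); of G, only the elements and their number intervene. The
   supremum is -oo, hence the limit fails, if A has no normalized trace. *)
Definition weak_Rokhlin_property (gT : choiceType) (G : set gT)
    (alpha : gT -> A -> A) :=
  exists f : nat -> A,
    [/\ (forall a : A, cnorm (f n * a - a * f n) @[n --> \oo] --> (0 : R)),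
        (forall n, cpositive (f n) /\ cpositive (1 - f n)),
        (forall g h, G g -> G h -> g <> h ->
           cnorm (alpha g (f n) * alpha h (f n)) @[n --> \oo] --> (0 : R)) &
        ereal_sup [set (cmod (tau (f n) - (#|` fset_set G|%fset%:R)^-1))%:E
                  | tau in normalized_traces] @[n --> \oo] --> (0 : \bar R)].

End CStar.

Section ReducedAlgebra.
Variables (R : realType) (d : nat) (L : Type) (S : tiling_data R d L).
Variables (A : cstarAlgType R) (iota : (Rpunc S -> R[i]) -> A).

(* A is the completion of the *-algebra C_c(R_punc) in the reduced norm, iota
   being the canonical map; this determines (A, iota) up to a unique
   isomorphism. The values of iota off C_c do not matter. *)
Record is_reduced_algebra : Prop := IsReducedAlgebra {
  iota_linear : forall (c : R[i]) f h, Cc f -> Cc h ->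
    iota (fun y => c * f y + h y) = c *: iota f + iota h;
  iota_conv : forall f h, Cc f -> Cc h -> iota (convol f h) = iota f * iota h;
  iota_star : forall f, Cc f -> iota (involution_Cc f) = star (iota f);
  iota_norm : forall f, Cc f -> (cnorm (iota f))%:E = reduced_norm f;
  iota_dense : forall (a : A) (e : R), 0 < e ->
    exists2 f, Cc f & cnorm (a - iota f) < e }.

Record is_symmetry_action (lact : 'M[R]_d -> L -> L) (G : set 'M[R]_d)
    (alpha : 'M[R]_d -> A -> A) : Prop := IsSymmetryAction {
  act_aut : forall g, G g -> star_automorphism (alpha g);
  act_one : forall a, alpha 1%:M a = a;
  act_mul : forall g h a, G g -> G h ->
    alpha (g *m h) a = alpha g (alpha h a);
  act_iota : forall g f, G g -> Cc f ->
    alpha g (iota f) = iota (gfun lact g f) }.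

End ReducedAlgebra.

(* Main.v *)
(* By recognizability every punctured tiling [T] lies at a well-defined position
   (its level-n address) in a level-n supertile, so a function [psi] of the
   address gives a diagonal element of [A]; all diagonal matrix units of one
   supertile type are equivalent, and a trace is determined by one weight per
   type and level. Uniqueness of these weights (Perron-Frobenius) makes them
   [G]-invariant. As the action on prototiles is free, one may choose one
   supertile type in each [G]-orbit and let [f_n] be the ramp which grows slowly
   from 0 to 1 inside the supertiles of the chosen types and vanishes elsewhere.
   The translates of [f_n] are orthogonal; a slow ramp almost commutes with
   elements of finite range; and its trace is close to [1 / #G], because the
   boundaries of the supertiles are negligible. That the supremum over the
   traces is not the one of the empty set uses the trace obtained as an
   ultralimit of averages over growing supertiles. *)
Require Import Defs.
From HB Require Import structures.
From mathcomp Require Import all_boot all_order all_algebra finmap.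
From mathcomp Require Import all_classical all_reals all_analysis.
From mathcomp Require Import complex.
From mathcomp Require Import ring lra.
Set Implicit Arguments.
Unset Strict Implicit.
Unset Printing Implicit Defensive.
Import Order.TTheory GRing.Theory Num.Theory.
Import numFieldNormedType.Exports.
Local Open Scope classical_set_scope.
Local Open Scope ring_scope.
Local Open Scope complex_scope.

(** * Tiles and translations *)

(** An ultrafilter replaces a metric on the hull: [ulim U T] collects the tiles that lie in almost
    all [T i]. Punctured tilings show finitely many patterns in each window, so there the limit
    agrees with almost all [T i]. This one device gives the existence of addresses, their dependence
    on a bounded window, and compactness in the groupoid. The algebra [A] is known only through
    [iota], so a trace is probed on the diagonal elements [iota (Ef n psi 0)]. Invariance of the
    weights comes from comparing [tau] with [tau \o alpha g]: both weight systems are non-negative,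
    have the same normalization and solve the same recursion given by the substitution matrix. A
    ramp has two competing errors. Its commutator with a fixed element is of order 1/w for a ramp of
    width w, while its loss of trace is the proportion of tiles within w of the supertile boundary;
    hence the width is fixed first and the level afterwards. The ramp has to vanish at the boundary
    because a translation may lead into a supertile of another type, where nothing relates the two
    values except that both are small. *)

Section Translations.
Context {R : realType} {d : nat} {L : Type}.
Local Notation V := 'cV[R]_d.
Implicit Types (t : tile R d L) (T : set (tile R d L)) (x y z : V).

Lemma translate_tileE t x z : (translate_tile t x).2 z <-> t.2 (z - x).
Proof.
split=> /=; first by case=> y ty <-; rewrite addrK.
by move=> tz; exists (z - x) => //; rewrite subrK.
Qed.

Lemma tile_ext t t' : t.1 = t'.1 -> (forall z, t.2 z <-> t'.2 z) -> t = t'.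
Proof.
case: t t' => [l A] [l' A'] /= <- AA'; congr (_, _).
by apply/seteqP; split=> z /AA'.
Qed.

Lemma translate_tile0 t : translate_tile t 0 = t.
Proof. by apply: tile_ext => // z; rewrite translate_tileE subr0. Qed.

Lemma translate_tileD t x y :
  translate_tile (translate_tile t x) y = translate_tile t (x + y).
Proof.
by apply: tile_ext => // z; rewrite !translate_tileE opprD addrA [z - y - x]addrAC.
Qed.

Lemma translate_tileK x : cancel (@translate_tile R d L ^~ x) (@translate_tile R d L ^~ (- x)).
Proof. by move=> t; rewrite translate_tileD subrr translate_tile0. Qed.

Lemma translateE T x t : translate T x t <-> T (translate_tile t (- x)).
Proof.
split; first by case=> u Tu <-; rewrite translate_tileK.
move=> Tt; exists (translate_tile t (- x)) => //.
by rewrite translate_tileD addNr translate_tile0.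
Qed.

Lemma translate0 T : translate T 0 = T.
Proof. by apply/seteqP; split=> t; rewrite translateE oppr0 translate_tile0. Qed.

Lemma translateD T x y : translate (translate T x) y = translate T (x + y).
Proof.
by apply/seteqP; split=> t; rewrite !translateE translate_tileD opprD [- y - x]addrC.
Qed.

Lemma translateK T x : translate (translate T x) (- x) = T.
Proof. by rewrite translateD subrr translate0. Qed.

Lemma interior_ballP (A : set V) z :
  A^° z <-> exists2 e : R, 0 < e & forall u, `|z - u| < e -> A u.
Proof.
rewrite /interior; split.
  by move=> /nbhs_ballP[e /= e0 eA]; exists e => // u zu; apply: eA; rewrite -ball_normE.
move=> [e e0 eA]; apply/nbhs_ballP; exists e => //= u.
by rewrite -ball_normE => /eA.
Qed.

Lemma interior_translate t x z :
  ((translate_tile t x).2)^° z <-> (t.2)^° (z - x).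
Proof.
rewrite !interior_ballP; split=> -[e e0 eA]; exists e => // u zu.
  have := eA (u + x); rewrite translate_tileE addrK; apply.
  by rewrite opprD addrA addrAC.
apply/translate_tileE/eA; suff -> : z - x - (u - x) = z - u by [].
by rewrite opprB addrA subrK.
Qed.

(** Estimates are made in the sup norm; this bound and [enorm_le] translate the Euclidean notions
    [eball], [unit_disc] and [diameter]. *)
Lemma enorm_ge (x : V) : `|x| <= enorm x.
Proof.
have e0 : 0 <= enorm x by exact: sqrtr_ge0.
rewrite [leLHS]/Num.norm /= mx_normrE; apply/bigmax_leP; split=> // -[i j] _ /=.
rewrite -(ger0_norm e0) -ler_sqr ?nnegrE// !real_normK ?num_real//.
rewrite sqr_sqrtr; last by apply: sumr_ge0 => k _; exact: sqr_ge0.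
rewrite (bigD1 i) //= (ord1 j) lerDl; apply: sumr_ge0 => k _; exact: sqr_ge0.
Qed.

Lemma mx_norm_coef (x : V) i : `|x i 0| <= `|x|.
Proof.
rewrite [leRHS]/Num.norm /= mx_normrE.
exact: (@le_bigmax _ _ _ 0 (fun ij : 'I_d * 'I_1 => `|x ij.1 ij.2|) (i, 0)).
Qed.

Lemma enorm_le (x : V) : enorm x <= d%:R * `|x|.
Proof.
rewrite -[leRHS]ger0_norm ?mulr_ge0// -sqrtr_sqr ler_wsqrtr//.
apply: (@le_trans _ _ (\sum_(i < d) `|x| ^+ 2)).
  by apply: ler_sum => i _; rewrite -(real_normK (num_real (x i 0))) lerXn2r ?nnegrE// mx_norm_coef.
rewrite sumr_const card_ord exprMn -[leLHS]mulr_natl ler_wpM2r ?sqr_ge0//.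
by rewrite -natrX ler_nat; case: (d) => // n; rewrite leq_pmulr.
Qed.

(** Transposition is an isometry of the sup norm, so Heine-Borel for row vectors carries over to
    columns. *)
Lemma bounded_closed_compact_col (A : set V) : bounded_set A -> closed A -> compact A.
Proof.
move=> bA cA.
have nrm p q (x : 'M[R]_(p, q)) : `|x^T| = `|x|.
  have le r s (z : 'M[R]_(r, s)) : `|z^T| <= `|z|.
    rewrite [leRHS]/Num.norm [leLHS]/Num.norm /= !mx_normrE.
    apply/bigmax_leP; split; first exact: bigmax_ge_id.
    move=> [i j] _ /=; rewrite mxE.
    exact: (@le_bigmax _ _ _ 0 (fun ij : 'I_r * 'I_s => `|z ij.1 ij.2|) (j, i)).
  by apply/eqP; rewrite eq_le le/= -{1}(trmxK x) le.
have trc p q : continuous (fun x : 'M[R]_(p, q) => x^T).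
  move=> x B /nbhs_ballP[e e0 eB]; apply/nbhs_ballP; exists e => // y xy.
  by apply: eB; move: xy; rewrite -!ball_normE /= -linearB nrm.
have -> : A = [set x^T | x in [set y : 'rV[R]_d | A y^T]].
  apply/seteqP; split=> [x Ax|x [y Ay <-]//].
  by exists (x^T); rewrite /= trmxK.
apply: continuous_compact; first by apply: continuous_subspaceT; exact: trc.
apply: bounded_closed_compact.
  move: bA => [M [Mr bM]]; exists M; split=> // e Me y /= Ay.
  by rewrite -nrm; exact: bM Me _ Ay.
by apply: closed_comp => // x _; exact: trc.
Qed.

Lemma unit_disc_compact : compact (@unit_disc R d).
Proof.
apply: bounded_closed_compact_col.
  exists 1; split=> // e e1 x /= x1.
  exact: le_trans (enorm_ge x) (le_trans x1 (ltW e1)).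
have -> : @unit_disc R d = [set x | (\sum_(i < d) x i 0 ^+ 2 : R) <= 1].
  apply/seteqP; split=> x /=; rewrite /unit_disc /enorm /=.
    by rewrite -{1}sqrtr1 ler_sqrt.
  by move=> x1; rewrite -sqrtr1 ler_wsqrtr.
apply: (@closed_comp _ _ (fun x : V => (\sum_(i < d) x i 0 ^+ 2 : R)) [set r | r <= 1]); last exact: closed_le.
move=> x _; apply: continuous_big => [|i _ {}x]; first exact: add_continuous.
have cx : continuous_at x (fun y : V => y i 0 : R) by exact: coord_continuous.
by have := continuousM cx cx; apply.
Qed.

Lemma tile_compact t : is_tile t -> compact t.2.
Proof.
move=> [f [g [fc gc fAB gBA [fK gK]]]].
suff -> : t.2 = g @` (@unit_disc R d) by exact: continuous_compact gc unit_disc_compact.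
apply/seteqP; split=> [x tx|x [y By <-]]; last exact: gBA.
by exists (f x); [exact: fAB|apply: fK; rewrite inE].
Qed.

End Translations.

(* An enumeration of the prototiles, with an inner radius [fr] and an outer
   radius [fD] (in the sup norm) common to all of them. *)
Record frame (R : realType) (d : nat) (L : Type) (S : tiling_data R d L) := Frame {
  fm : nat;
  fP : 'I_fm -> tile R d L;
  fr : R;
  fD : R;
  fP_inj : injective fP;
  fP_proto : forall i, proto S (fP i);
  fP_surj : forall p, proto S p -> exists i, p = fP i;
  fm_gt0 : (0 < fm)%N;
  fr_gt0 : 0 < fr;
  fP_ball : forall i z, `|z| < fr -> (fP i).2 z;
  fP_bound : forall i z, (fP i).2 z -> `|z| <= fD;
  fP_closed : forall i, closed (fP i).2 }.

Arguments fP {R d L S} f i : rename.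
Arguments fP_proto {R d L S} f i : rename.

Lemma frame_exists (R : realType) (d : nat) (L : Type) (S : tiling_data R d L) :
  substitution_tiling_system S -> exists _ : frame S, True.
Proof.
move=> hS.
have [m [P [Pinj PS]]] : exists m (P : 'I_m -> tile R d L),
    injective P /\ forall p, proto S p <-> exists i, p = P i.
  have /finite_setP[m] := proto_finite hS; rewrite card_eq_sym => /card_bijP[f [g fK gK]].
  have mem (i : 'I_m) : (i : nat) \in `I_m by rewrite inE /=; exact: ltn_ord.
  exists m, (fun i => val (f (SigSub (mem i)))); split.
    move=> i j /val_inj /(can_inj fK) /(congr1 val) /= ij; exact: val_inj.
  move=> p; split=> [pS|[i ->]]; last by have := valP (f (SigSub (mem i))); rewrite inE.
  have pS' : p \in proto S by rewrite inE.
  have := valP (g (SigSub pS')); rewrite inE /= => km.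
  exists (Ordinal km); rewrite -[LHS]/(val (SigSub pS')) -[X in val X = _]gK.
  by congr (val (f _)); apply: val_inj.
have Pp i : proto S (P i) by apply/PS; exists i.
have cpt i : compact (P i).2 by exact/tile_compact/(proto_tile hS).
have [r [r0 Pr]] : exists r : R, 0 < r /\ forall i z, `|z| < r -> (P i).2 z.
  have /choice[e eP] : forall i, exists e : R, 0 < e /\ forall z, `|z| < e -> (P i).2 z.
    move=> i; have /interior_ballP[e e0 eP] := proto_origin hS (Pp i).
    by exists e; split=> // z ze; apply: eP; rewrite sub0r normrN.
  exists (\big[Num.min/1]_i e i); split.
    by apply/lt_bigmin; [exact: ltr01|move=> i _; case: (eP i)].
  move=> i z ze; have [_] := eP i; apply; apply: lt_le_trans ze _.
  exact: bigmin_le_cond.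
have [D PD] : exists D : R, forall i z, (P i).2 z -> `|z| <= D.
  have /choice[e eP] : forall i, exists e : R, forall z, (P i).2 z -> `|z| <= e.
    move=> i; have [M [_ bM]] := compact_bounded (cpt i).
    by exists (M + 1) => z Pz; apply: bM Pz; rewrite ltrDl.
  exists (\big[Num.max/0]_i e i) => i z /eP /le_trans; apply.
  exact: (le_bigmax _ e i).
have m0 : (0 < m)%N.
  by have [p /PS[i _]] := proto_nonempty hS; apply: leq_ltn_trans (ltn_ord i).
have Pc i : closed (P i).2 by apply: compact_closed => //; exact: norm_hausdorff.
by exists (Frame Pinj Pp (fun p => (PS p).1) m0 r0 Pr PD Pc).
Qed.

(** * Geometry of tiles, partial tilings and iterated substitution *)

Section Tilings.
Context {R : realType} {d : nat} {L : Type} {S : tiling_data R d L}.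
Context (F : frame S) (hS : substitution_tiling_system S).
Local Notation V := 'cV[R]_d.
Local Notation lam := (scale S).
Local Notation r := (fr F).
Local Notation D := (fD F).
Implicit Types (t u : tile R d L) (T : set (tile R d L)) (x y z : V).

Definition tl (i : 'I_(fm F)) (x : V) : tile R d L := translate_tile (fP F i) x.

Lemma translate_tl i x y : translate_tile (tl i x) y = tl i (x + y).
Proof. exact: translate_tileD. Qed.

Lemma tl0 i : tl i 0 = fP F i.
Proof. exact: translate_tile0. Qed.

(** Makes a tile interchangeable with the pair of its type and its puncture, which is how tiles are
    handled from here on. *)
Lemma tl_inj i x j y : tl i x = tl j y -> i = j /\ x = y.
Proof.
move=> e; have : translate_tile (fP F i) (x - y) = fP F j.
  by rewrite -/(tl i (x - y)) -translate_tl e translate_tl subrr tl0.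
move=> e'; have xy := proto_translate hS (fP_proto F i) (fP_proto F j) e'.
split; last by apply/eqP; rewrite -subr_eq0 xy.
by apply: (@fP_inj _ _ _ _ F); rewrite -e' xy translate_tile0.
Qed.

Lemma tlE i x z : (tl i x).2 z <-> (fP F i).2 (z - x).
Proof. exact: translate_tileE. Qed.

Lemma interior_tl i x z : (tl i x).2^° z <-> (fP F i).2^° (z - x).
Proof. exact: interior_translate. Qed.

Lemma tl_bound i x z : (tl i x).2 z -> `|z - x| <= D.
Proof. by rewrite tlE => /fP_bound. Qed.

Lemma D_ge0 : 0 <= D.
Proof.
have i : 'I_(fm F) := Ordinal (fm_gt0 F).
apply: le_trans (normr_ge0 (0 : V)) _; apply: (@fP_bound _ _ _ _ F i).
by apply: fP_ball; rewrite normr0; exact: fr_gt0.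
Qed.

Lemma tl_ball i x z : `|z - x| < r -> (tl i x).2^° z.
Proof.
move=> zx; rewrite interior_tl interior_ballP.
exists (r - `|z - x|); first by rewrite subr_gt0.
move=> v zv; apply: fP_ball.
rewrite -[v]opprK -[- v](addKr (z - x)) opprD opprK.
by apply: le_lt_trans (ler_normB _ _) _; rewrite -ltrBrDl.
Qed.

Lemma tl_puncture i x : (tl i x).2^° x.
Proof. by apply: tl_ball; rewrite subrr normr0; exact: fr_gt0. Qed.

Lemma Pstar_tl T t : Pstar S T -> T t -> exists i x, t = tl i x.
Proof.
move=> [_ hT] /hT[p [x [/(@fP_surj _ _ _ _ F)[i ->] ->]]]; by exists i, x.
Qed.

Lemma Pstar_meet T t u z : Pstar S T -> T t -> T u -> t.2^° z -> u.2^° z -> t = u.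
Proof.
move=> [[_ dT] _] Tt Tu tz uz; apply: contrapT => tu.
by have := dT _ _ Tt Tu tu; move/seteqP => [/(_ z) + _]; apply.
Qed.

(** The interior of a tile contains the ball of radius [r] about its puncture, so two punctures
    closer than [r] make the tiles overlap. All local finiteness rests on this. *)
Lemma Pstar_sep T i x j y : Pstar S T -> T (tl i x) -> T (tl j y) -> `|x - y| < r ->
  i = j /\ x = y.
Proof.
move=> PT Tx Ty xy; apply: tl_inj; apply: (Pstar_meet (z := x)) PT Tx Ty _ _.
  exact: tl_puncture.
exact: tl_ball.
Qed.

Lemma mx_norm_lt (x : V) e : 0 < e -> (forall i, `|x i 0| < e) -> `|x| < e.
Proof.
move=> e0 xe; rewrite [ltLHS]/Num.norm /= mx_normrE; apply/bigmax_ltP; split=> // -[i j] _ /=.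
by rewrite (ord1 j).
Qed.

(** Pigeonhole in a grid of mesh [r]: two points of one cell are closer than [r] in the sup norm,
    and the number of cells in the window does not depend on its centre [c]. *)
Lemma separated_bound w : exists N : nat, forall c (s : seq V), uniq s ->
  {in s, forall x, `|x - c| < w} ->
  {in s &, forall x y, `|x - y| < r -> x = y} -> (size s <= N)%N.
Proof.
pose M := (Num.truncn (2 * w * r^-1)).+1.
exists #|{ffun 'I_d -> 'I_M.+1}| => c s us sw ssep.
have r0 := fr_gt0 F.
pose q x i := (x i 0 - c i 0 + w) / r.
pose f x : {ffun 'I_d -> 'I_M.+1} := [ffun i => inord (Num.truncn (q x i))].
have qb x i : x \in s -> 0 <= q x i < M%:R.
  move=> xs; have := le_lt_trans (mx_norm_coef (x - c) i) (sw _ xs).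
  rewrite !mxE ltr_norml => /andP[h1 h2]; apply/andP; split.
    by rewrite divr_ge0 ?(ltW r0)//; lra.
  apply: (@le_lt_trans _ _ (2 * w * r^-1)); last exact: truncnS_gt.
  by rewrite ler_pM2r ?invr_gt0//; lra.
have finj : {in s &, injective f}.
  move=> x y xs ys fxy; apply: ssep => //; apply: mx_norm_lt => // i.
  have /andP[x0 xM] := qb x i xs; have /andP[y0 yM] := qb y i ys.
  have e : Num.truncn (q x i) = Num.truncn (q y i).
    move/ffunP/(_ i): fxy; rewrite !ffunE => /(congr1 val) /=.
    rewrite !inordK //.
      by apply: leq_trans (_ : M <= _)%N => //; rewrite -(ltr_nat R); apply: le_lt_trans yM; rewrite truncn_le.
    by apply: leq_trans (_ : M <= _)%N => //; rewrite -(ltr_nat R); apply: le_lt_trans xM; rewrite truncn_le.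
  have := truncn_itv x0; have := truncn_itv y0; rewrite e => /andP[a1 a2] /andP[b1 b2].
  have qq : x i 0 - y i 0 = (q x i - q y i) * r by rewrite /q; field; rewrite gt_eqF.
  rewrite !mxE qq normrM (gtr0_norm r0) gtr_pMl// ltr_norml.
  rewrite mulrS in a2 b2; lra.
rewrite -(size_map f); have <- : size (undup (map f s)) = size (map f s).
  by congr size; apply: undup_id; rewrite map_inj_in_uniq.
by rewrite cardE; apply: uniq_leq_size; [exact: undup_uniq|move=> a _; rewrite mem_enum].
Qed.

Definition adr T : set ('I_(fm F) * V) := [set a | T (tl a.1 a.2)].

Lemma finite_of_size_bound (C : choiceType) (A : set C) (N : nat) :
  (forall s : seq C, uniq s -> (forall a, a \in s -> A a) -> (size s <= N)%N) -> finite_set A.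
Proof.
move=> h; apply: contrapT => iA; have [X XA] := infinite_set_fset N.+1 iA.
rewrite leqNgt => /negP; apply; apply: h; first exact: fset_uniq.
by move=> a /XA.
Qed.

Lemma adr_finite T c w : Pstar S T -> finite_set (adr T `&` [set a | `|a.2 - c| < w]).
Proof.
move=> PT; have [N hN] := separated_bound w.
apply: (@finite_of_size_bound _ _ N) => s us sA.
have sep a b : a \in s -> b \in s -> `|a.2 - b.2| < r -> a = b.
  case: a b => [i x] [j y] /sA[/= Tx _] /sA[/= Ty _] xy.
  by have [/= -> ->] := Pstar_sep PT Tx Ty xy.
rewrite -(size_map snd); apply: (hN c).
- rewrite map_inj_in_uniq// => a b sa sb ab; apply: sep => //.
  by rewrite ab subrr normr0; exact: fr_gt0.
- by move=> _ /mapP[a /sA[_ /= aw] ->].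
- by move=> _ _ /mapP[a sa ->] /mapP[b sb ->] ab; rewrite (sep _ _ sa sb ab).
Qed.

(** Either the first set fills [O], or [O] minus this set is a non-empty open set covered by the
    remaining ones. *)
Lemma closed_cover_interior (s : seq (set V)) (O : set V) :
  open O -> O !=set0 -> (forall A, List.In A s -> closed A) ->
  (forall z, O z -> exists2 A, List.In A s & A z) ->
  exists2 A, List.In A s & exists2 z, O z & A^° z.
Proof.
elim: s O => [|A s IHs] O oO [z0 Oz0] cs cov; first by have [] := cov _ Oz0.
have [[z1 [Oz1 Az1]]|none] := pselect (exists z, O z /\ ~ A z).
  have [||||B sB [z [Oz _] Bz]] := IHs (O `&` ~` A).
  - by apply: openI => //; apply: closed_openC; apply: cs; left.
  - by exists z1.
  - by move=> B sB; apply: cs; right.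
  - by move=> z [/cov[B [<-|] // sB Bz] nAz]; exists B.
  by exists B; [right|exists z].
exists A; first by left.
exists z0 => //; apply: filterS (open_nbhs_nbhs (conj oO Oz0)) => z Oz.
by apply: contrapT => nAz; apply: none; exists z.
Qed.

(* Baire's argument for finitely many closed tiles, in place of the fact that
   a tile is the closure of its interior. *)
Lemma open_meets_tile T (O : set V) : Pstar S T -> open O -> O !=set0 -> O `<=` supp T ->
  exists i x z, [/\ T (tl i x), O z & (tl i x).2^° z].
Proof.
move=> PT oO [z0 Oz0] OT.
(* Shrinking [O] to the unit ball about [z0] leaves finitely many tiles: those that reach this ball
   have their puncture within [D + 1] of [z0]. *)
have fA := adr_finite z0 (D + 1 + 1) PT.
pose s := enum_fset (fset_set (adr T `&` [set a | `|a.2 - z0| < D + 1 + 1])).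
have [||||A + [z [Oz _] Az]] := @closed_cover_interior [seq (tl a.1 a.2).2 | a <- s] (O `&` ball z0 1).
- by apply: openI => //; apply: ball_open.
- by exists z0; split => //; apply: ballxx.
- move=> A /List.in_map_iff[a [<- _]].
  have -> : (tl a.1 a.2).2 = (fun z => z - a.2) @^-1` (fP F a.1).2.
    by apply/seteqP; split=> z; rewrite tlE.
  apply: closed_comp; last exact: fP_closed.
  move=> z _ B /nbhs_ballP[e e0 eB]; apply/nbhs_ballP; exists e => // y.
  rewrite -ball_normE /= => zy; apply: eB; rewrite -ball_normE /=.
  by rewrite opprD opprK addrACA addNr addr0.
- move=> z [Oz]; rewrite -ball_normE /= => z0z.
  have [t Tt tz] := OT _ Oz; have [i [x e]] := Pstar_tl PT Tt; subst t.
  exists (tl i x).2 => //; apply/List.in_map_iff; exists (i, x); split=> //.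
  suff : (i, x) \in s.
    by elim: (s) => //= b l IHl; rewrite inE => /orP[/eqP ->|/IHl]; [left|right].
  rewrite /s /= in_fset_set// inE; split=> //=.
  rewrite -(subrK z x) -addrA; apply: le_lt_trans (ler_normD _ _) _.
  have := tl_bound tz; rewrite distrC => h1; rewrite distrC in z0z; lra.
move=> /List.in_map_iff[a [ea sa]]; exists a.1, a.2, z; split=> //; last by rewrite ea.
suff : a \in s by rewrite /s /= in_fset_set// inE => -[].
by elim: (s) sa => //= b l IHl [->|/IHl]; rewrite inE ?eqxx// => ->; rewrite orbT.
Qed.

(** Some tile of [T] overlaps the interior of [tl i x]. Its puncture is within [2 * D], so it lies
    in [T'] as well, where overlapping tiles coincide. *)
Lemma local_incl T T' i x : Pstar S T -> Pstar S T' -> T' (tl i x) ->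
  (tl i x).2 `<=` supp T ->
  (forall j y, T (tl j y) -> `|x - y| <= 2 * D -> T' (tl j y)) -> T (tl i x).
Proof.
move=> PT PT' T'x cov sub.
have [|||j [y [z [Ty xz yz]]]] := @open_meets_tile T (tl i x).2^° PT.
- exact: open_interior.
- by exists x; exact: tl_puncture.
- by move=> z /interior_subset /cov.
suff e : tl j y = tl i x by rewrite -e.
apply: (Pstar_meet PT' _ T'x yz xz); apply: sub => //.
have := tl_bound (interior_subset xz); have := tl_bound (interior_subset yz).
move=> h1 h2; rewrite -(subrK z x) -addrA; apply: le_trans (ler_normD _ _) _.
rewrite distrC in h2; lra.
Qed.

(** A tiling is maximal among partial tilings, so a single inclusion proves equality. This is how
    ultralimits are identified. *)
Lemma tiling_eq T T' : Pstar S T -> supp T = setT -> Pstar S T' -> T `<=` T' -> T = T'.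
Proof.
move=> PT cT PT' sub; apply/seteqP; split=> // t T't.
have [i [x e]] := Pstar_tl PT' T't; rewrite e in T't *.
by apply: (local_incl PT PT' T't) => [|j y /sub]; rewrite ?cT.
Qed.

Lemma homeomorphic_translate t x : is_tile t -> is_tile (translate_tile t x).
Proof.
move=> [f [g [fc gc fAB gBA [fK gK]]]].
exists (fun z => f (z - x)), (fun z => g z + x).
have shift (y z : V) e : ball y e z = ball (y + x) e (z + x).
  by rewrite -!ball_normE /= opprD addrACA subrr addr0.
split.
- apply/subspace_continuousP => z; rewrite translate_tileE => tz.
  move/subspace_continuousP/(_ _ tz) : fc => fcz B /fcz.
  rewrite /fmap /within /= => /nbhs_ballP[e e0 eB].
  apply/nbhs_ballP; exists e => // y zy /translate_tileE ty.
  by apply: eB => //; rewrite shift !subrK.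
- apply/subspace_continuousP => z Bz.
  move/subspace_continuousP/(_ _ Bz) : gc => gcz B /nbhs_ballP[e e0 eB].
  have /gcz : nbhs (g z) (ball (g z) e) by exact: nbhsx_ballx.
  change (nbhs z (fun y => unit_disc y -> ball (g z) e (g y)) ->
    nbhs z (fun y => unit_disc y -> B (g y + x))).
  apply: filterS => y h By.
  by apply: eB; rewrite -shift; exact: h.
- by move=> z /translate_tileE /fAB.
- by move=> z /gBA gz; apply/translate_tileE; rewrite addrK.
- split=> z.
    by rewrite inE => /translate_tileE tz; rewrite fK ?subrK// inE.
  by move=> Bz; rewrite addrK gK.
Qed.

Lemma is_tile_tl i x : is_tile (tl i x).
Proof. exact/homeomorphic_translate/(proto_tile hS)/fP_proto. Qed.

Lemma Pstar_intro T : (forall t, T t -> exists i x, t = tl i x) ->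
  (forall i x j y z, T (tl i x) -> T (tl j y) ->
     (tl i x).2^° z -> (tl j y).2^° z -> tl i x = tl j y) -> Pstar S T.
Proof.
move=> hT dT; split; last first.
  by move=> t /hT[i [x ->]]; exists (fP F i), x; split=> //; exact: fP_proto.
split=> [t /hT[i [x ->]]|t u Tt Tu tu]; first exact: is_tile_tl.
have [i [x e]] := hT _ Tt; have [j [y e']] := hT _ Tu; subst t u.
by apply/seteqP; split=> // z [xz yz]; apply: tu; exact: dT xz yz.
Qed.

Lemma Pstar_sub T T' : Pstar S T -> T' `<=` T -> Pstar S T'.
Proof.
move=> PT sub; apply: Pstar_intro => [t /sub|i x j y z /sub Ti /sub Tj xz yz].
  exact: Pstar_tl.
exact: Pstar_meet PT Ti Tj xz yz.
Qed.

Lemma Pstar_translate T x : Pstar S T -> Pstar S (translate T x).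
Proof.
move=> PT; apply: Pstar_intro => [t|i y j y' z].
  by move=> -[u /(Pstar_tl PT)[i [y ->]] <-]; exists i, (y + x); rewrite translate_tl.
rewrite !translateE !translate_tl => Ti Tj iz jz.
suff /tl_inj[-> /addIr ->] : tl i (y - x) = tl j (y' - x) by [].
by apply: (Pstar_meet (z := z - x) PT Ti Tj); move: iz jz;
  rewrite !interior_tl !opprD !opprK addrACA addNr addr0.
Qed.

Lemma supp_translate T x z : supp (translate T x) z <-> supp T (z - x).
Proof.
split=> [[_ [t Tt <-] /translate_tileE tz]|[t Tt tz]]; first by exists t.
by exists (translate_tile t x); [exists t|apply/translate_tileE].
Qed.

Lemma subst_supp_tl i z : supp (subst S (fP F i)) z <-> (fP F i).2 (lam^-1 *: z).
Proof.
have l0 : lam != 0 by rewrite gt_eqF// (lt_trans _ (scale_gt1 hS)).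
rewrite (subst_supp hS (fP_proto F i)); split=> [[y Py <-]|Pz].
  by rewrite scalerA mulVf// scale1r.
by exists (lam^-1 *: z) => //; rewrite scalerA mulfV// scale1r.
Qed.

Lemma lam_gt0 : 0 < lam. Proof. exact: lt_trans (scale_gt1 hS). Qed.

Lemma subst_body i x u z : translate (subst S (fP F i)) (lam *: x) u ->
  u.2 z -> (tl i x).2 (lam^-1 *: z).
Proof.
move=> hu uz; have : supp (translate (subst S (fP F i)) (lam *: x)) z by exists u.
rewrite supp_translate subst_supp_tl tlE scalerBr scalerA mulVf ?scale1r//.
exact/lt0r_neq0/lam_gt0.
Qed.

(** Interiors of subtiles shrink into the interior of their parent, so tiles coming from different
    parents cannot overlap. *)
Lemma subst_interior i x u z : translate (subst S (fP F i)) (lam *: x) u ->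
  u.2^° z -> (tl i x).2^° (lam^-1 *: z).
Proof.
have l0 := lam_gt0.
move=> hu /interior_ballP[e e0 eB]; apply/interior_ballP.
exists (lam^-1 * e); first by rewrite mulr_gt0// invr_gt0.
move=> v zv; have := @subst_body i x u (lam *: v) hu.
rewrite scalerA mulVf ?lt0r_neq0// scale1r; apply; apply: eB.
have -> : z - lam *: v = lam *: (lam^-1 *: z - v).
  by rewrite scalerBr scalerA mulfV ?lt0r_neq0// scale1r.
by rewrite normrZ gtr0_norm// -ltr_pdivlMl.
Qed.

Lemma subst_ext_tl T u : subst_ext S T u <->
  exists i x, T (tl i x) /\ translate (subst S (fP F i)) (lam *: x) u.
Proof.
split; first by case=> p [x [/(@fP_surj _ _ _ _ F)[i ->] Tx h]]; exists i, x.
by case=> i [x [Tx h]]; exists (fP F i), x; split=> //; exact: fP_proto.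
Qed.

Lemma Pstar_subst i x : Pstar S (translate (subst S (fP F i)) x).
Proof. exact/Pstar_translate/(subst_Pstar hS)/fP_proto. Qed.

Lemma Pstar_subst_ext T : Pstar S T -> Pstar S (subst_ext S T).
Proof.
move=> PT; apply: Pstar_intro => [t /subst_ext_tl[i [x [_]]]|].
  exact/Pstar_tl/Pstar_subst.
move=> i x j y z /subst_ext_tl[k [a [Ta ka]]] /subst_ext_tl[l [b [Tb lb]]] xz yz.
have /tl_inj[e1 e2] : tl k a = tl l b.
  apply: (Pstar_meet PT Ta Tb (subst_interior ka xz) (subst_interior lb yz)).
by subst l b; apply: (Pstar_meet (Pstar_subst _ _) ka lb xz yz).
Qed.

Lemma supp_subst_ext T z : Pstar S T -> supp (subst_ext S T) z <-> supp T (lam^-1 *: z).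
Proof.
move=> PT; split=> [[u /subst_ext_tl[i [x [Tx hu]]] uz]|[t Tt tz]].
  by exists (tl i x) => //; exact: subst_body uz.
have [i [x e]] := Pstar_tl PT Tt; subst t.
have : supp (translate (subst S (fP F i)) (lam *: x)) z.
  rewrite supp_translate subst_supp_tl scalerBr scalerA mulVf ?scale1r -?tlE//.
  exact/lt0r_neq0/lam_gt0.
by move=> [u hu uz]; exists u => //; apply/subst_ext_tl; exists i, x.
Qed.

Definition om n T := iter n (subst_ext S) T.

Lemma omD n k T : om (n + k) T = om n (om k T).
Proof. exact: iterD. Qed.

Lemma omS n T : om n.+1 T = subst_ext S (om n T).
Proof. by []. Qed.

Lemma om_sub n T T' : T `<=` T' -> om n T `<=` om n T'.
Proof.
move=> sub; elim: n => [//|n IHn] u [p [x [pS /IHn h hu]]].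
by exists p, x.
Qed.

Lemma Pstar_om n T : Pstar S T -> Pstar S (om n T).
Proof. by move=> PT; elim: n => [//|n IHn]; exact: Pstar_subst_ext. Qed.

Lemma supp_om n T z : Pstar S T -> supp (om n T) z <-> supp T (lam ^- n *: z).
Proof.
move=> PT; elim: n z => [|n IHn] z; first by rewrite expr0 invr1 scale1r.
rewrite omS supp_subst_ext; last exact: Pstar_om.
by rewrite IHn scalerA exprSr invfM mulrC.
Qed.

(** The digits of level [n]: types and positions of the tiles in the supertile of type [i] placed at
    the origin. *)
Definition Lam n i : set ('I_(fm F) * V) := adr (supertile S n (fP F i)).

Lemma Pstar1 i x : Pstar S [set tl i x].
Proof.
apply: Pstar_intro => [t ->|k a l b z -> ->//]; by exists i, x.
Qed.

Lemma supertileE n i : supertile S n (fP F i) = om n [set tl i 0].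
Proof. by rewrite tl0. Qed.

Lemma Pstar_supertile n i : Pstar S (supertile S n (fP F i)).
Proof. by rewrite supertileE; exact/Pstar_om/Pstar1. Qed.

Lemma supp_supertile n i z : supp (supertile S n (fP F i)) z <-> (fP F i).2 (lam ^- n *: z).
Proof.
rewrite supertileE supp_om; last exact: Pstar1.
by rewrite -tl0; split=> [[_ -> //]|?]; exists (tl i 0).
Qed.

(** Turns the iterated substitution into arithmetic on digits and scaled punctures. *)
Lemma omE n T u : (forall t, T t -> exists i x, t = tl i x) ->
  om n T u <-> exists i x a, [/\ T (tl i x), Lam n i a & u = tl a.1 (a.2 + lam ^+ n *: x)].
Proof.
move=> hT; elim: n u => [|n IHn] u.
  split=> [Tu|[i [x [[j y] [Tx /= e ->]]]]].
    have [i [x e]] := hT _ Tu; subst u; exists i, x, (i, 0); split=> //=.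
      by rewrite /Lam /adr /= tl0.
    by rewrite add0r expr0 scale1r.
  move: e; rewrite /Lam /adr /= -tl0 => /tl_inj[-> ->].
  by rewrite add0r expr0 scale1r.
rewrite omS subst_ext_tl; split.
  move=> [j [y [/IHn[i [x [a [Tx La /tl_inj[ej ey]]]]] hu]]].
  have /(Pstar_tl (Pstar_subst _ _))[k [z ez]] := hu; subst u j y.
  exists i, x, (k, z - lam ^+ n.+1 *: x); split=> //=; last by rewrite subrK.
  rewrite /Lam /adr /=; apply/subst_ext_tl; exists a.1, a.2; split=> //.
  move: hu; rewrite !translateE !translate_tl; congr (subst _ _ (tl _ _)).
  by rewrite scalerDr scalerA exprS opprD addrA addrAC.
move=> [i [x [[k z] [Tx /subst_ext_tl[j [y [Ly hz]]] ->]]]].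
exists j, (y + lam ^+ n *: x); split.
  by apply/IHn; exists i, x, (j, y).
move: hz; rewrite !translateE !translate_tl; congr (subst _ _ (tl _ _)).
by rewrite scalerDr scalerA -exprS /= opprD addrACA subrr addr0.
Qed.

Lemma om_translate n T x : (forall t, T t -> exists i x, t = tl i x) ->
  om n (translate T x) = translate (om n T) (lam ^+ n *: x).
Proof.
move=> hT; apply/seteqP; split=> u.
  move=> /omE[]; first by move=> _ [t /hT[i [y ->]] <-]; exists i, (y + x); rewrite translate_tl.
  move=> i [y [a []]]; rewrite translateE translate_tl => Ty La ->.
  rewrite translateE; apply/omE => //; exists i, (y - x), a; split=> //.
  by rewrite translate_tl scalerBr addrA.
rewrite translateE => /omE[]// i [y [a [Ty La e]]]; apply/omE.
  by move=> _ [t /hT[j [z ->]] <-]; exists j, (z + x); rewrite translate_tl.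
exists i, (y + x), a; split=> //; first by exists (tl i y); rewrite ?translate_tl.
by rewrite scalerDr addrA -translate_tl -e translate_tileD addNr translate_tile0.
Qed.

(** The whole ball of radius [r] about the puncture lies in the supertile, so the puncture is
    interior to it and not merely in its support. *)
Lemma Lam_supp n i a : Lam n i a -> (fP F i).2^° (lam ^- n *: a.2).
Proof.
have l0 : 0 < lam ^+ n by rewrite exprn_gt0// lam_gt0.
move=> La; apply/interior_ballP; exists (lam ^- n * r).
  by rewrite mulr_gt0 ?invr_gt0// fr_gt0.
move=> v av; have : (tl a.1 a.2).2 (lam ^+ n *: v).
  apply: interior_subset; apply: tl_ball; rewrite distrC.
  have -> : a.2 - lam ^+ n *: v = lam ^+ n *: (lam ^- n *: a.2 - v).
    by rewrite scalerBr scalerA mulfV ?lt0r_neq0// scale1r.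
  by rewrite normrZ gtr0_norm// -ltr_pdivlMl.
move=> av'; have : supp (supertile S n (fP F i)) (lam ^+ n *: v) by exists (tl a.1 a.2).
by rewrite supp_supertile scalerA mulVf ?lt0r_neq0// scale1r.
Qed.

Lemma Lam_bound n i a : Lam n i a -> `|a.2| <= lam ^+ n * D.
Proof.
have l0 : 0 < lam ^+ n by rewrite exprn_gt0// lam_gt0.
move=> /Lam_supp /interior_subset /fP_bound.
by rewrite normrZ gtr0_norm ?invr_gt0// ler_pdivrMl.
Qed.

Lemma Lam_finite n i : finite_set (Lam n i).
Proof.
apply: sub_finite_set (adr_finite 0 (lam ^+ n * D + 1) (Pstar_supertile n i)) => a La.
by split=> //=; rewrite subr0 (le_lt_trans (Lam_bound La))// ltrDl.
Qed.

End Tilings.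

(** A function with finitely many values is constant on a set of the ultrafilter; otherwise the
    complements of all its fibres would be in it, and so would their empty intersection. *)
Lemma ultra_pick (I X : Type) (U : set_system I) (B : set X) (f : I -> X) :
  UltraFilter U -> finite_set B -> U [set i | B (f i)] ->
  exists2 b, B b & U [set i | f i = b].
Proof.
move=> UU fB UB; apply: contrapT => none.
have fB' : finite_set (B : set {classic X}) by [].
have : U (\bigcap_(b in [set` fset_set (B : set {classic X})]) [set i | f i <> b]).
  apply: filter_bigI => b; rewrite in_fset_set// inE => Bb.
  have [h|//] := in_ultra_setVsetC [set i | f i = b] UU.
  by exfalso; apply: none; exists b.
move=> /(filterI UB) /filter_ex[i [Bi h]].
by apply: (h (f i)) => //=; rewrite in_fset_set// inE.
Qed.

(** * The hull and its compactness *)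

Section Hull.
Context {R : realType} {d : nat} {L : Type} {S : tiling_data R d L}.
Context (F : frame S) (hS : substitution_tiling_system S).
Context (hA : standing_assumptions S) (hd : (1 <= d)%N).
Local Notation V := 'cV[R]_d.
Local Notation lam := (scale S).
Local Notation D := (fD F).
Local Notation om := (@om R d L S).
Local Notation tl := (@tl R d L S F).
Local Notation Lam := (@Lam R d L S F).
Implicit Types (t u : tile R d L) (T Q : set (tile R d L)) (x y z : V).

Lemma Omega_Pstar T : Omega S T -> Pstar S T.
Proof. by case. Qed.

Lemma Omega_tl T t : Omega S T -> T t -> exists i x, t = tl i x.
Proof. by move=> /Omega_Pstar; exact: Pstar_tl. Qed.

Lemma supertile_tl n i t : supertile S n (fP F i) t -> exists j y, t = tl j y.
Proof. exact/(Pstar_tl F)/(Pstar_supertile hS). Qed.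

Lemma Omega_supp T : Omega S T -> supp T = setT.
Proof. by case=> _ [_ ->]. Qed.

Lemma Omega_intro T : Pstar S T -> supp T = setT ->
  (forall Q, finite_set Q -> Q `<=` T ->
    exists n i x, Q `<=` translate (supertile S n (fP F i)) x) -> Omega S T.
Proof.
move=> PT cT hT; split=> //; first by split=> //; case: PT.
move=> Q [fQ _] /(hT _ fQ)[n [i [x hx]]]; exists n, (fP F i), x.
by split=> //; exact: fP_proto.
Qed.

Lemma Omega_patch T Q : Omega S T -> finite_set Q -> Q `<=` T ->
  exists n i x, Q `<=` translate (supertile S n (fP F i)) x.
Proof.
move=> OT fQ QT; have [_ _ /(_ Q)] := OT; case=> //.
  by split=> //; case: (Pstar_sub F hS (Omega_Pstar OT) QT).
by move=> n [p [x [/(@fP_surj _ _ _ _ F)[i ->] h]]]; exists n, i, x.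
Qed.

Lemma Omega_translate T x : Omega S T -> Omega S (translate T x).
Proof.
move=> OT; apply: Omega_intro.
- exact/(Pstar_translate F hS)/Omega_Pstar.
- by apply/seteqP; split=> // z _; rewrite supp_translate Omega_supp.
- move=> Q fQ QT; have [||n [i [y h]]] := @Omega_patch T (translate Q (- x)) OT.
  + exact: finite_image.
  + by move=> t; rewrite translateE opprK => /QT; rewrite translateE translate_tileK.
  exists n, i, (y + x) => t Qt; rewrite -translateD translateE; apply: h.
  by rewrite translateE opprK translate_tileD addNr translate_tile0.
Qed.

Lemma Omega_om n T : Omega S T -> Omega S (om n T).
Proof.
move=> OT; elim: n => [//|n]; rewrite omS; move: (om n T) => {OT}T OT.
have PT := Omega_Pstar OT.
apply: Omega_intro; first exact: Pstar_subst_ext F hS _ PT.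
  by apply/seteqP; split=> // z _; rewrite (supp_subst_ext F hS)// Omega_supp.
move=> Q fQ QT.
have /choice[f hf] : forall q, exists t, Q q -> T t /\ subst_ext S [set t] q.
  move=> q; have [/QT[p [x [Pp Tx hq]]]|nQ] := pselect (Q q).
    by exists (translate_tile p x) => _; split=> //; exists p, x.
  by exists q.
have [||n' [i [x h]]] := @Omega_patch T (f @` Q) OT.
- exact: finite_image.
- by move=> _ [q /hf[Tq _] <-].
exists n'.+1, i, (lam *: x).
have -> : translate (supertile S n'.+1 (fP F i)) (lam *: x) =
    om 1 (translate (supertile S n' (fP F i)) x).
  rewrite (om_translate (F := F) hS) ?expr1//; exact: supertile_tl.
move=> q Qq; have [_ hq] := hf _ Qq.
have : om 1 [set f q] q by [].
by apply: om_sub => _ ->; apply: h; exists q.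
Qed.

Lemma puncture_tl i x : puncture S (tl i x) = x.
Proof.
rewrite /puncture; case: xgetP => [y _ [p /(@fP_surj _ _ _ _ F)[j ->]]|].
  by rewrite -/(tl j y) => /(tl_inj hS)[_ ->].
by move=> /(_ x) /= []; exists (fP F i) => //; exact: fP_proto.
Qed.

Lemma Omega_puncE T : Omega_punc S T <-> Omega S T /\ exists i, T (tl i 0).
Proof.
split=> [[OT [t Tt t0]]|[OT [i Ti]]].
  split=> //; have [i [x e]] := Omega_tl OT Tt; subst t.
  by exists i; rewrite -[X in tl i X]t0 puncture_tl.
by split=> //; exists (tl i 0) => //; rewrite puncture_tl.
Qed.

(** Windows select tiles by puncture rather than by support, in keeping with the description of
    tiles by [tl]. *)
Definition cut T w := T `&` [set t | exists i x, t = tl i x /\ `|x| < w].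

Lemma cut_finite T w : Pstar S T -> finite_set (cut T w).
Proof.
move=> PT; have := finite_image (fun a : 'I_(fm F) * V => tl a.1 a.2) (adr_finite F hS 0 w PT).
apply: sub_finite_set => t [Tt [i [x [e xw]]]]; subst t.
by exists (i, x) => //; split=> //=; rewrite subr0.
Qed.

Lemma cover_tile T z : Omega S T -> exists i x, [/\ T (tl i x), (tl i x).2 z & `|z - x| <= D].
Proof.
move=> OT; have : supp T z by rewrite Omega_supp.
move=> [t Tt tz]; have [i [x e]] := Omega_tl OT Tt; subst t.
by exists i, x; split=> //; exact: tl_bound tz.
Qed.

(** Membership in the hull yields a supertile of some level only. Enlarging the window forces the
    level up, because a supertile of level below [n] is too small to cover a large ball. *)
Lemma cut_deep T w n : Omega S T ->
  exists m i x, cut T w `<=` translate (supertile S (n + m) (fP F i)) x.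
Proof.
move=> OT; have l1 : 1 <= lam by exact/ltW/(scale_gt1 hS).
have l0 : 0 < lam := lam_gt0 hS.
(* More than the sup-norm diameter of any supertile of level at most [n]. *)
pose a := 2 * D * lam ^+ n + 1.
have D0 : 0 <= D := D_ge0 F.
have a0 : 0 < a by rewrite ltr_pwDr// !mulr_ge0// exprn_ge0// ltW.
(* Tiles that meet the ball of radius [a] have their puncture within [a + D] of the origin. *)
pose w' := Num.max w (a + D + 1).
have [||n' [i [x h]]] := @Omega_patch T (cut T w') OT.
- exact/cut_finite/Omega_Pstar.
- by move=> t [].
have hw : cut T w `<=` cut T w'.
  by move=> t [Tt [j [y [e yw]]]]; split=> //; exists j, y; rewrite lt_max yw.
have [nn'|nn'] := leqP n n'.
  by exists (n' - n)%N, i, x; rewrite subnKC//; exact: subset_trans h.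
exfalso.
have sup z : `|z| <= a -> `|z - x| <= lam ^+ n * D.
  move=> za; have [j [y [Ty yz zy]]] := cover_tile z OT.
  have yw : `|y| < w'.
    rewrite lt_max; apply/orP; right; rewrite -(subrK z y).
    apply: le_lt_trans (ler_normD _ _) _; rewrite distrC in zy.
    by apply: le_lt_trans (lerD zy za) _; rewrite addrC ltrDl.
  have : supp (translate (supertile S n' (fP F i)) x) z.
    by exists (tl j y) => //; apply: h; split=> //; exists j, y.
  rewrite supp_translate (supp_supertile hS) => /fP_bound.
  have ln' : 0 < lam ^+ n' by exact: exprn_gt0.
  rewrite normrZ gtr0_norm ?invr_gt0// ler_pdivrMl// => /le_trans; apply.
  by rewrite ler_wpM2r// ler_weXn2l// ltnW.
(* The points 0 and [z1], at distance [a], both lie in the supertile, which is too small for that. A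
   vector of norm [a] exists because [d] is positive. *)
pose z1 : V := const_mx a.
have z1a : `|z1| = a.
  apply/eqP; rewrite eq_le; apply/andP; split.
    rewrite [leLHS]/Num.norm /= mx_normrE; apply/bigmax_leP; split=> [|j _]; first exact: ltW.
    by rewrite mxE gtr0_norm.
  case: (d) hd @z1 => // k _ z1; have := mx_norm_coef z1 ord0.
  by rewrite mxE gtr0_norm.
have := sup z1; rewrite z1a lexx => /(_ isT) h1.
have := sup 0; rewrite normr0 (ltW a0) => /(_ isT) h2.
have : `|z1| <= `|z1 - x| + `|0 - x|.
  by rewrite sub0r normrN -{1}(subrK x z1) ler_normD.
rewrite z1a => h3; have : a <= 2 * D * lam ^+ n by lra.
by rewrite /a gerDl ler10.
Qed.

(** A large window of [T] lies in a supertile of level at least [K = k + N]. The level [K] supertile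
    around a tile near the origin fits well inside the window, hence belongs to [T]; by primitivity
    it contains a level [k] supertile of every type. *)
Lemma supertile_in T k i : Omega S T -> exists y, translate (supertile S k (fP F i)) y `<=` T.
Proof.
move=> OT; have [[N hN] _ _ _] := hA.
have l0 : 0 < lam := lam_gt0 hS.
have D0 : 0 <= D := D_ge0 F.
pose K := (k + N)%N; have lK : 0 < lam ^+ K by exact: exprn_gt0.
(* The tile near 0 costs [D], its supertile twice [lam ^+ K * D], and [local_incl] asks for a margin
   [2 * D]. *)
pose w := 2 * (lam ^+ K * D) + 3 * D + 1.
have [m [j [x hx]]] := cut_deep w K OT.
pose T2 := translate (supertile S m (fP F j)) (lam ^- K *: x).
have PT2 : Pstar S T2 by apply: (Pstar_translate F hS); exact: Pstar_supertile.
have e2 : translate (supertile S (K + m) (fP F j)) x = om K T2.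
  rewrite (om_translate (F := F) hS); last exact: supertile_tl.
  by rewrite scalerA mulfV ?lt0r_neq0// scale1r /om -iterD.
rewrite e2 in hx.
have PoT2 : Pstar S (om K T2) := Pstar_om F hS K PT2.
have [l [a [Ta a0 aD]]] := cover_tile 0 OT.
rewrite sub0r normrN in aD.
have hw j' y : T (tl j' y) -> `|y| < w -> om K T2 (tl j' y).
  by move=> Ty yw; apply: hx; split=> //; exists j', y.
have : om K T2 (tl l a).
  apply: hw => //; apply: le_lt_trans aD _; rewrite /w.
  by have : 0 <= lam ^+ K * D by [rewrite mulr_ge0// ltW]; lra.
have T2tl t : T2 t -> exists i x, t = tl i x by exact: Pstar_tl.
move=> /(omE hS _ _ T2tl)[i' [x' [b [T2x Lb /(tl_inj hS)[_ eb]]]]].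
have sub : translate (supertile S K (fP F i')) (lam ^+ K *: x') `<=` T.
  move=> t' [t ht <-]; have [c [c2 e]] := supertile_tl ht; subst t.
  have Lc : Lam K i' (c, c2) by [].
  rewrite translate_tl; apply: (local_incl hS (Omega_Pstar OT) PoT2).
  - by apply/(omE hS _ _ T2tl); exists i', x', (c, c2).
  - by move=> z _; rewrite Omega_supp.
  move=> j' y Ty cy; apply: hw => //.
  have hb : `|lam ^+ K *: x'| <= D + lam ^+ K * D.
    have -> : lam ^+ K *: x' = a - b.2 by rewrite eb addrAC subrr add0r.
    by apply: le_trans (ler_normB _ _) _; rewrite lerD// (Lam_bound hS Lb).
  have hc := Lam_bound hS Lc; rewrite /= in hc.
  have : `|y| <= `|c2 + lam ^+ K *: x'| + `|c2 + lam ^+ K *: x' - y|.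
    by rewrite -{1}(subKr (c2 + lam ^+ K *: x') y) ler_normB.
  have := ler_normD c2 (lam ^+ K *: x').
  rewrite /w; lra.
have [z hz] := hN _ _ (fP_proto F i') (fP_proto F i).
exists (lam ^+ k *: z + lam ^+ K *: x') => t; rewrite -translateD => -[u hu <-].
apply: sub; exists u => //.
have -> : supertile S K (fP F i') = om k (supertile S N (fP F i')).
  by rewrite /K !supertileE -omD.
apply: (@om_sub _ _ _ _ k [set tl i z]); first by move=> _ ->.
have -> : [set tl i z] = translate [set tl i 0] z.
  by rewrite /translate image_set1 translate_tl add0r.
rewrite (om_translate (F := F) hS); last by move=> _ ->; exists i, 0.
by rewrite -supertileE.
Qed.

Lemma enorm_diameter_le T w : (forall z, supp T z -> `|z| <= w) ->
  (diameter (supp T) <= (d%:R * (w + w))%:E)%E.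
Proof.
move=> hw; apply: ge_ereal_sup => _ [x Tx [y Ty <-]].
rewrite lee_fin; apply: le_trans (enorm_le _) _; rewrite ler_wpM2l//.
by apply: le_trans (ler_normB _ _) _; rewrite lerD ?hw.
Qed.

Lemma diameter_translate T x : diameter (supp (translate T x)) = diameter (supp T).
Proof.
congr ereal_sup; apply/seteqP; split=> _ [y Ty [z Tz <-]].
  move: Ty Tz; rewrite !supp_translate => Ty Tz.
  exists (y - x) => //; exists (z - x) => //.
  by rewrite opprB addrA subrK.
exists (y + x); first by rewrite supp_translate addrK.
exists (z + x); first by rewrite supp_translate addrK.
by rewrite opprD addrACA subrr addr0.
Qed.

(** Finite local complexity speaks of the patches of one tiling [T0] up to translation. Every window
    of every tiling lies in a supertile and therefore occurs in [T0]; the tile with puncture 0 then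
    leaves finitely many choices for the translation. *)
Lemma local_patterns_finite w : finite_set [set cut T w | T in Omega_punc S].
Proof.
have [[T0 OT0]|none] := pselect (exists T, Omega_punc S T); last first.
  by rewrite (_ : [set _ | _ in _] = set0)//; apply/seteqP; split=> // t [T OT _]; apply: none; exists T.
(* A positive radius, so that the tile with puncture 0 belongs to the window. *)
pose w1 := Num.max w 1; have w10 : 0 < w1 by rewrite lt_max ltr01 orbT.
have [_ hF _ _] := hA.
(* Exceeds the Euclidean diameter of the window's support: tiles reach [D] beyond their punctures,
   and the factor [d] converts the sup norm. *)
pose rho : R := d%:R * ((w1 + D) + (w1 + D)) + 1.
have rho0 : 0 < rho by rewrite ltr_pwDr// mulr_ge0// addr_ge0// addr_ge0 ?D_ge0// ltW.
have [F0 [fF0 hF0]] := hF T0 rho OT0.1 rho0.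
(* All ways to put a puncture of a representative at the origin. The intersection with [finite_set]
   discards infinite members of [F0]. *)
pose B := \bigcup_(Q in F0 `&` @finite_set _) [set translate Q (- puncture S t) | t in Q].
have fB : finite_set B.
  apply: bigcup_finite; first exact: finite_setIl.
  by move=> Q [_ fQ]; exact: finite_image.
suff h T : Omega_punc S T -> B (cut T w1).
  apply: sub_finite_set (finite_image (fun Q => cut Q w) fB) => _ [T OT <-].
  exists (cut T w1); first exact: h.
  apply/seteqP; split=> t [].
    by case=> Tt _ ht; split.
  move=> Tt [i [x [e xw]]]; split; last by exists i, x.
  by split=> //; exists i, x; rewrite lt_max xw.
move=> /Omega_puncE[OT [i Ti]].
have fc := cut_finite w1 (Omega_Pstar OT).
have sc : cut T w1 `<=` T by move=> t [].
have [n [j [x hx]]] := Omega_patch OT fc sc.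
have [y hy] := supertile_in n j OT0.1.
pose Q := translate (cut T w1) (y - x).
have QT0 : Q `<=` T0.
  move=> t; rewrite /Q translateE opprB => /hx; rewrite translateE translate_tileD addrAC subrr add0r => h.
  by apply: hy; rewrite translateE.
have patchQ : is_patch Q.
  split; first exact: finite_image.
  by have [] := Pstar_sub F hS (Omega_Pstar OT0.1) QT0.
have diamQ : (diameter (supp Q) < rho%:E)%E.
  rewrite diameter_translate; apply: (@le_lt_trans _ _ (d%:R * ((w1 + D) + (w1 + D)))%:E).
    apply: enorm_diameter_le => z [t [_ [k [b [-> bw]]]] /tl_bound zb].
    rewrite -(subrK b z) addrC; apply: le_trans (ler_normD _ _) _.
    by rewrite lerD// ltW.
  by rewrite lte_fin ltrDl.
have [Q0 [u [FQ0 eQ]]] := hF0 Q patchQ QT0 diamQ.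
have eQ0 : cut T w1 = translate Q0 (u - (y - x)).
  by rewrite -(translateK (cut T w1) (y - x)) -/Q eQ translateD.
have ci : cut T w1 (tl i 0) by split=> //; exists i, 0; rewrite normr0.
exists Q0.
  split=> //; rewrite -(translateK Q0 u) -eQ.
  exact/finite_image/finite_image.
exists (tl i (y - x - u)).
  by move: ci; rewrite eQ0 translateE translate_tl add0r opprB.
by rewrite puncture_tl eQ0 opprB.
Qed.

Definition ulim (I : Type) (U : set_system I) (T : I -> set (tile R d L)) :=
  [set t | U [set i | T i t]].

Section Limits.
Context {I : Type} (U : set_system I) {UU : UltraFilter U}.
Variable T : I -> set (tile R d L).
Hypothesis UT : U [set i | Omega_punc S (T i)].

Lemma ulim_tl t : ulim U T t -> exists i x, t = tl i x.
Proof.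
move=> h; have [i [Ti [/Omega_Pstar/(Pstar_tl F) PT _]]] := filter_ex (filterI h UT).
exact: PT Ti.
Qed.

(** With finitely many patterns, the window of [T i] is the same for almost all [i], and this common
    window is that of the limit. *)
Lemma ulim_cut w : U [set i | cut (T i) w = cut (ulim U T) w].
Proof.
have [|Q _ UQ] := @ultra_pick _ _ U _ (fun i => cut (T i) w) _ (local_patterns_finite w).
  by apply: filterS UT => i OTi; exists (T i).
suff -> : cut (ulim U T) w = Q by [].
apply/seteqP; split=> t.
  case=> Ut ht; have [i [<- Tt]] := filter_ex (filterI UQ Ut).
  by split.
move=> Qt; split.
  by apply: filterS UQ => i e; have : cut (T i) w t by [rewrite e]; case.
have [i e] := filter_ex UQ.
by move: Qt; rewrite -e => -[].
Qed.

(** This is compactness of the punctured hull: each defining property concerns finitely many tiles,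
    and there the limit can be compared with a single [T i]. *)
Lemma ulim_Omega_punc : Omega_punc S (ulim U T).
Proof.
have PU : Pstar S (ulim U T).
  apply: (Pstar_intro (F := F)) => //; first exact: ulim_tl.
  move=> i x j y z Ux Uy xz yz.
  have [k [[Tx Ty] [OT _]]] := filter_ex (filterI (filterI Ux Uy) UT).
  exact: Pstar_meet (Omega_Pstar OT) Tx Ty xz yz.
have cut_ex w : exists k, Omega_punc S (T k) /\ cut (T k) w = cut (ulim U T) w.
  by have [k h] := filter_ex (filterI UT (ulim_cut w)); exists k.
apply/Omega_puncE; split.
  apply: Omega_intro => //.
    apply/seteqP; split=> // z _.
    have [k [[OTk _] e]] := cut_ex (`|z| + D + 1).
    have [i [x [Tx xz zx]]] := cover_tile z OTk.
    exists (tl i x) => //; suff : cut (ulim U T) (`|z| + D + 1) (tl i x) by case.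
    rewrite -e; split=> //; exists i, x; split=> //.
    rewrite -(subrK z x); apply: le_lt_trans (ler_normD _ _) _.
    by rewrite distrC in zx; lra.
  move=> Q fQ QU; have [i [h [OT _]]] : exists i, Q `<=` T i /\ Omega_punc S (T i).
    suff : U [set i | Q `<=` T i] by move=> /(filterI UT)/filter_ex[i [? ?]]; exists i.
    have fQ' : finite_set (Q : set {classic tile R d L}) by [].
    have : U (\bigcap_(t in [set` fset_set (Q : set {classic tile R d L})]) [set i | T i t]).
      by apply: filter_bigI => t; rewrite in_fset_set// inE => /QU.
    by apply: filterS => i h t Qt; apply: h; rewrite /= in_fset_set// inE.
  exact: Omega_patch OT fQ h.
have [k [/Omega_puncE[_ [i Ti]] e]] := cut_ex 1.
exists i; suff : cut (ulim U T) 1 (tl i 0) by case.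
by rewrite -e; split=> //; exists i, 0; rewrite normr0.
Qed.

End Limits.

End Hull.

(** * Supertile addresses and recognizability *)

Section Addresses.
Context {R : realType} {d : nat} {L : Type} {S : tiling_data R d L}.
Context (F : frame S) (hS : substitution_tiling_system S).
Context (hA : standing_assumptions S) (hd : (1 <= d)%N).
Local Notation V := 'cV[R]_d.
Local Notation lam := (scale S).
Local Notation r := (fr F).
Local Notation om := (@om R d L S).
Local Notation tl := (@tl R d L S F).
Local Notation Lam := (@Lam R d L S F).
Implicit Types (t u : tile R d L) (T Q : set (tile R d L)) (x y z : V).

Local Notation address := ('I_(fm F) * V)%type.

Lemma lamX_gt0 n : 0 < lam ^+ n.
Proof. exact/exprn_gt0/(lam_gt0 hS). Qed.

Lemma lamXK n x : lam ^+ n *: (lam ^- n *: x) = x.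
Proof. by rewrite scalerA mulfV ?scale1r// gt_eqF// lamX_gt0. Qed.

Lemma lamXVK n x : lam ^- n *: (lam ^+ n *: x) = x.
Proof. by rewrite scalerA mulVf ?scale1r// gt_eqF// lamX_gt0. Qed.

(* The address [(i, x)] says that the tile of [T] with puncture 0 sits at
   position [x] inside a level-n supertile of type [i]. *)
Definition Addr n T (a : address) := exists T1,
  [/\ Omega S T1, om n T1 = T, T1 (tl a.1 (- (lam ^- n *: a.2))) &
      exists j, Lam n a.1 (j, a.2)].

Definition addresses n : set address := [set a | exists j, Lam n a.1 (j, a.2)].

Lemma addresses_finite n : finite_set (addresses n).
Proof.
suff : finite_set (\bigcup_(i in [set: 'I_(fm F)]) [set (i, b.2) | b in Lam n i]).
  apply: sub_finite_set => -[i x] [j Lj]; exists i => //; by exists (j, x).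
apply: bigcup_finite => [|i _]; first exact: finite_finset.
exact/finite_image/(Lam_finite hS).
Qed.

Lemma Addr_addresses n T a : Addr n T a -> addresses n a.
Proof. by case=> T1 []. Qed.

(** The preimages [T1 i] have an ultralimit whose image under [om n] lies in the ultralimit of the
    [T i]; both are tilings, so they are equal. *)
Lemma Addr_ulim (I : Type) (U : set_system I) (T : I -> set (tile R d L)) n a :
  UltraFilter U -> U [set i | Omega_punc S (T i)] -> U [set i | Addr n (T i) a] ->
  Addr n (ulim U T) a.
Proof.
move=> UU UT Ua; set y := lam ^- n *: a.2.
have /choice[T1 hT1] : forall i, exists T1, Addr n (T i) a ->
    [/\ Omega S T1, om n T1 = T i & T1 (tl a.1 (- y))].
  move=> i; have [[T1 [? ? ? _]]|] := pselect (Addr n (T i) a); first by exists T1.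
  by exists set0.
(* The preimages need not have a puncture at 0. The shift by [y] moves the puncture of the parent
   tile there, so that the compactness of the punctured hull applies. *)
pose T2 i := translate (T1 i) y.
have UT2 : U [set i | Omega_punc S (T2 i)].
  apply: filterS Ua => i /hT1[OT1 _ h1]; apply/(Omega_puncE F hS); split.
    exact: (Omega_translate F hS).
  by exists a.1; rewrite /T2 translateE translate_tl add0r.
have [OU _] := ulim_Omega_punc F hS hA hd UT2.
exists (translate (ulim U T2) (- y)); split.
- exact: (Omega_translate F hS).
- apply: (tiling_eq F hS).
  + exact/Omega_Pstar/(Omega_om F hS)/(Omega_translate F hS).
  + exact/Omega_supp/(Omega_om F hS)/(Omega_translate F hS).
  + by case: (ulim_Omega_punc F hS hA hd UT) => /Omega_Pstar.
  + have OU' : Omega S (translate (ulim U T2) (- y)) by exact: (Omega_translate F hS).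
    move=> u /(omE hS _ _ (fun t => Omega_tl F OU'))[i [x [b [h Lb ->]]]].
    move: h; rewrite translateE translate_tl opprK => h.
    apply: filterS (filterI Ua h) => k [/hT1[OT1 e1 _]].
    rewrite /= /T2 -e1 translateE translate_tl addrK => hx.
    by apply/(omE hS _ _ (fun t => Omega_tl F OT1)); exists i, x, b.
- rewrite translateE translate_tl opprK addNr.
  apply: filterS Ua => k /hT1[OT1 _ h1].
  by rewrite /T2 /= translateE translate_tl add0r.
- by have [k /Addr_addresses] := filter_ex Ua.
Qed.

Lemma ultra_nat : exists U : set_system nat, UltraFilter U /\ forall n, U [set k | (n <= k)%N].
Proof.
have [U [UU sU]] := @ultraFilterLemma nat \oo _.
by exists U; split=> // n; apply: sU; exact: nbhs_infty_ge.
Qed.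

(** The window lies in a supertile of level [n + m], the image under [om n] of one of level [m]; the
    latter occurs in a translate of [T], which serves as [T1]. *)
Lemma cut_om_Omega T w n : Omega S T -> exists T1, Omega S T1 /\ cut F T w `<=` om n T1.
Proof.
move=> OT; have [m [i [x hx]]] := cut_deep F hS hd w n OT.
have [y hy] := supertile_in hS hA hd m i OT.
exists (translate T (lam ^- n *: x - y)); split; first exact: (Omega_translate F hS).
apply: (subset_trans hx).
have -> : translate (supertile S (n + m) (fP F i)) x =
    om n (translate (supertile S m (fP F i)) (lam ^- n *: x)).
  rewrite (om_translate (F := F) hS) ?lamXK; last exact: (supertile_tl hS).
  by rewrite !supertileE -omD.
apply: om_sub => t; rewrite !translateE => ht; apply: hy.
by rewrite translateE translate_tileD opprB addrAC subrr add0r in ht *.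
Qed.

Lemma tile_at_puncture n T i : Omega S T -> om n T (tl i 0) -> exists a, Addr n (om n T) a.
Proof.
move=> OT /(omE hS _ _ (fun t => Omega_tl F OT))[j [x [b [Tx Lb /(tl_inj hS)[eb e0]]]]].
exists (j, b.2), T; split=> //=; last by exists b.1; case: (b) Lb.
have -> : b.2 = - (lam ^+ n *: x) by apply/eqP; rewrite -addr_eq0 -e0.
by rewrite scalerN lamXVK opprK.
Qed.

(** Surjectivity of the substitution on the hull: [T] is the ultralimit of tilings [om n (T1 k)]
    that contain its growing windows, and their addresses, taken from a finite set, pass to the
    limit. *)
Lemma Addr_exists n T : Omega_punc S T -> exists a, Addr n T a.
Proof.
move=> /(Omega_puncE F hS)[OT [i Ti]].
have [U [UU Uge]] := ultra_nat.
(* The radius [k.+1] keeps the tile with puncture 0 inside every window, including the first. *)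
have /choice[T1 hT1] : forall k : nat, exists T1, Omega S T1 /\ cut F T k.+1%:R `<=` om n T1.
  by move=> k; exact: cut_om_Omega.
have hi k : om n (T1 k) (tl i 0).
  by have [_] := hT1 k; apply; split=> //; exists i, 0; rewrite normr0 ltr0Sn.
have /choice[a ha] : forall k, exists a, Addr n (om n (T1 k)) a.
  by move=> k; apply: (tile_at_puncture _ (hi k)); case: (hT1 k).
have [|b _ Ub] := ultra_pick (f := a) UU (addresses_finite n).
  by apply: filterE => k; exact: Addr_addresses (ha k).
have UO : U [set k | Omega_punc S (om n (T1 k))].
  apply: filterE => k; apply/(Omega_puncE F hS); split; last by exists i.
  by apply: (Omega_om F hS); case: (hT1 k).
exists b.
suff -> : T = ulim U (fun k => om n (T1 k)).
  apply: Addr_ulim => //; apply: filterS Ub => k <-; exact: ha.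
apply: (tiling_eq F hS); first exact: Omega_Pstar.
- exact: (Omega_supp OT).
- by case: (ulim_Omega_punc F hS hA hd UO) => /Omega_Pstar.
- move=> t Tt; have [j [x e]] := Omega_tl F OT Tt; subst t.
  apply: filterS (Uge (Num.truncn `|x|)) => k xk.
  have [_] := hT1 k; apply; split=> //; exists j, x; split=> //.
  by apply: lt_le_trans (truncnS_gt _) _; rewrite ler_nat ltnS.
Qed.

Lemma om_inj n T T' : Omega S T -> Omega S T' -> om n T = om n T' -> T = T'.
Proof.
move=> OT OT'; elim: n => [//|n IHn] e; apply: IHn; have [_ _ inj _] := hA.
by apply: inj => //; exact: (Omega_om F hS).
Qed.

Lemma address_interior n a T1 : addresses n a -> T1 (tl a.1 (- (lam ^- n *: a.2))) ->
  (tl a.1 (- (lam ^- n *: a.2))).2^° 0.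
Proof. by move=> [j /(Lam_supp hS)] /= ? _; rewrite interior_tl opprK add0r. Qed.

(** Injectivity yields one common preimage, in which both parent tiles have the origin in their
    interior. *)
Lemma Addr_uniq n T a b : Addr n T a -> Addr n T b -> a = b.
Proof.
move=> [T1 [OT1 e1 h1 a1]] [T2 [OT2 e2 h2 a2]].
have e : T1 = T2 by apply: (@om_inj n) => //; rewrite e1.
subst T2; have [] := tl_inj hS (Pstar_meet (z := 0) (Omega_Pstar OT1) h1 h2 _ _).
- exact: (@address_interior n a T1).
- exact: (@address_interior n b T1).
case: a b {h1 h2 a1 a2} => [i x] [j y] /= -> /oppr_inj xy; congr (_, _).
by rewrite -(lamXK n x) xy lamXK.
Qed.

(* A period [z] of [T] gives the period [lam^-n z] of its preimage under [om n],
   too small to move a tile off itself. *)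
Lemma aperiodic T z : Omega S T -> translate T z = T -> z = 0.
Proof.
move=> OT Tz; have [i [x [Tx _ _]]] := cover_tile F 0 OT.
pose T' := translate T (- x).
have OT' : Omega_punc S T'.
  apply/(Omega_puncE F hS); split; first exact: (Omega_translate F hS).
  by exists i; rewrite /T' translateE translate_tl opprK add0r.
have Tz' : translate T' z = T' by rewrite /T' translateD addrC -translateD Tz.
have [n hn] : exists n, lam ^- n * `|z| < r.
  have l1 : `|lam^-1| < 1.
    by rewrite ger0_norm ?invf_lt1 ?invr_ge0 ?(ltW (lam_gt0 hS)) ?(lam_gt0 hS)// (scale_gt1 hS).
  have /cvgrPdist_lt/(_ _ (fr_gt0 F))[N _ hN] := cvg_geometric `|z| l1.
  exists N; have := hN N (leqnn N).
  rewrite sub0r normrN /geometric /= exprVn mulrC ger0_norm//.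
  by rewrite mulr_ge0// invr_ge0 ltW// lamX_gt0.
have [a [T1 [OT1 e1 h1 _]]] := Addr_exists n OT'.
have e : T1 = translate T1 (lam ^- n *: z).
  apply: (@om_inj n) => //; first exact: (Omega_translate F hS).
  by rewrite (om_translate (F := F) hS) ?lamXK ?e1 ?Tz'// => t; exact: (Omega_tl F OT1).
have h2 : T1 (tl a.1 (- (lam ^- n *: a.2) + lam ^- n *: z)).
  by rewrite e translateE translate_tl addrK.
have [] := Pstar_sep hS (Omega_Pstar OT1) h1 h2.
  rewrite opprD addrA subrr add0r normrN normrZ ger0_norm//.
  by rewrite invr_ge0 ltW// lamX_gt0.
move=> _ /eqP; rewrite -subr_eq0 opprD addrA subrr add0r oppr_eq0 scaler_eq0.
by rewrite invr_eq0 gt_eqF ?lamX_gt0//= => /eqP.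
Qed.

(* By compactness: an ultralimit of counterexamples is a tiling with two addresses. *)
Lemma recognizability n : exists w, forall T T' a, Omega_punc S T -> Omega_punc S T' ->
  cut F T w `<=` T' -> Addr n T a -> Addr n T' a.
Proof.
apply: contrapT => none.
have /choice[f hf] : forall k : nat, exists q : set (tile R d L) * set (tile R d L) * (address * address),
    [/\ Omega_punc S q.1.1, Omega_punc S q.1.2 &
     [/\ cut F q.1.1 k%:R `<=` q.1.2, Addr n q.1.1 q.2.1, Addr n q.1.2 q.2.2 & q.2.1 <> q.2.2]].
  move=> k; apply: contrapT => nk; apply: none; exists k%:R => T T' a OT OT' c ha.
  have [b hb] := Addr_exists n OT'.
  have [<-//|ab] := pselect (b = a).
  by exfalso; apply: nk; exists ((T, T'), (a, b)); split=> //; split=> //= /esym.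
have [U [UU Uge]] := ultra_nat.
pose T k := (f k).1.1; pose T' k := (f k).1.2.
have UT : U [set k | Omega_punc S (T k)] by apply: filterE => k; case: (hf k).
have UT' : U [set k | Omega_punc S (T' k)] by apply: filterE => k; case: (hf k).
have [|a _ Ua] := ultra_pick (f := fun k => (f k).2.1) UU (addresses_finite n).
  by apply: filterE => k; case: (hf k) => _ _ [_ /Addr_addresses].
have [|b _ Ub] := ultra_pick (f := fun k => (f k).2.2) UU (addresses_finite n).
  by apply: filterE => k; case: (hf k) => _ _ [_ _ /Addr_addresses].
have Aa : Addr n (ulim U T) a.
  by apply: Addr_ulim => //; apply: filterS Ua => k <-; case: (hf k) => _ _ [].
have Ab : Addr n (ulim U T') b.
  by apply: Addr_ulim => //; apply: filterS Ub => k <-; case: (hf k) => _ _ [].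
have [OU _] := ulim_Omega_punc F hS hA hd UT.
have [OU' _] := ulim_Omega_punc F hS hA hd UT'.
have e : ulim U T = ulim U T'.
  apply: (tiling_eq F hS); [exact: Omega_Pstar|exact: (Omega_supp OU)|exact: Omega_Pstar|].
  move=> t Ut; have [j [x e]] := Omega_tl F OU Ut; subst t.
  apply: filterS (filterI Ut (Uge (Num.truncn `|x|).+1)) => k [Tk xk].
  have [_ _ [c _ _ _]] := hf k; apply: c; split=> //; exists j, x; split=> //.
  by apply: lt_le_trans (truncnS_gt _) _; rewrite ler_nat.
have ab : a = b by apply: (@Addr_uniq n (ulim U T)) => //; rewrite e.
have [k [ea eb]] := filter_ex (filterI Ua Ub).
by have [_ _ [_ _ _]] := hf k; rewrite ea eb.
Qed.

End Addresses.

(* Doeblin's argument: over [N] substitution steps the stochastic matrices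
   [M i j * h n i / h (n + N) j] have entries bounded below, hence contract the
   weighted l^1 norm of [v n - v' n] by a constant factor. *)
Lemma weights_unique (R : realType) (m N : nat) (h : nat -> 'I_m -> R) (M : 'I_m -> 'I_m -> R)
    (v v' : nat -> 'I_m -> R) :
  (forall n i, 0 < h n i) -> (forall i j, 1 <= M i j) ->
  (forall n j, h (n + N)%N j = \sum_i M i j * h n i) ->
  (forall n i, 0 <= v n i) -> (forall n i, 0 <= v' n i) ->
  (forall n, \sum_i h n i * v n i = 1) -> (forall n, \sum_i h n i * v' n i = 1) ->
  (forall n i, v n i = \sum_j M i j * v (n + N)%N j) ->
  (forall n i, v' n i = \sum_j M i j * v' (n + N)%N j) ->
  forall n i, (N <= n)%N -> v n i = v' n i.
Proof.
move=> h0 M1 hM v0 v'0 hv hv' vM v'M.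
pose C := \big[Num.max/1]_(ij : 'I_m * 'I_m) M ij.1 ij.2.
have C1 : 1 <= C by exact: bigmax_ge_id.
have MC i j : M i j <= C by exact: (@le_bigmax _ _ _ 1 (fun ij => M ij.1 ij.2) (i, j)).
pose H n := \sum_i h n i.
have hH n j : h (n + N)%N j <= C * H n.
  by rewrite hM mulr_sumr; apply: ler_sum => i _; rewrite ler_wpM2r// ltW.
have Hh n j : H n <= h (n + N)%N j.
  by rewrite hM; apply: ler_sum => i _; rewrite ler_peMl// ltW.
(* All entries of [h n] are comparable, since each lies between [H (n - N)] and [C * H (n - N)].
   Going back [N] steps is what requires [N <= n]. *)
have compare n i j : (N <= n)%N -> h (n + N)%N j <= C * (m%:R * C) * h n i.
  move=> Nn; apply: le_trans (hH _ _) _; rewrite -mulrA ler_wpM2l//; first exact: le_trans C1.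
  apply: (@le_trans _ _ (\sum_(k < m) C * h n i)); last first.
    by rewrite sumr_const card_ord -[leLHS]mulr_natl mulrA.
  apply: ler_sum => k _; rewrite -(subnK Nn); apply: le_trans (hH _ _) _.
  by rewrite ler_wpM2l//; exact: le_trans C1.
pose D n := \sum_i h n i * `|v n i - v' n i|.
have D0 n : 0 <= D n by apply: sumr_ge0 => i _; rewrite mulr_ge0// ltW.
have D2 n : D n <= 2.
  have -> : (2 : R) = \sum_i h n i * v n i + \sum_i h n i * v' n i by rewrite hv hv'.
  rewrite -big_split /=; apply: ler_sum => i _; rewrite -mulrDr ler_wpM2l ?(ltW (h0 _ _))//.
  by apply: le_trans (ler_normB _ _) _; rewrite !ger0_norm.
move=> n0 i0 Nn0; have m0 : (0 < m)%N by apply: leq_ltn_trans (ltn_ord i0).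
pose c := (C * (m%:R * C))^-1.
have c0 : 0 < c by rewrite invr_gt0 !mulr_gt0 ?ltr0n// (lt_le_trans _ C1).
pose rho := 1 - m%:R * c.
have rho1 : rho < 1 by rewrite gtrBl mulr_gt0// ltr0n.
have rho0 : 0 <= rho.
  rewrite subr_ge0 /c ler_pdivrMr ?mul1r; last by rewrite -invr_gt0.
  have -> : C * (m%:R * C) = m%:R * (C * C) by ring.
  by rewrite ler_peMr// mulr_ege1.
have contract n : (N <= n)%N -> D n <= rho * D (n + N)%N.
  move=> Nn; set w := fun j => v (n + N)%N j - v' (n + N)%N j.
  (* Equal normalizations make the difference have total mass zero, so [c * h (n + N) j] can be
     subtracted from every coefficient without changing the sum; this produces the factor [rho]. *)
  have w0 : \sum_j h (n + N)%N j * w j = 0.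
    under eq_bigr do rewrite mulrBr.
    by rewrite sumrB hv hv' subrr.
  have hb i j : 0 <= h n i * M i j - c * h (n + N)%N j.
    rewrite subr_ge0; apply: (@le_trans _ _ (h n i)); last by rewrite ler_peMr// ltW.
    rewrite /c ler_pdivrMl; last by rewrite -invr_gt0.
    exact: compare.
  apply: (@le_trans _ _ (\sum_i \sum_j (h n i * M i j - c * h (n + N)%N j) * `|w j|)).
    apply: ler_sum => i _.
    have -> : h n i * `|v n i - v' n i| = `|\sum_j (h n i * M i j - c * h (n + N)%N j) * w j|.
      rewrite -{1}(gtr0_norm (h0 n i)) -normrM; congr `|_|.
      transitivity (\sum_j h n i * M i j * w j - c * \sum_j h (n + N)%N j * w j).
        rewrite w0 mulr0 subr0 vM v'M -sumrB mulr_sumr; apply: eq_bigr => j _.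
        by rewrite /w mulrBr mulrBr !mulrA -mulrBr.
      rewrite mulr_sumr -sumrB; apply: eq_bigr => j _; ring.
    apply: le_trans (ler_norm_sum _ _ _) _; apply: ler_sum => j _.
    by rewrite normrM (ger0_norm (hb _ _)).
  rewrite exchange_big /= /D mulr_sumr; apply: ler_sum => j _.
  rewrite -mulr_suml sumrB mulrA ler_wpM2r// /rho mulrBl mul1r hM.
  under [X in X - _]eq_bigr do rewrite mulrC.
  by rewrite sumr_const card_ord -[(c * _) *+ m]mulr_natl mulrA.
(* The contraction runs from high levels down, so the a priori bound 2 at level [n0 + k * N] forces
   the difference at [n0] to vanish. *)
have small k : D n0 <= rho ^+ k * 2.
  have : D n0 <= rho ^+ k * D (n0 + k * N)%N.
    elim: k => [|k IHk]; first by rewrite mul0n addn0 expr0 mul1r.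
    apply: le_trans IHk _; rewrite exprSr -mulrA ler_wpM2l ?exprn_ge0//.
    by rewrite mulSnr addnA; apply: contract; rewrite (leq_trans Nn0)// leq_addr.
  by move=> /le_trans; apply; rewrite ler_wpM2l ?exprn_ge0.
have Dn0 : D n0 = 0.
  apply/eqP; rewrite eq_le D0 andbT; apply/ler_addgt0Pl => e e0; rewrite addr0.
  have r1 : `|rho| < 1 by rewrite ger0_norm.
  have /cvgrPdist_lt/(_ _ e0)[k _ /(_ k (leqnn k))] := cvg_geometric (2 : R) r1.
  rewrite sub0r normrN /geometric /= => hk; apply: le_trans (small k) (ltW _).
  by rewrite mulrC; apply: le_lt_trans (ler_norm _) hk.
move/eqP: Dn0; rewrite psumr_eq0 => [/allP/(_ i0)|i _]; last by rewrite mulr_ge0// ltW.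
rewrite mem_index_enum => /(_ isT) /implyP /(_ isT).
by rewrite mulf_eq0 gt_eqF//= normr_eq0 subr_eq0 => /eqP.
Qed.

(** * Counting tiles in supertiles *)

Section Counting.
Context {R : realType} {d : nat} {L : Type} {S : tiling_data R d L}.
Context (F : frame S) (hS : substitution_tiling_system S).
Context (hA : standing_assumptions S) (hd : (1 <= d)%N).
Local Notation V := 'cV[R]_d.
Local Notation lam := (scale S).
Local Notation r := (fr F).
Local Notation D := (fD F).
Local Notation om := (@om R d L S).
Local Notation tl := (@tl R d L S F).
Local Notation Lam := (@Lam R d L S F).
Local Notation address := ('I_(fm F) * V)%type.
Implicit Types (T : set (tile R d L)) (x y z : V).

Definition LamF n i : {fset address} := fset_set (Lam n i).

Lemma in_LamF n i a : (a \in LamF n i) = `[< Lam n i a >].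
Proof. by rewrite in_fset_set ?inE//; exact: Lam_finite. Qed.

Lemma LamFP n i a : reflect (Lam n i a) (a \in LamF n i).
Proof. by rewrite in_LamF; exact: asboolP. Qed.

Lemma Lam_add n k j c : Lam (n + k) j c <->
  exists a b, [/\ Lam k j a, Lam n a.1 b & c = (b.1, b.2 + lam ^+ n *: a.2)].
Proof.
have htl t : supertile S k (fP F j) t -> exists i x, t = tl i x by exact: supertile_tl.
have -> : Lam (n + k) j c <-> om n (supertile S k (fP F j)) (tl c.1 c.2).
  by rewrite /Lam /adr /= !supertileE -omD.
rewrite (omE hS n _ htl); split.
  move=> [i [x [b [hx Lb /(tl_inj hS)[e1 e2]]]]]; exists (i, x), b; split=> //.
  by case: c e1 e2 => ? ? /= -> ->.
by move=> [a [b [La Lb ->]]]; exists a.1, a.2, b.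
Qed.

(** Scaled back by [lam ^- n], the puncture is an interior point of its parent tile, which is
    thereby determined. *)
Lemma Lam_add_inj n k j a b a' b' : Lam k j a -> Lam n a.1 b -> Lam k j a' -> Lam n a'.1 b' ->
  b.1 = b'.1 -> b.2 + lam ^+ n *: a.2 = b'.2 + lam ^+ n *: a'.2 -> a = a' /\ b = b'.
Proof.
move=> La /[dup] Lb /(Lam_supp hS) ib La' /(Lam_supp hS) ib' e1 e2.
have ha (c c' : address) : lam ^- n *: (c.2 + lam ^+ n *: c'.2) - c'.2 = lam ^- n *: c.2.
  by rewrite scalerDr (lamXVK hS) addrK.
have [] := tl_inj hS (Pstar_meet (z := lam ^- n *: (b.2 + lam ^+ n *: a.2))
    (Pstar_supertile hS k j) La La' _ _).
- by rewrite interior_tl ha.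
- by rewrite interior_tl e2 ha.
move: a a' b b' e1 e2 {La La' Lb ib ib' ha} => [i x] [i' x'] [l y] [l' y'] /= -> e2 -> ex.
by move: e2; rewrite ex => /addIr ->.
Qed.

Lemma big_LamF_add (W : nmodType) (f : address -> W) n k j :
  \sum_(c <- LamF (n + k) j) f c =
  \sum_(a <- LamF k j) \sum_(b <- LamF n a.1) f (b.1, b.2 + lam ^+ n *: a.2).
Proof.
transitivity (\sum_(c <- [seq (b.1, b.2 + lam ^+ n *: a.2) | a <- LamF k j, b <- LamF n a.1]) f c).
  2: by rewrite big_allpairs_dep.
apply: perm_big; apply: uniq_perm; first exact: fset_uniq.
  apply: allpairs_uniq_dep; [exact: fset_uniq|by move=> a _; exact: fset_uniq|].
  move=> [a b] [a' b'] /allpairsPdep[a1 [b1 [/LamFP La /LamFP Lb /= [? ?]]]].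
  move=> /allpairsPdep[a2 [b2 [/LamFP La' /LamFP Lb' /= [? ?]]]] [e1 e2]; subst.
  by have [-> ->] := Lam_add_inj La Lb La' Lb' e1 e2.
move=> c; apply/LamFP/allpairsPdep => [/Lam_add[a [b [La Lb ->]]]|].
  by exists a, b; split=> //; exact/LamFP.
by move=> [a [b [/LamFP La /LamFP Lb ->]]]; apply/Lam_add; exists a, b.
Qed.

(** In the language of towers, [hgt n i] is the height of the tower of type [i], and [mult k i j] is
    an entry of the k-th power of the substitution matrix. *)
Definition hgt n i : nat := #|` LamF n i|.
Definition mult k i j : nat := count (fun a : address => a.1 == i) (LamF k j).

Lemma sum_by_type (W : nmodType) (f : 'I_(fm F) -> W) k j :
  \sum_(a <- LamF k j) f a.1 = \sum_i f i *+ mult k i j.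
Proof.
rewrite /mult; elim: (enum_fset (LamF k j)) => [|a s IHs].
  by rewrite big_nil big1.
rewrite big_cons IHs (bigD1 a.1) //= [in RHS](bigD1 a.1) //= eqxx add1n mulrS.
rewrite addrA; congr (_ + _); apply: eq_bigr => i /negbTE ia.
by rewrite eq_sym ia.
Qed.

Lemma hgtE n i : (hgt n i)%:R = \sum_(a <- LamF n i) 1 :> R.
Proof. by rewrite big_const_seq count_predT iter_addr addr0. Qed.

Lemma hgt_add n k j : (hgt (n + k) j)%:R = \sum_i (mult k i j)%:R * (hgt n i)%:R :> R.
Proof.
rewrite hgtE (big_LamF_add (fun=> 1)).
under eq_bigr do rewrite -hgtE.
rewrite (sum_by_type (fun i => (hgt n i)%:R)); apply: eq_bigr => i _.
by rewrite mulr_natl.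
Qed.

Lemma mult_ge1 k i j : (exists x, Lam k j (i, x)) -> (1 <= mult k i j)%N.
Proof.
by move=> [x /LamFP Lx]; rewrite -has_count; apply/hasP; exists (i, x).
Qed.

Lemma supertile_cover n i z : (fP F i).2 (lam ^- n *: z) ->
  exists2 a, Lam n i a & `|z - a.2| <= D.
Proof.
rewrite -(supp_supertile hS) => -[t ht tz].
have [j [x e]] := supertile_tl hS ht; subst t.
by exists (j, x) => //; exact: tl_bound tz.
Qed.

Lemma hgt_gt0 n i : (0 < hgt n i)%N.
Proof.
have [|a /LamFP La _] := @supertile_cover n i 0.
  by rewrite scaler0; apply: fP_ball; rewrite normr0; exact: fr_gt0.
by rewrite cardfs_gt0; apply/fset0Pn; exists a.
Qed.

Lemma size_union_bound (A B : eqType) (P : A -> B -> bool) (N : nat) (s : seq A) (t : seq B) :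
  (forall b, b \in t -> exists2 a, a \in s & P a b) ->
  (forall a, a \in s -> (count (P a) t <= N)%N) -> (size t <= size s * N)%N.
Proof.
elim: s t => [|a s IHs] t cov cnt.
  by case: t cov {cnt} => // b t /(_ b (mem_head _ _))[].
rewrite -(count_predC (P a)) mulSn leq_add ?cnt ?mem_head//.
rewrite -size_filter; apply: IHs => [b|a' sa'].
  rewrite mem_filter /= => /andP[nPab tb]; have [a'] := cov b tb.
  by rewrite inE => /orP[/eqP ->|]; [rewrite (negbTE nPab)|exists a'].
rewrite count_filter; apply: leq_trans (cnt a' _); last by rewrite inE sa' orbT.
by apply: sub_count => b /= /andP[].
Qed.

Lemma lamX_large (B : R) : exists n0 : nat, forall n, (n0 <= n)%N -> B <= lam ^+ n.
Proof.
have l0 := lam_gt0 hS.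
have l1 : `|lam^-1| < 1.
  by rewrite ger0_norm ?invf_lt1 ?invr_ge0 ?(ltW l0)// (scale_gt1 hS).
have /cvgrPdist_lt/(_ _ ltr01)[n0 _ hn] := cvg_geometric B l1.
exists n0 => n /hn; rewrite sub0r normrN /geometric /= exprVn => h.
have := le_lt_trans (ler_norm _) h.
by rewrite ltr_pdivrMr ?mul1r ?(lamX_gt0 hS)// => /ltW.
Qed.

(** The last point of the segment in [A] is a boundary point: [A] is closed, and at an interior
    point the segment would stay in [A] a little longer. *)
Lemma segment_boundary (A : set V) x z : closed A -> A x -> ~ A^° z ->
  exists2 t : R, 0 <= t <= 1 & boundary A (x + t *: (z - x)).
Proof.
move=> cA Ax nAz; set g := fun t : R => x + t *: (z - x).
have gB (s t : R) : `|g s - g t| = `|s - t| * `|z - x|.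
  by rewrite /g opprD addrACA subrr add0r -scalerBl normrZ.
pose E := [set t : R | 0 <= t <= 1 /\ A (g t)].
have E0 : E 0 by split; [rewrite lexx ler01|rewrite /g scale0r addr0].
have supE : has_sup E by split; [exists 0|exists 1 => t [/andP[]]].
pose s := sup E.
have s0 : 0 <= s by apply: ub_le_sup => //; case: supE.
have s1 : s <= 1 by apply: ge_sup; [exists 0|move=> t [/andP[]]].
have zx0 : 0 < `|z - x| + 1 by rewrite ltr_wpDl.
have As : A (g s).
  apply: cA => B /nbhs_ballP[e e0 eB].
  have e1 : 0 < e / (`|z - x| + 1) by rewrite divr_gt0.
  have [t [Et At] st] := sup_adherent e1 supE.
  exists (g t); split=> //; apply: eB; rewrite -ball_normE /= gB.
  have ts : t <= s by apply: ub_le_sup; [case: supE|split].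
  rewrite ger0_norm ?subr_ge0//; rewrite -/s in st.
  apply: (@le_lt_trans _ _ (e / (`|z - x| + 1) * `|z - x|)).
    by rewrite ler_wpM2r//; lra.
  by rewrite mulrAC ltr_pdivrMr// ltr_pM2l// ltrDl.
have zE : x + (z - x) = z by rewrite addrC subrK.
exists s; first by rewrite s0 s1.
split; first exact: subset_closure.
move=> /interior_ballP[e e0 eA].
have sl1 : s < 1.
  rewrite lt_neqAle s1 andbT; apply/eqP => e1; apply: nAz; apply/interior_ballP.
  by exists e => // u zu; apply: eA; rewrite e1 scale1r zE.
pose dl := Num.min (1 - s) (e / (`|z - x| + 1) / 2).
have dl0 : 0 < dl by rewrite lt_min subr_gt0 sl1 !divr_gt0.
have : s + dl <= s.
  apply: ub_le_sup; first by case: supE.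
  split.
    rewrite addr_ge0 ?(ltW dl0)//= -lerBrDl.
    by rewrite /dl ge_min lexx.
  apply: eA; rewrite gB opprD addrA subrr sub0r normrN gtr0_norm//.
  apply: (@le_lt_trans _ _ (e / (`|z - x| + 1) / 2 * `|z - x|)).
    by rewrite ler_wpM2r// ge_min lexx orbT.
  rewrite -mulrA mulrAC ltr_pdivrMr// ltr_pM2l//.
  by have : 0 <= `|z - x| by []; lra.
by rewrite gerDl leNgt dl0.
Qed.

(* Grid points at mutual distance more than [2 D] lie in distinct tiles. *)
Lemma hgt_lower : exists2 c : R, 0 < c & exists n0, forall n, (n0 <= n)%N -> forall i,
  (c * lam ^+ n) ^+ d <= (hgt n i)%:R.
Proof.
pose E := 3 * (D + 1).
have D0 := D_ge0 F; have r0 := fr_gt0 F.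
have E0 : 0 < E by rewrite /E; lra.
(* The factor 1/2 absorbs the rounding of [lam ^+ n * r / E] down to the integer [q], once
   [c * lam ^+ n] is at least 1. *)
pose c := r / E / 2; have c0 : 0 < c by rewrite !divr_gt0.
exists c => //; have [n0 hn0] := lamX_large c^-1; exists n0 => n /hn0 hn i.
have l0 := lamX_gt0 hS n.
have cl : 1 <= c * lam ^+ n by rewrite -ler_pdivrMl// mulr1.
have lr0 : 0 <= lam ^+ n * r / E by rewrite !mulr_ge0 ?invr_ge0 ?ltW.
have [q [q1 q2]] : exists q : nat, q%:R <= lam ^+ n * r / E /\ lam ^+ n * r / E < q.+1%:R.
  by have /andP[] := truncn_itv lr0; exists (Num.truncn (lam ^+ n * r / E)).
have eqc : lam ^+ n * r / E = 2 * (c * lam ^+ n) by rewrite /c; field; rewrite gt_eqF.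
apply: (@le_trans _ _ ((q ^ d)%N%:R)).
  rewrite natrX lerXn2r ?nnegrE ?ler0n//; first by rewrite mulr_ge0// ltW.
  by move: q2; rewrite eqc mulrS; lra.
rewrite ler_nat.
pose pt (g : {ffun 'I_d -> 'I_q}) : V := \col_k (E * (g k)%:R).
have hpt g : exists a, Lam n i a /\ `|pt g - a.2| <= D.
  have [|a La pa] := @supertile_cover n i (pt g); last by exists a.
  apply: fP_ball; rewrite normrZ gtr0_norm ?invr_gt0// ltr_pdivrMl//.
  apply: mx_norm_lt => [|k]; first by rewrite mulr_gt0.
  rewrite mxE ger0_norm; last by rewrite mulr_ge0 ?ler0n// ltW.
  apply: (@lt_le_trans _ _ (E * q%:R)); first by rewrite ltr_pM2l// ltr_nat.
  by rewrite mulrC -ler_pdivlMr.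
have /choice[f hf] := hpt.
have finj : injective f.
  move=> g g' e; apply/ffunP => k; apply: ord_inj.
  have dist : `|pt g - pt g'| <= D + D.
    have [_ h1] := hf g; have [_ h2] := hf g'; rewrite e in h1.
    rewrite -(subrK (f g').2 (pt g)) -addrA; apply: le_trans (ler_normD _ _) _.
    by rewrite lerD// distrC.
  have := le_trans (mx_norm_coef _ k) dist; rewrite !mxE -mulrBr normrM gtr0_norm// => dk.
  have dk1 : `|(g k)%:R - (g' k)%:R| < 1 :> R.
    rewrite -(ltr_pM2l E0) mulr1; apply: le_lt_trans dk _; rewrite /E; lra.
  move: dk1; rewrite ltr_norml => /andP[d1 d2].
  by case: (ltngtP (g k) (g' k)) => //; rewrite -(ler_nat R) mulrS => h; exfalso; lra.
have <- : #|{ffun 'I_d -> 'I_q}| = (q ^ d)%N by rewrite card_ffun !card_ord.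
rewrite cardE -(size_map f); apply: uniq_leq_size; first by rewrite map_inj_uniq// enum_uniq.
by move=> a /mapP[g _ ->]; apply/LamFP => //; case: (hf g).
Qed.

Definition outer n i : set V := [set z | ~ (fP F i).2^° (lam ^- n *: z)].

Definition bad n i (w : R) : set address :=
  [set a | Lam n i a /\ exists z, outer n i z /\ `|a.2 - z| < w].

(** Covering prototile boundaries at scale [lam ^- n] and scaling up covers supertile boundaries by
    unit balls, in number at most a constant times [lam ^+ n] to the power [d.-1]. Each accounts for
    at most [N] bad tiles, while heights grow like the power [d]. *)
Lemma few_bad w (e : R) : 0 < e -> exists n0, forall n, (n0 <= n)%N -> forall i,
  (#|` fset_set (bad n i w)|)%:R <= e * (hgt n i)%:R.
Proof.
move=> e0; have [N hN] := separated_bound F (w + 1).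
have [ncap [K [ncapd hK]]] := proto_boundary hS.
have [c c0 [n1 hc]] := hgt_lower.
have [n2 hn2] := lamX_large (`|K| * N%:R / (e * c ^+ d)).
exists (maxn n1 n2) => n; rewrite geq_max => /andP[/hc{}hc /hn2{}hn2] i.
have l0 := lamX_gt0 hS n.
have l1 : 1 <= lam ^+ n by rewrite exprn_ege1// ltW// (scale_gt1 hS).
have fbad : finite_set (bad n i w) by apply: sub_finite_set (Lam_finite hS n i) => a [].
have [s [ss hs]] : exists s : seq V, ((size s)%:R <= K * (lam ^- n) ^ (- ncap)) /\
    boundary (fP F i).2 `<=` \bigcup_(c in [set` s]) eball c (lam ^- n).
  apply: hK; last exact: fP_proto.
  by rewrite invr_gt0 l0 invf_le1.
(* The hypothesis [ncap < d] enters as [ncap <= d.-1]; the integer [ncap] may be negative. *)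
have ss' : (size s)%:R <= `|K| * (lam ^+ n) ^+ d.-1.
  apply: le_trans ss _; apply: (@le_trans _ _ (`|K| * (lam ^- n) ^ (- ncap))).
    by rewrite ler_wpM2r ?ler_norm// exprz_ge0// invr_ge0 ltW.
  rewrite ler_wpM2l// exprz_inv opprK.
  suff : (lam ^+ n) ^ ncap <= (lam ^+ n) ^ (d.-1)%:Z by [].
  apply: ler_weXz2l => //.
  by rewrite -ltzD1 -PoszD addn1 prednK.
have nb : (#|` fset_set (bad n i w)| <= size s * N)%N.
  apply: (@size_union_bound _ _ (fun c a => `|a.2 - lam ^+ n *: c| < w + 1)).
    move=> a; rewrite in_fset_set// inE => -[La [z [oz az]]].
    (* The segment from a bad tile to a nearby outer point crosses the boundary, so the tile is
       within [w] of a boundary point, and this within 1 of a covering centre. *)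
    have [|||t t01 bd] := @segment_boundary (fP F i).2 (lam ^- n *: a.2) (lam ^- n *: z).
    - exact: fP_closed.
    - by apply: interior_subset; exact: Lam_supp La.
    - exact: oz.
    have [c' sc' ec'] := hs _ bd; exists c' => //.
    have := le_lt_trans (enorm_ge _) ec'; rewrite -scalerBr scalerA mulrC -scalerA => bc.
    have bc' : `|a.2 + t *: (z - a.2) - lam ^+ n *: c'| < 1.
      have -> : a.2 + t *: (z - a.2) - lam ^+ n *: c' =
          lam ^+ n *: (lam ^- n *: a.2 + lam ^- n *: (t *: (z - a.2)) - c').
        by rewrite [RHS]scalerBr [in RHS]scalerDr !(lamXK hS).
      by rewrite normrZ gtr0_norm// -ltr_pdivlMl// mulr1.
    have -> : a.2 - lam ^+ n *: c' = t *: (a.2 - z) + (a.2 + t *: (z - a.2) - lam ^+ n *: c').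
      by rewrite addrA addrCA -scalerDr addrA subrK subrr scaler0 addr0.
    apply: le_lt_trans (ler_normD _ _) _; apply: ltrD => //.
    move/andP: t01 => [t0 t1]; rewrite normrZ ger0_norm//; apply: le_lt_trans az.
    by rewrite ler_piMl.
  move=> c' _; rewrite -size_filter -(size_map snd).
  have sep : {in fset_set (bad n i w) &, forall a b, `|a.2 - b.2| < r -> a = b}.
    move=> [j x] [k y]; rewrite !in_fset_set// !inE => -[La _] [Lb _] /= xy.
    by have [/= -> ->] := Pstar_sep hS (Pstar_supertile hS n i) La Lb xy.
  apply: (hN (lam ^+ n *: c')).
  - rewrite map_inj_in_uniq ?filter_uniq ?fset_uniq// => a b.
    rewrite !mem_filter => /andP[_ ha] /andP[_ hb] ab; apply: sep => //.
    by rewrite ab subrr normr0; exact: fr_gt0.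
  - by move=> y /mapP[a]; rewrite mem_filter => /andP[h _] ->.
  - move=> y y' /mapP[a + ->] /mapP[b + ->]; rewrite !mem_filter => /andP[_ ha] /andP[_ hb] ab.
    by rewrite (sep a b).
apply: (@le_trans _ _ ((size s)%:R * N%:R)); first by rewrite -natrM ler_nat.
apply: (@le_trans _ _ (`|K| * N%:R * (lam ^+ n) ^+ d.-1)).
  by rewrite mulrAC ler_wpM2r.
apply: (@le_trans _ _ (e * (c * lam ^+ n) ^+ d)); last by rewrite ler_pM2l.
rewrite ler_pdivrMr in hn2; last by rewrite mulr_gt0// exprn_gt0.
have -> : e * (c * lam ^+ n) ^+ d = lam ^+ n * (e * c ^+ d) * (lam ^+ n) ^+ d.-1.
  have -> : (c * lam ^+ n) ^+ d = c ^+ d * (lam ^+ n * (lam ^+ n) ^+ d.-1).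
    by rewrite exprMn -exprS prednK.
  by ring.
by rewrite ler_wpM2r// exprn_ge0// ltW.
Qed.

(** Keeps the infimum in [ramp] from being the dummy value taken on the empty set. *)
Lemma outer_nonempty n i : outer n i !=set0.
Proof.
exists (lam ^+ n *: const_mx (D + 1)) => /interior_subset /fP_bound.
rewrite (lamXVK hS); have D0 := D_ge0 F.
have : D + 1 <= `|const_mx (D + 1) : V|.
  have := mx_norm_coef (const_mx (D + 1) : V) (Ordinal hd).
  by rewrite mxE ger0_norm// addr_ge0.
by move=> h1 h2; have := le_trans h1 h2; rewrite gerDl ler10.
Qed.

Definition ramp n (w : R) (a : address) : R :=
  Num.min 1 (inf [set `|a.2 - z| | z in outer n a.1] / w).

Section Ramp.
Variables (n : nat) (w : R).
Hypothesis w0 : 0 < w.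

Let dist_lb i x : has_inf [set `|x - z| | z in outer n i].
Proof.
split; first by have [z oz] := outer_nonempty n i; exists `|x - z|, z.
by exists 0 => _ [z _ <-].
Qed.

Lemma ramp_ge0 a : 0 <= ramp n w a.
Proof.
rewrite /ramp le_min ler01 divr_ge0 ?(ltW w0)//.
by apply: lb_le_inf; [case: (dist_lb a.1 a.2)|move=> _ [z _ <-]].
Qed.

Lemma ramp_le1 a : ramp n w a <= 1.
Proof. by rewrite /ramp ge_min lexx. Qed.

(** Bounds the value before a translation that leaves the supertile, with [z] the position it leads
    to. *)
Lemma ramp_outer a z : outer n a.1 z -> ramp n w a <= `|a.2 - z| / w.
Proof.
move=> oz; rewrite /ramp ge_min; apply/orP; right; rewrite ler_pM2r ?invr_gt0//.
by apply: ge_inf; [case: (dist_lb a.1 a.2)|exists z].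
Qed.

Lemma ramp_lipschitz i x y : ramp n w (i, x) <= ramp n w (i, y) + `|x - y| / w.
Proof.
have xyw : 0 <= `|x - y| / w by rewrite divr_ge0// ltW.
rewrite {2}/ramp addr_minl le_min; apply/andP; split.
  by apply: le_trans (ramp_le1 _) _; rewrite lerDl.
rewrite /ramp ge_min -mulrDl ler_pM2r ?invr_gt0//; apply/orP; right; rewrite -lerBlDr.
apply: lb_le_inf; first by case: (dist_lb i y).
move=> _ [z oz <-]; rewrite lerBlDr.
apply: (@le_trans _ _ `|x - z|); first by apply: ge_inf; [case: (dist_lb i x)|exists z].
by rewrite -(subrK y x) -addrA addrC; apply: le_trans (ler_normD _ _) _; rewrite addrK.
Qed.

Lemma ramp_good i a : Lam n i a -> ~ bad n i w a -> ramp n w (i, a.2) = 1.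
Proof.
move=> La nb; apply/eqP; rewrite eq_le ramp_le1 /ramp le_min lexx /=.
rewrite ler_pdivlMr// mul1r; apply: lb_le_inf; first by case: (dist_lb i a.2).
move=> _ [z oz <-]; rewrite leNgt; apply/negP => az; apply: nb; split=> //.
by exists z.
Qed.

(** Only bad tiles fall short of the value 1, and each by at most 1. *)
Lemma ramp_sum (e : R) i : (#|` fset_set (bad n i w)|)%:R <= e * (hgt n i)%:R ->
  (1 - e) * (hgt n i)%:R <= \sum_(a <- LamF n i) ramp n w (i, a.2) <= (hgt n i)%:R.
Proof.
move=> hb; have fbad : finite_set (bad n i w) by apply: sub_finite_set (Lam_finite hS n i) => a [].
apply/andP; split; last first.
  by rewrite hgtE; apply: ler_sum => a _; exact: ramp_le1.
rewrite mulrBl mul1r lerBlDl -lerBlDr; apply: le_trans hb.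
rewrite hgtE -sumrB.
apply: (@le_trans _ _ (\sum_(a <- LamF n i) (a \in fset_set (bad n i w))%:R)).
  rewrite big_seq [leRHS]big_seq; apply: ler_sum => a /LamFP La.
  have [ba|nb] := pselect (bad n i w a); last by rewrite ramp_good// subrr ler0n.
  have -> : a \in fset_set (bad n i w) by rewrite in_fset_set// inE.
  by rewrite gerBl ramp_ge0.
rewrite -natr_sum ler_nat.
have -> : (\sum_(a <- LamF n i) (a \in fset_set (bad n i w)) =
    count (fun a => a \in fset_set (bad n i w)) (LamF n i))%N.
  by rewrite -sum1_count [RHS]big_mkcond; apply: eq_bigr => a _; case: (a \in _).
rewrite -size_filter; apply: uniq_leq_size; first by rewrite filter_uniq// fset_uniq.
by move=> a; rewrite mem_filter => /andP[].
Qed.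

End Ramp.

(** The tile moved to the origin had position [a.2 - z] relative to the old supertile. If that point
    is interior to it, the old and new parent tiles overlap in the common preimage and so
    coincide. *)
Lemma Addr_translate n T z a b : Omega S T -> Addr n T a -> Addr n (translate T z) b ->
  (a.1 = b.1 /\ b.2 = a.2 - z) \/ outer n a.1 (a.2 - z).
Proof.
move=> OT [T1 [OT1 e1 h1 La]] [T2 [OT2 e2 h2 Lb]].
have OT1z : Omega S (translate T1 (lam ^- n *: z)) by exact: (Omega_translate F hS).
have eT2 : T2 = translate T1 (lam ^- n *: z).
  apply: (om_inj F hS hA (n := n)) => //; rewrite e2.
  rewrite (om_translate (F := F) hS) ?(lamXK hS) ?e1// => t; exact: (Omega_tl F OT1).
move: h2; rewrite eT2 translateE translate_tl => h2.
have [e|ne] := pselect (tl a.1 (- (lam ^- n *: a.2)) =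
    tl b.1 (- (lam ^- n *: b.2) - lam ^- n *: z)).
  left; have [-> e'] := tl_inj hS e; split=> //.
  apply/eqP; rewrite eq_sym subr_eq eq_sym -[_ + _](lamXK hS n) scalerDr.
  by rewrite -[lam ^- n *: b.2 + _]opprK opprD -e' opprK (lamXK hS).
right => ha; apply: ne.
apply: (Pstar_meet (z := - (lam ^- n *: z)) (Omega_Pstar OT1) h1 h2).
  by rewrite interior_tl opprK addrC -scalerBr.
have [j /(Lam_supp hS) hb] := Lb.
by rewrite interior_tl opprD !opprK addrCA addNr addr0.
Qed.

End Counting.

(** The sup norm is not invariant under orthogonal matrices; a crude Lipschitz constant is enough to
    transport interiors. *)
Lemma mulmx_norm_le (R : realType) (d : nat) (g : 'M[R]_d) (z : 'cV[R]_d) :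
  `|g *m z| <= d%:R * `|g| * `|z|.
Proof.
rewrite [leLHS]/Num.norm /= mx_normrE; apply/bigmax_leP; split.
  by rewrite !mulr_ge0.
move=> [i j] _ /=; rewrite mxE; apply: le_trans (ler_norm_sum _ _ _) _.
apply: (@le_trans _ _ (\sum_(k < d) `|g| * `|z|)); last first.
  by rewrite sumr_const card_ord -[leLHS]mulr_natl mulrA.
apply: ler_sum => k _; rewrite normrM (ord1 j) ler_pM//; last exact: mx_norm_coef.
rewrite [leRHS]/Num.norm /= mx_normrE.
exact: (@le_bigmax _ _ _ 0 (fun ij : 'I_d * 'I_d => `|g ij.1 ij.2|) (i, k)).
Qed.

(** * Symmetries *)

Section Symmetry.
Context {R : realType} {d : nat} {L : Type} {S : tiling_data R d L}.
Context (F : frame S) (hS : substitution_tiling_system S).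
Context (lact : 'M[R]_d -> L -> L) (G : set 'M[R]_d).
Context (hG : symmetry_group S lact G) (hfree : acts_freely S lact G).
Local Notation V := 'cV[R]_d.
Local Notation lam := (scale S).
Local Notation om := (@om R d L S).
Local Notation tl := (@tl R d L S F).
Local Notation Lam := (@Lam R d L S F).
Local Notation address := ('I_(fm F) * V)%type.
Implicit Types (T : set (tile R d L)) (x y z : V) (g h : 'M[R]_d).

Lemma G1 : G 1%:M. Proof. by case: (sym_subgroup hG). Qed.

Lemma GM g h : G g -> G h -> G (g *m h).
Proof. by move=> Gg Gh; case: (sym_subgroup hG) => _ /(_ g h Gg Gh). Qed.

Lemma GV g : G g -> G (invmx g).
Proof. by move=> Gg; case: (sym_subgroup hG) => _ _ /(_ g Gg). Qed.

Lemma G_unit g : G g -> g \in unitmx.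
Proof.
by move=> Gg; case: (sym_subgroup hG) => _ _ _ /(_ g Gg) /mulmx1_unit[].
Qed.

Lemma GmulVK g x : G g -> invmx g *m (g *m x) = x.
Proof. by move=> Gg; rewrite mulmxA mulVmx ?mul1mx ?G_unit. Qed.

Lemma GmulKV g x : G g -> g *m (invmx g *m x) = x.
Proof. by move=> Gg; rewrite mulmxA mulmxV ?mul1mx ?G_unit. Qed.

Lemma Gmul_inj g x y : G g -> g *m x = g *m y -> x = y.
Proof. by move=> Gg e; rewrite -(GmulVK x Gg) e GmulVK. Qed.

(** The action on prototiles read on their indices; for [g] in [G] the default value [i] of [xget]
    is not reached. *)
Definition gact g (i : 'I_(fm F)) : 'I_(fm F) :=
  xget i [set j | gtile lact g (fP F i) = fP F j].

Lemma gactE g i : G g -> gtile lact g (fP F i) = fP F (gact g i).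
Proof.
move=> Gg; rewrite /gact; case: xgetP => [j _ //|none].
have [j e] := fP_surj F (sym_proto hG Gg (fP_proto F i)).
by exfalso; exact: none j e.
Qed.

Lemma gtile_tl g i x : G g -> gtile lact g (tl i x) = tl (gact g i) (g *m x).
Proof.
move=> Gg; apply: tile_ext; first by rewrite /= -(gactE i Gg).
move=> z; rewrite tlE -(gactE i Gg); split=> /=.
  move=> [y /tlE ty <-]; exists (y - x) => //; by rewrite mulmxBr.
move=> [y ty e]; exists (y + x); first by apply/tlE; rewrite addrK.
by rewrite mulmxDr e subrK.
Qed.

Lemma gact1 i : gact 1%:M i = i.
Proof.
apply: (@fP_inj _ _ _ _ F); rewrite -gactE; last exact: G1.
exact/(sym_act1 hG)/fP_proto.
Qed.

Lemma gactM g h i : G g -> G h -> gact (g *m h) i = gact g (gact h i).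
Proof.
move=> Gg Gh; apply: (@fP_inj _ _ _ _ F).
rewrite -gactE; last exact: GM.
by rewrite (sym_actM hG Gg Gh (fP_proto F i)) -!gactE.
Qed.

Lemma gactVK g i : G g -> gact (invmx g) (gact g i) = i.
Proof.
move=> Gg; rewrite -gactM//; last exact: GV.
by rewrite mulVmx ?gact1// G_unit.
Qed.

Lemma gactKV g i : G g -> gact g (gact (invmx g) i) = i.
Proof.
move=> Gg; rewrite -gactM//; last exact: GV.
by rewrite mulmxV ?gact1// G_unit.
Qed.

Lemma gact_free g h i : G g -> G h -> gact g i = gact h i -> g = h.
Proof.
move=> Gg Gh e; have e1 : gact (invmx h *m g) i = i.
  by rewrite gactM// ?e ?gactVK//; exact: GV.
have Gk : G (invmx h *m g) by apply: GM => //; exact: GV.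
have e2 : invmx h *m g = 1%:M.
  by apply: (hfree Gk (fP_proto F i)); rewrite gactE// e1.
by rewrite -(mulmx1 h) -e2 mulmxA mulmxV ?mul1mx// G_unit.
Qed.

(** A free action embeds the group into the finite index set through the orbit map of any one
    index. *)
Lemma G_finite : finite_set G.
Proof.
have i0 : 'I_(fm F) := Ordinal (fm_gt0 F).
apply: (@finite_of_size_bound _ _ (fm F)) => s us sG.
rewrite -(size_map (fun g => gact g i0)) -[leqRHS]card_ord cardE.
apply: uniq_leq_size; last by move=> i _; rewrite mem_enum.
rewrite map_inj_in_uniq// => g h /sG Gg /sG Gh; exact: gact_free.
Qed.

Lemma gtilingE g T u : G g -> (forall t, T t -> exists i x, t = tl i x) ->
  gtiling lact g T u <-> exists i x, T (tl i x) /\ u = tl (gact g i) (g *m x).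
Proof.
move=> Gg hT; split.
  move=> [t Tt <-]; have [i [x e]] := hT _ Tt; subst t.
  by exists i, x; rewrite gtile_tl.
by move=> [i [x [Tx ->]]]; exists (tl i x); rewrite ?gtile_tl.
Qed.

Lemma gtiling_tl g T : G g -> (forall t, T t -> exists i x, t = tl i x) ->
  forall t, gtiling lact g T t -> exists i x, t = tl i x.
Proof.
by move=> Gg hT t /(gtilingE _ Gg hT)[i [x [_ ->]]]; exists (gact g i), (g *m x).
Qed.

Lemma gtiling_comp g h T : G g -> G h -> (forall t, T t -> exists i x, t = tl i x) ->
  gtiling lact g (gtiling lact h T) = gtiling lact (g *m h) T.
Proof.
move=> Gg Gh hT; have hT' := gtiling_tl Gh hT.
apply/seteqP; split=> u.
  move=> /(gtilingE _ Gg hT')[i [x [/(gtilingE _ Gh hT)[j [y [Ty /(tl_inj hS)[-> ->]]]] ->]]].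
  by apply/(gtilingE _ (GM Gg Gh) hT); exists j, y; rewrite gactM// mulmxA.
move=> /(gtilingE _ (GM Gg Gh) hT)[j [y [Ty ->]]].
apply/(gtilingE _ Gg hT'); exists (gact h j), (h *m y); rewrite gactM// mulmxA; split=> //.
by apply/(gtilingE _ Gh hT); exists j, y.
Qed.

Lemma gtiling1 T : (forall t, T t -> exists i x, t = tl i x) -> gtiling lact 1%:M T = T.
Proof.
move=> hT; apply/seteqP; split=> u.
  by move=> /(gtilingE _ G1 hT)[i [x [Tx ->]]]; rewrite gact1 mul1mx.
move=> Tu; have [i [x e]] := hT _ Tu; subst u.
by apply/(gtilingE _ G1 hT); exists i, x; rewrite gact1 mul1mx.
Qed.

Lemma gtilingVK g T : G g -> (forall t, T t -> exists i x, t = tl i x) ->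
  gtiling lact (invmx g) (gtiling lact g T) = T.
Proof.
move=> Gg hT; rewrite gtiling_comp//; last exact: GV.
by rewrite mulVmx ?gtiling1// G_unit.
Qed.

Lemma gtilingKV g T : G g -> (forall t, T t -> exists i x, t = tl i x) ->
  gtiling lact g (gtiling lact (invmx g) T) = T.
Proof.
move=> Gg hT; rewrite gtiling_comp//; last exact: GV.
by rewrite mulmxV ?gtiling1// G_unit.
Qed.

Lemma gbody g i x z : G g -> (tl (gact g i) (g *m x)).2 (g *m z) <-> (tl i x).2 z.
Proof.
move=> Gg; rewrite -gtile_tl//=; split=> [[y ty /(Gmul_inj Gg) <-]//|tz].
by exists z.
Qed.

Lemma ginterior g i x z : G g -> (tl (gact g i) (g *m x)).2^° (g *m z) -> (tl i x).2^° z.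
Proof.
move=> Gg /interior_ballP[e e0 eA]; apply/interior_ballP.
have c0 : 0 < d%:R * `|g| + 1 by rewrite ltr_pwDr// mulr_ge0.
exists (e / (d%:R * `|g| + 1)); first by rewrite divr_gt0.
move=> u zu; apply/(gbody i x u Gg)/eA; rewrite -mulmxBr.
apply: le_lt_trans (mulmx_norm_le _ _) _.
apply: (@le_lt_trans _ _ ((d%:R * `|g| + 1) * `|z - u|)).
  by rewrite ler_wpM2r// lerDl.
by rewrite mulrC -ltr_pdivlMr.
Qed.

Lemma Pstar_gtiling g T : G g -> Pstar S T -> Pstar S (gtiling lact g T).
Proof.
move=> Gg PT; have hT t : T t -> exists i x, t = tl i x by exact: Pstar_tl.
apply: (Pstar_intro (F := F)) => //; first exact: gtiling_tl.
move=> i x j y z /(gtilingE _ Gg hT)[k [a [Ta /(tl_inj hS)[-> ->]]]].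
move=> /(gtilingE _ Gg hT)[l [b [Tb /(tl_inj hS)[-> ->]]]].
rewrite -(GmulKV z Gg) => /(ginterior Gg) az /(ginterior Gg) bz.
by have /(tl_inj hS)[-> ->] := Pstar_meet PT Ta Tb az bz.
Qed.

Lemma gtiling_translate g T x : G g -> (forall t, T t -> exists i x, t = tl i x) ->
  gtiling lact g (translate T x) = translate (gtiling lact g T) (g *m x).
Proof.
move=> Gg hT; have hTx t : translate T x t -> exists i y, t = tl i y.
  by move=> [u /hT[i [y ->]] <-]; exists i, (y + x); rewrite translate_tl.
apply/seteqP; split=> u.
  move=> /(gtilingE _ Gg hTx)[i [y [+ ->]]]; rewrite !translateE !translate_tl => Ty.
  by apply/(gtilingE _ Gg hT); exists i, (y - x); rewrite mulmxBr.
rewrite translateE => /(gtilingE _ Gg hT)[i [y [Ty e]]].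
apply/(gtilingE _ Gg hTx); exists i, (y + x); rewrite translateE translate_tl addrK; split=> //.
by rewrite mulmxDr -translate_tl -e translate_tileD addNr translate_tile0.
Qed.

Lemma subst_tl i t : subst S (fP F i) t -> exists j x, t = tl j x.
Proof. by move=> h; apply: (Pstar_tl F) h; exact/(subst_Pstar hS)/fP_proto. Qed.

Lemma subst_ext_gtiling g T : G g -> (forall t, T t -> exists i x, t = tl i x) ->
  subst_ext S (gtiling lact g T) = gtiling lact g (subst_ext S T).
Proof.
move=> Gg hT.
have key i x : translate (subst S (fP F (gact g i))) (lam *: (g *m x)) =
    gtiling lact g (translate (subst S (fP F i)) (lam *: x)).
  rewrite gtiling_translate//; last exact: subst_tl.
  by rewrite -gactE// (sym_subst hG Gg (fP_proto F i)) scalemxAr.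
apply/seteqP; split=> u.
  move=> /(subst_ext_tl F)[k [y [/(gtilingE _ Gg hT)[i [x [Tx /(tl_inj hS)[-> ->]]]]]]].
  rewrite key => -[t ht <-]; exists t => //.
  by apply/(subst_ext_tl F); exists i, x.
move=> [t /(subst_ext_tl F)[i [x [Tx ht]]] <-].
apply/(subst_ext_tl F); exists (gact g i), (g *m x); split.
  by apply/(gtilingE _ Gg hT); exists i, x.
by rewrite key; exists t.
Qed.

Lemma om_gtiling g n T : G g -> Pstar S T ->
  om n (gtiling lact g T) = gtiling lact g (om n T).
Proof.
move=> Gg PT; elim: n => [//|n IHn]; rewrite !omS IHn subst_ext_gtiling//.
by move=> t; exact: (Pstar_tl F (Pstar_om F hS n PT)).
Qed.

Lemma supertile_gact g n i : G g ->
  supertile S n (fP F (gact g i)) = gtiling lact g (supertile S n (fP F i)).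
Proof.
move=> Gg; rewrite !supertileE -om_gtiling//; last exact: Pstar1.
by rewrite /gtiling image_set1 gtile_tl// mulmx0.
Qed.

Lemma Lam_gact g n i j x : G g -> Lam n i (j, x) -> Lam n (gact g i) (gact g j, g *m x).
Proof.
move=> Gg Lx; rewrite /Lam /adr /= supertile_gact//.
by apply/(gtilingE _ Gg); [exact: supertile_tl|exists j, x].
Qed.

Lemma hgt_gact g n i : G g -> hgt n (gact g i) = hgt n i.
Proof.
have le h k : G h -> (hgt n k <= hgt n (gact h k))%N.
  move=> Gh; rewrite /hgt -(size_map (fun a : address => (gact h a.1, h *m a.2)) (LamF n k)).
  apply: uniq_leq_size.
    rewrite map_inj_uniq ?fset_uniq// => -[j x] [l y] [e1 e2].
    by rewrite (Gmul_inj Gh e2) -(gactVK j Gh) e1 gactVK.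
  move=> b /mapP[[j x] /(LamFP hS) Lx ->]; apply/(LamFP hS); exact: Lam_gact.
move=> Gg; apply/eqP; rewrite eqn_leq le// andbT.
by rewrite -{2}(gactVK i Gg) le//; exact: GV.
Qed.

Lemma Omega_gtiling g T : G g -> Omega S T -> Omega S (gtiling lact g T).
Proof.
move=> Gg OT; have PT := Omega_Pstar OT.
have hT t : T t -> exists i x, t = tl i x by exact: Pstar_tl.
apply: (Omega_intro (F := F)); first exact: Pstar_gtiling.
  apply/seteqP; split=> // z _.
  have [i [x [Tx xz _]]] := cover_tile F (invmx g *m z) OT.
  exists (tl (gact g i) (g *m x)); first by apply/(gtilingE _ Gg hT); exists i, x.
  by rewrite -(GmulKV z Gg); apply/gbody.
move=> Q fQ QT.
have hQ t : Q t -> exists i x, t = tl i x by move=> /QT /(gtiling_tl Gg hT).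
have [||n [i [x h]]] := @Omega_patch _ _ _ _ F hS T (gtiling lact (invmx g) Q) OT.
- exact: finite_image.
- by rewrite -(gtilingVK Gg hT) => _ [t /QT ht <-]; exists t.
exists n, (gact g i), (g *m x).
rewrite supertile_gact// -gtiling_translate//; last exact: supertile_tl.
by rewrite -(gtilingKV Gg hQ) => _ [t /h ht <-]; exists t.
Qed.

Lemma Omega_punc_gtiling g T : G g -> Omega_punc S T -> Omega_punc S (gtiling lact g T).
Proof.
move=> Gg /(Omega_puncE F hS)[OT [i Ti]]; apply/(Omega_puncE F hS).
split; first exact: Omega_gtiling.
exists (gact g i); apply/(gtilingE _ Gg (fun t => Omega_tl F OT)).
by exists i, 0; rewrite mulmx0.
Qed.

Lemma Addr_gtiling g n T a : G g -> Addr n T a ->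
  Addr n (gtiling lact g T) (gact g a.1, g *m a.2).
Proof.
move=> Gg [T1 [OT1 <- h1 [j La]]]; exists (gtiling lact g T1); split=> /=.
- exact: Omega_gtiling.
- exact/om_gtiling/Omega_Pstar.
- apply/(gtilingE _ Gg (fun t => Omega_tl F OT1)).
  by exists a.1, (- (lam ^- n *: a.2)); rewrite mulmxN scalemxAr.
- by exists (gact g j); exact: Lam_gact.
Qed.

(* One representative of each orbit of [G] on the prototiles. *)
Definition is_rep (i : 'I_(fm F)) : bool := `[< forall g, G g -> (i <= gact g i)%N >].

Lemma rep_exists i : exists2 g, G g & is_rep (gact g i).
Proof.
pose A := [set k : nat | exists2 g, G g & k = gact g i].
have [k [g Gg ek] min] : exists2 k, A k & forall k', A k' -> (k <= k')%N.
  have ex : exists k, `[< A k >] by exists i; apply/asboolP; exists 1%:M; [exact: G1|rewrite gact1].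
  exists (ex_minn ex); case: ex_minnP => k /asboolP // h min k' h'.
  by apply: min; exact/asboolP.
exists g => //; apply/asboolP => h Gh; rewrite -ek; apply: min.
by exists (h *m g); [exact: GM|rewrite gactM].
Qed.

Lemma rep_uniq g i : G g -> is_rep i -> is_rep (gact g i) -> g = 1%:M.
Proof.
move=> Gg /asboolP h1 /asboolP h2; apply: (gact_free (i := i)) => //; first exact: G1.
rewrite gact1; apply: ord_inj; apply/eqP; rewrite eqn_leq h1// andbT.
by have := h2 _ (GV Gg); rewrite gactVK.
Qed.

(** By freeness each index is the image of a representative under exactly one [g], so the sum over
    pairs counts every index once. *)
Lemma sum_reps (f : 'I_(fm F) -> R) : (forall g i, G g -> f (gact g i) = f i) ->
  \sum_i f i = (#|` fset_set G|)%:R * \sum_(i | is_rep i) f i.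
Proof.
move=> fG.
have one j : \sum_(g <- fset_set G) \sum_(i | is_rep i) (gact g i == j)%:R = 1 :> R.
  have [h Gh rh] := rep_exists j.
  have GVh := GV Gh.
  rewrite (big_fsetD1 (invmx h)) /=; last by rewrite in_fset_set ?inE//; exact: G_finite.
  rewrite (bigD1 (gact h j)) //= gactVK// eqxx big1 ?addr0; last first.
    move=> i /andP[_ ij]; case: eqP => // e; case/eqP: ij.
    by rewrite -e gactKV.
  rewrite big_seq big1 ?addr0// => g; rewrite !inE in_fset_set ?inE; last exact: G_finite.
  move=> /andP[/eqP gh /set_mem Gg]; rewrite big1// => i ri; case: eqP => // e; exfalso; apply: gh.
  have e1 : gact (h *m g) i = gact h j by rewrite gactM// e.
  have := rep_uniq (GM Gh Gg) ri; rewrite e1 => /(_ rh) hg.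
  by rewrite -[LHS]mul1mx -(mulVmx (G_unit Gh)) -mulmxA hg mulmx1.
transitivity (\sum_j f j * \sum_(g <- fset_set G) \sum_(i | is_rep i) (gact g i == j)%:R).
  by apply: eq_bigr => j _; rewrite one mulr1.
under eq_bigr do rewrite mulr_sumr.
rewrite exchange_big /=.
have inner g : g \in fset_set G ->
    \sum_j f j * (\sum_(i | is_rep i) (gact g i == j)%:R) = \sum_(i | is_rep i) f i.
  rewrite in_fset_set ?inE; last exact: G_finite; move=> Gg.
  under eq_bigr do rewrite mulr_sumr.
  rewrite exchange_big /=; apply: eq_bigr => i _.
  rewrite (bigD1 (gact g i)) //= eqxx mulr1 fG// big1 ?addr0// => j /negbTE ji.
  by rewrite eq_sym ji mulr0.
rewrite big_seq (eq_bigr (fun=> \sum_(i | is_rep i) f i)); last by move=> g /inner.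
by rewrite -big_seq big_const_seq count_predT iter_addr addr0 mulr_natl.
Qed.

End Symmetry.

(** * The complex modulus as a real number *)

Section Modulus.
Context {R : realType}.
Implicit Types a b : R[i].

Lemma cmodE a : `|a| = (cmod a)%:C.
Proof. by rewrite /cmod normc_def. Qed.

Lemma cmod_ge0 a : 0 <= cmod a.
Proof. by rewrite -lecR -cmodE; exact: normr_ge0. Qed.

Lemma cmod0 : cmod (0 : R[i]) = 0.
Proof. by rewrite /cmod normr0. Qed.

Lemma cmod_eq0 a : cmod a = 0 -> a = 0.
Proof. by move=> a0; apply/eqP; rewrite -normr_eq0 cmodE a0. Qed.

Lemma cmodD a b : cmod (a + b) <= cmod a + cmod b.
Proof. by rewrite -lecR rmorphD /= -!cmodE ler_normD. Qed.

Lemma cmodM a b : cmod (a * b) = cmod a * cmod b.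
Proof. by apply: complexI; rewrite rmorphM /= -!cmodE normrM. Qed.

Lemma cmodN a : cmod (- a) = cmod a.
Proof. by rewrite /cmod normrN. Qed.

Lemma cmodB a b : cmod (a - b) <= cmod a + cmod b.
Proof. by rewrite -(cmodN b) cmodD. Qed.

Lemma cmod_distC a b : cmod (a - b) = cmod (b - a).
Proof. by rewrite /cmod distrC. Qed.

Lemma cmod_real (x : R) : cmod x%:C = `|x|.
Proof. by apply: complexI; rewrite -cmodE normc_def /= expr0n addr0 sqrtr_sqr. Qed.

Lemma cmod1 : cmod (1 : R[i]) = 1.
Proof. by rewrite /cmod normr1. Qed.

Lemma cmodJ a : cmod (conjc a) = cmod a.
Proof. by apply: complexI; rewrite -!cmodE; exact: normcJ. Qed.

Lemma cmod_sum (I : Type) (s : seq I) (f : I -> R[i]) :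
  cmod (\sum_(i <- s) f i) <= \sum_(i <- s) cmod (f i).
Proof.
elim: s => [|i s IHs]; first by rewrite !big_nil cmod0.
by rewrite !big_cons; apply: le_trans (cmodD _ _) _; rewrite lerD2l.
Qed.

Lemma conjc_mul a : conjc a * a = (cmod a ^+ 2)%:C.
Proof. by rewrite mulrC -sqr_normc cmodE rmorphXn. Qed.

End Modulus.

Lemma continuous_cmodP (R : realType) (T : topologicalType) (f : T -> R[i]) :
  continuous (f : T -> R[i]^o) <->
  forall y (e : R), 0 < e -> nbhs y [set y' | cmod (f y' - f y) < e].
Proof.
split=> [cf y e e0|hf y].
  have /cvgrPdist_lt/(_ e%:C) := cf y; rewrite ltcR => /(_ e0).
  by apply: filterS => y'; rewrite cmodE ltcR cmod_distC.
move=> B /nbhs_ballP[e e0 eB]; rewrite /= in e0.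
have er : e = (complex.Re e)%:C by case: e e0 {eB} => a b; rewrite ltcE /= => /andP[/eqP -> _].
have re0 : 0 < complex.Re e by rewrite -ltcR -er.
apply: filterS (hf y _ re0) => y' h; apply: eB.
by rewrite -ball_normE /= er cmodE ltcR cmod_distC.
Qed.

Lemma seq_upper_bound (R : realType) (I : eqType) (s : seq I) (g : I -> R) :
  exists w, forall i, i \in s -> g i <= w.
Proof.
elim: s => [|i s [w hw]]; first by exists 0.
exists (Num.max (g i) w) => j; rewrite inE le_max => /orP[/eqP ->|/hw ->].
  by rewrite lexx.
by rewrite orbT.
Qed.

(** * The groupoid and its compactly supported functions *)

Section Groupoid.
Context {R : realType} {d : nat} {L : Type} {S : tiling_data R d L}.
Context (F : frame S) (hS : substitution_tiling_system S).
Context (hA : standing_assumptions S) (hd : (1 <= d)%N).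
Local Notation V := 'cV[R]_d.
Local Notation tl := (@tl R d L S F).
Local Notation cut := (cut F).
Local Notation Rp := (Rpunc S).
Implicit Types (T : set (tile R d L)) (x z : V) (y : Rpunc S) (f h : Rpunc S -> R[i]).

Lemma RpuncP y : Rset S (rng y, src y).
Proof. by case: y => -[T T'] h; exact: (set_mem h). Qed.

Lemma rng_punc y : Omega_punc S (rng y).
Proof. by case: (RpuncP y). Qed.

Lemma src_punc y : Omega_punc S (src y).
Proof. by case: (RpuncP y). Qed.

Lemma Rpunc_ext y y' : rng y = rng y' -> src y = src y' -> y = y'.
Proof.
rewrite /rng /src => e1 e2; apply: val_inj; move: e1 e2.
by rewrite /set_val /=; case: (val y) (val y') => [? ?] [? ?] /= -> ->.
Qed.

Definition rpack TT (h : Rset S TT) : Rp := SigSub (mem_set h).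

Lemma at_pair_rpack f TT (hTT : Rset S TT) : at_pair f TT = f (rpack hTT).
Proof.
rewrite /at_pair; case: insubP => [u _ e|]; last by rewrite mem_set.
by congr f; apply: val_inj.
Qed.

Lemma at_pair_val f y : at_pair f (rng y, src y) = f y.
Proof.
by rewrite (at_pair_rpack f (RpuncP y)); congr f; apply: Rpunc_ext.
Qed.

Lemma at_pair_out f TT : ~ Rset S TT -> at_pair f TT = 0.
Proof. by move=> nR; rewrite /at_pair insubF//; apply/negP; rewrite inE. Qed.

(** The translation cocycle of the groupoid. By aperiodicity it is well defined, and an arrow
    amounts to its range together with this vector. *)
Definition off y : V := xget 0 [set x | src y = translate (rng y) x].

Lemma offE y : src y = translate (rng y) (off y).
Proof.
rewrite /off; case: xgetP => [x _ //|none].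
by have [_ _ [x e]] := RpuncP y; exfalso; exact: none x e.
Qed.

Lemma translate_inj T x z : Omega S T -> translate T x = translate T z -> x = z.
Proof.
move=> OT e; apply/eqP; rewrite -subr_eq0; apply/eqP.
by apply: (aperiodic F hS hA hd OT); rewrite -translateD e translateK.
Qed.

Lemma off_uniq y x : src y = translate (rng y) x -> off y = x.
Proof.
by move=> e; apply: (@translate_inj (rng y)); [case: (rng_punc y)|rewrite -offE].
Qed.

Lemma Rset_intro T x : Omega_punc S T -> Omega_punc S (translate T x) ->
  Rset S (T, translate T x).
Proof. by move=> h1 h2; split=> //; exists x. Qed.

(** A base of neighbourhoods of [y] indexed by a single radius, more convenient than the sets
    [Vset]. *)
Definition W y w : set Rp := [set y' | cut (rng y) w `<=` rng y' /\ off y' = off y].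

Lemma W_le y w w' : w <= w' -> W y w' `<=` W y w.
Proof.
move=> ww y' [c o]; split=> // t [Tt [i [x [e xw]]]]; apply: c; split=> //.
by exists i, x; split=> //; exact: lt_le_trans ww.
Qed.

Lemma punc_tile_shift T x : Omega_punc S T -> Omega_punc S (translate T x) <-> exists j, T (tl j (- x)).
Proof.
move=> [OT _]; split.
  by move=> /(Omega_puncE F hS)[_ [j]]; rewrite translateE translate_tl add0r; exists j.
move=> [j Tj]; apply/(Omega_puncE F hS); split; first exact: (Omega_translate F hS).
by exists j; rewrite translateE translate_tl add0r.
Qed.

Lemma subbase_open (B : set Rp) : @Rpunc_subbase _ _ _ S B -> open B.
Proof.
move=> hB; exists [set B]; last by rewrite bigcup_set1.
move=> _ ->; exists [fset B]%fset; first by move=> C /fset1P ->; rewrite inE.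
by rewrite set_fset1 bigcap_set1.
Qed.

Lemma nbhs_W y w : nbhs y (W y w).
Proof.
have /(Omega_puncE F hS)[OT [i Ti]] := rng_punc y.
have [j Tj] : exists j, rng y (tl j (- off y)).
  apply/punc_tile_shift; first exact: rng_punc.
  by rewrite -offE; exact: src_punc.
(* The patch has to contain the tiles with punctures 0 and [- off y], which serve as [t1] and
   [t2]. *)
pose w' := Num.max w `|off y| + 1.
have inc k x : rng y (tl k x) -> `|x| < w' -> cut (rng y) w' (tl k x).
  by move=> Tx xw; split=> //; exists k, x.
have ww' : Num.max w `|off y| < w' by rewrite ltrDl.
have oV : open (Vset (S := S) (cut (rng y) w') (tl i 0) (tl j (- off y))).
  apply: subbase_open; exists (cut (rng y) w'), (tl i 0), (tl j (- off y)).
  have cT : cut (rng y) w' `<=` rng y by move=> t [].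
  split=> //.
  - split; first exact/(cut_finite F hS)/Omega_Pstar.
    by case: (Pstar_sub F hS (Omega_Pstar OT) cT).
  - by exists (rng y).
  - by apply: inc => //; rewrite normr0 (le_lt_trans _ ww')// le_max normr_ge0 orbT.
  - by apply: inc => //; rewrite normrN (le_lt_trans _ ww')// le_max lexx orbT.
have sub : Vset (S := S) (cut (rng y) w') (tl i 0) (tl j (- off y)) `<=` W y w.
  move=> y' []; rewrite !(puncture_tl hS) oppr0 translate0 sub0r opprK => c e; split.
    move=> t [Tt [k [x [ek xw]]]]; apply: c; split=> //; exists k, x; split=> //.
    by rewrite (lt_trans _ ww')// lt_max xw.
  exact: off_uniq.
apply: filterS sub _; apply: open_nbhs_nbhs; split=> //.
split; first by rewrite (puncture_tl hS) oppr0 translate0 => t [].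
by rewrite !(puncture_tl hS) sub0r opprK; exact: offE.
Qed.

Lemma subbase_W y (B : set Rp) : @Rpunc_subbase _ _ _ S B -> B y -> exists w, W y w `<=` B.
Proof.
move=> [Q [t1 [t2 [[fQ _] _ _ _ ->]]]] [c e].
have [w hw] : exists w, translate Q (- puncture S t1) `<=` cut (rng y) w.
  have fQ' : finite_set (translate Q (- puncture S t1) : set {classic tile R d L}).
    exact: finite_image.
  have OT : Omega S (rng y) by case: (rng_punc y).
  have /choice[g hg] : forall t, exists w, translate Q (- puncture S t1) t -> cut (rng y) w t.
    move=> t; have [/c Tt|] := pselect (translate Q (- puncture S t1) t); last by exists 0.
    have [i [x et]] := Omega_tl F OT Tt.
    exists (`|x| + 1) => _; split=> //; exists i, x; split=> //; by rewrite ltrDl.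
  have [w hw] := seq_upper_bound (enum_fset (fset_set (translate Q (- puncture S t1) : set {classic tile R d L}))) g.
  exists w => t Qt; have [Tt [i [x [et xw]]]] := hg _ Qt; split=> //; exists i, x; split=> //.
  have tQ : (t : {classic tile R d L}) \in fset_set (translate Q (- puncture S t1) : set {classic tile R d L}).
    by rewrite in_fset_set// inE.
  exact: lt_le_trans xw (hw _ tQ).
exists w => y' [c' o]; split; first exact: subset_trans c'.
by rewrite offE o; congr translate; exact: off_uniq.
Qed.

Lemma nbhs_sub_W y (B : set Rp) : nbhs y B -> exists w, W y w `<=` B.
Proof.
rewrite nbhsE => -[B' [[D' sD <-] [C DC Cy]] OB].
have [X sX eX] := sD _ DC; rewrite -eX in Cy.
have [w hw] : exists w, forall E, E \in X -> W y w `<=` E.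
  have /choice[g hg] : forall E : set Rp, exists w, E \in X -> W y w `<=` E.
    move=> E; have [EX|] := boolP (E \in X); last by exists 0.
    have := sX _ EX; rewrite inE => /(@subbase_W y)[|w h]; first exact: Cy.
    by exists w.
  have [w hw] := seq_upper_bound (enum_fset X) g.
  by exists w => E EX; apply: subset_trans (hg _ EX); apply: W_le; exact: hw.
exists w => y' hy'; apply: OB; exists C; first exact: DC.
change (C y'); rewrite -eX => E EX; exact: hw EX _ hy'.
Qed.

Lemma continuousRP f : continuous (f : Rp -> R[i]^o) <->
  forall y (e : R), 0 < e -> exists w, forall y', W y w y' -> cmod (f y' - f y) < e.
Proof.
rewrite continuous_cmodP; split=> hf y e e0.
  by have [w hw] := nbhs_sub_W (hf y e e0); exists w.
have [w hw] := hf y e e0; exact: filterS hw (nbhs_W y w).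
Qed.

Definition offsets_in (X : set V) f := forall y, f y != 0 -> X (off y).

(** An ultrafilter settles on one offset [x]. The ultralimit of the ranges still has a tile with
    puncture [- x], so it is the range of a limiting arrow. *)
Lemma offsets_compact (X : set V) : finite_set X -> compact [set y | X (off y)].
Proof.
move=> fX; rewrite compact_ultra => U UU UX.
have [x Xx Ux] := ultra_pick UU fX UX.
have UT : U [set y | Omega_punc S (rng y)] by apply: filterE => y; exact: rng_punc.
have OT : Omega_punc S (ulim U (@rng _ _ _ S)) by exact: ulim_Omega_punc F hS hA hd _ _ _ _ UT.
have Usrc : U [set y | exists j, rng y (tl j (- x))].
  apply: filterS Ux => y <-; apply/punc_tile_shift; first exact: rng_punc.
  by rewrite -offE; exact: src_punc.
have OTx : Omega_punc S (translate (ulim U (@rng _ _ _ S)) x).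
  apply/punc_tile_shift => //.
  have /choice[g hg] : forall y : Rp, exists j, (exists j, rng y (tl j (- x))) -> rng y (tl j (- x)).
    move=> y; have [[j hj]|] := pselect (exists j, rng y (tl j (- x))); first by exists j.
    by exists (Ordinal (fm_gt0 F)).
  have [|j _ Uj] := ultra_pick (f := g) UU (finite_finset (X := [set: 'I_(fm F)])).
    exact: filterE.
  by exists j; apply: filterS (filterI Uj Usrc) => y [<- /hg].
pose y0 := rpack (Rset_intro OT OTx).
have o0 : off y0 = x by exact: off_uniq.
exists y0; split; first by rewrite /= o0.
move=> B /nbhs_sub_W[w hw]; change (U B); apply: filterS hw _.
have Uc : U [set y | cut (rng y) w = cut (ulim U (@rng _ _ _ S)) w] by exact: ulim_cut F hS hA hd _ _ _ _ UT w.
apply: filterS (filterI Ux Uc) => y [ox cy]; split; last by rewrite o0.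
by change (cut (ulim U (@rng _ _ _ S)) w `<=` rng y); rewrite -cy => t [].
Qed.

Lemma offsets_closed (X : set V) : closed [set y : Rp | X (off y)].
Proof. by move=> y /(_ _ (nbhs_W y 0))[y' [/= Xy' [_ <-]]]. Qed.

Lemma Cc_intro f (X : set V) : finite_set X -> offsets_in X f ->
  (forall y (e : R), 0 < e -> exists w, forall y', W y w y' -> cmod (f y' - f y) < e) -> Cc f.
Proof.
move=> fX oX /continuousRP cf; split=> //.
have sub : closure [set y | f y != 0] `<=` [set y | X (off y)].
  by rewrite [X in _ `<=` X](closure_id _).1; [apply: closure_subset|exact: offsets_closed].
exact: subclosed_compact (@closed_closure _ _) (offsets_compact fX) sub.
Qed.

(** Otherwise the sets of support arrows with offset outside a finite set generate a proper filter;
    a cluster point is excluded because [off] is locally constant. *)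
Lemma Cc_offsets f : Cc f -> exists2 X : set V, finite_set X & offsets_in X f.
Proof.
move=> [_ cpt]; apply: contrapT => none.
pose supf := [set y | f y != 0].
pose B (X : set V) := [set y | supf y /\ ~ X (off y)].
have FP : ProperFilter (filter_from (@finite_set V) B).
  apply: filter_from_proper; last first.
    move=> X fX; apply: contrapT => nB; apply: none; exists X => // y fy.
    by apply: contrapT => nX; apply: nB; exists y.
  apply: filter_from_filter; first by exists set0.
  move=> X Y fX fY; exists (X `|` Y); first by rewrite finite_setU.
  by move=> y [fy nXY]; split; split=> // h; apply: nXY; [left|right].
have [|y [_ cl]] := cpt _ FP.
  by exists set0 => // y [fy _]; exact: subset_closure.
have hB : filter_from (@finite_set V) B (B [set off y]) by exists [set off y].
by have [y' [[_ h] [_ o]]] := cl _ _ hB (nbhs_W y 0).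
Qed.

End Groupoid.

(** * Convolution and involution on compactly supported functions *)

Section Convolution.
Context {R : realType} {d : nat} {L : Type} {S : tiling_data R d L}.
Context (F : frame S) (hS : substitution_tiling_system S).
Context (hA : standing_assumptions S) (hd : (1 <= d)%N).
Local Notation V := 'cV[R]_d.
Local Notation D := (fD F).
Local Notation tl := (@tl R d L S F).
Local Notation cut := (cut F).
Local Notation Rp := (Rpunc S).
Local Notation W := (@W R d L S F).
Implicit Types (T : set (tile R d L)) (x z : V) (y : Rpunc S) (f h : Rpunc S -> R[i]).

Lemma at_pair_neq0 f TT : at_pair f TT != 0 -> exists y, [/\ rng y = TT.1, src y = TT.2 & f y != 0].
Proof.
move=> nz; have [hTT|nR] := pselect (Rset S TT); last by rewrite at_pair_out ?eqxx in nz.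
by exists (rpack hTT); rewrite -at_pair_rpack.
Qed.

Lemma at_pairE f T T' y : rng y = T -> src y = T' -> at_pair f (T, T') = f y.
Proof. by move=> <- <-; exact: at_pair_val. Qed.

Lemma at_pair_off f (X : set V) T z : offsets_in X f -> at_pair f (T, translate T z) != 0 -> X z.
Proof.
move=> oX /at_pair_neq0[y [/= e1 e2 /oX]].
by rewrite (off_uniq F hS hA hd (x := z)) // e1 e2.
Qed.

(* The factorizations of [y] are parametrized by the offset [z] of the first factor. *)
Lemma convolE f h y (X : {fset V}) : offsets_in [set` X] f ->
  convol f h y = \sum_(z <- X) at_pair f (rng y, translate (rng y) z) *
                               at_pair h (translate (rng y) z, src y).
Proof.
move=> oX; rewrite /convol.
(* The default [y] of [insubd] is irrelevant on [X'], where the intermediate tiling is punctured and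
   both pairs are genuine arrows. *)
pose e z : Rp * Rp := (insubd y (rng y, translate (rng y) z), insubd y (translate (rng y) z, src y)).
pose X' := [set z | z \in X /\ Omega_punc S (translate (rng y) z)].
have fX' : finite_set X' by apply: sub_finite_set (finite_fset X) => z [].
have R1 z : X' z -> Rset S (rng y, translate (rng y) z).
  by move=> [_ h1]; split=> //=; [exact: rng_punc|exists z].
have R2 z : X' z -> Rset S (translate (rng y) z, src y).
  move=> [_ h1]; split=> //=; first exact: src_punc.
  by exists (- z + off y); rewrite -translateD translateK -offE.
have v1 z : X' z -> rng (e z).1 = rng y /\ src (e z).1 = translate (rng y) z.
  by move=> /R1/mem_set h1; rewrite /rng /src /set_val /= !insubdK.
have v2 z : X' z -> rng (e z).2 = translate (rng y) z /\ src (e z).2 = src y.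
  by move=> /R2/mem_set h1; rewrite /rng /src /set_val /= !insubdK.
set Y := [set yy | _].
have eY : e @` X' `<=` Y.
  by move=> _ [z Xz <-]; have [a1 a2] := v1 z Xz; have [b1 b2] := v2 z Xz; split; rewrite ?a1 ?a2 ?b1 ?b2.
rewrite -(fsbig_widen _ _ _ eY); last first.
  move=> yy [[a1 a2 a3] nX]; apply/eqP; apply: contra_notT nX => nz.
  have f0 : f yy.1 != 0 by apply: contraNneq nz => ->; rewrite mul0r.
  have ez : src yy.1 = translate (rng y) (off yy.1) by rewrite offE a1.
  have Xz : X' (off yy.1).
    by split; [exact: oX|rewrite -ez; exact: src_punc].
  exists (off yy.1) => //; have [b1 b2] := v1 _ Xz; have [c1 c2] := v2 _ Xz.
  case: yy a1 a2 a3 ez Xz {f0 nz} b1 b2 c1 c2 => y1 y2 /= a1 a2 a3 ez Xz b1 b2 c1 c2.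
  by congr (_, _); apply: Rpunc_ext; rewrite ?b1 ?b2 ?c1 ?c2 ?a1 ?a2 ?a3 -?ez.
have einj : set_bij X' (e @` X') e.
  split; [by move=> z Xz; exists z| |by move=> p [z Xz <-]; exists z].
  move=> z z' /set_mem Xz /set_mem Xz' ee.
  have [_ h1] := v1 _ Xz; have [_ h2] := v1 _ Xz'.
  by apply: (translate_inj F hS hA hd (rng_punc y).1); rewrite -h1 -h2 ee.
rewrite (reindex_fsbig e X' (e @` X') (fun yy => f yy.1 * h yy.2) einj) fsbig_finite//.
rewrite [RHS](bigID (fun z => `[< Omega_punc S (translate (rng y) z) >])) /=.
rewrite [X in _ = _ + X]big1 ?addr0; last first.
  move=> z /asboolPn nO; rewrite at_pair_out ?mul0r// => -[_ /= h1 _]; exact: nO.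
rewrite -[RHS]big_filter.
have -> : \sum_(i <- fset_set X') f (e i).1 * h (e i).2 =
    \sum_(z <- fset_set X') at_pair f (rng y, translate (rng y) z) *
       at_pair h (translate (rng y) z, src y).
  apply: eq_big_seq => z; rewrite in_fset_set// inE => Xz.
  have [a1 a2] := v1 z Xz; have [b1 b2] := v2 z Xz.
  by rewrite (at_pairE _ a1 a2) (at_pairE _ b1 b2).
apply: perm_big; apply: uniq_perm; [exact: fset_uniq|by rewrite filter_uniq// fset_uniq|].
move=> z; rewrite mem_filter -[LHS]/(z \in fset_set X') in_fset_set// andbC.
apply/idP/andP => [/set_mem[zX /asboolP h1]//|[zX /asboolP h1]].
by apply: mem_set.
Qed.

(** The neighbourhoods [W] demand one inclusion of windows; the converse follows at the cost of a
    margin [2 * D]. *)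
Lemma agree_sym T T' w i x : Omega S T -> Omega S T' -> cut T w `<=` T' ->
  `|x| + 2 * D < w -> T' (tl i x) -> T (tl i x).
Proof.
move=> OT OT' c xw T'x; apply: (local_incl hS (Omega_Pstar OT) (Omega_Pstar OT') T'x).
  by move=> z _; rewrite (Omega_supp OT).
move=> j v Tv xv; apply: c; split=> //; exists j, v; split=> //.
apply: le_lt_trans xw; rewrite -(subrK x v) addrC; apply: le_trans (ler_normD _ _) _.
by rewrite lerD2l distrC.
Qed.

Definition cont_at y (u : Rp -> R[i]) :=
  forall e : R, 0 < e -> exists w, forall y', W y w y' -> cmod (u y' - u y) < e.

Lemma cont_atD y u v : cont_at y u -> cont_at y v -> cont_at y (fun y => u y + v y).
Proof.
move=> cu cv e e0; have e2 : 0 < e / 2 by rewrite divr_gt0.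
have [w1 h1] := cu _ e2; have [w2 h2] := cv _ e2.
exists (Num.max w1 w2) => y' Wy.
have le1 : w1 <= Num.max w1 w2 by rewrite le_max lexx.
have le2 : w2 <= Num.max w1 w2 by rewrite le_max lexx orbT.
have -> : u y' + v y' - (u y + v y) = (u y' - u y) + (v y' - v y) by ring.
apply: le_lt_trans (cmodD _ _) _; rewrite [ltRHS](splitr e).
by apply: ltrD; [apply: h1|apply: h2]; apply: W_le Wy.
Qed.

Lemma cont_atM y u v : cont_at y u -> cont_at y v -> cont_at y (fun y => u y * v y).
Proof.
move=> cu cv e e0.
pose c := cmod (u y) + cmod (v y) + 1.
have c1 : 1 <= c by rewrite /c lerDr addr_ge0// cmod_ge0.
have c0 : 0 < c by exact: lt_le_trans c1.
pose e' := Num.min 1 (e / (2 * c)).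
have e'0 : 0 < e' by rewrite lt_min ltr01 divr_gt0// mulr_gt0.
have [w1 h1] := cu _ e'0; have [w2 h2] := cv _ e'0.
exists (Num.max w1 w2) => y' Wy.
have le1 : w1 <= Num.max w1 w2 by rewrite le_max lexx.
have le2 : w2 <= Num.max w1 w2 by rewrite le_max lexx orbT.
have d1 := h1 _ (W_le le1 Wy); have d2 := h2 _ (W_le le2 Wy).
have -> : u y' * v y' - u y * v y = (u y' - u y) * (v y' - v y) +
   (u y' - u y) * v y + u y * (v y' - v y) by ring.
apply: le_lt_trans (cmodD _ _) _.
apply: (@le_lt_trans _ _ (cmod (u y' - u y) * 1 + cmod (u y' - u y) * cmod (v y) + cmod (u y) * e')).
  apply: lerD; last by rewrite cmodM ler_wpM2l ?cmod_ge0// ltW.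
  apply: le_trans (cmodD _ _) _; rewrite !cmodM lerD2r ler_wpM2l ?cmod_ge0//.
  by apply: (le_trans (ltW d2)); rewrite ge_min lexx.
apply: (@le_lt_trans _ _ (c * e')).
  rewrite /c; have := cmod_ge0 (v y); have := ltW d1; have := cmod_ge0 (u y); nra.
apply: (@le_lt_trans _ _ (c * (e / (2 * c)))).
  by rewrite ler_pM2l// ge_min lexx orbT.
have -> : c * (e / (2 * c)) = e / 2 by field; rewrite gt_eqF.
by rewrite ltr_pdivrMr// ltr_pMr// ltr1n.
Qed.

Lemma cont_at_cst y (c : R[i]) : cont_at y (fun=> c).
Proof. by move=> e e0; exists 0 => y' _; rewrite subrr cmod0. Qed.

Lemma cont_at_sum y (I : Type) (s : seq I) (u : I -> Rp -> R[i]) :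
  (forall i, cont_at y (u i)) -> cont_at y (fun y => \sum_(i <- s) u i y).
Proof.
move=> cu; elim: s => [|i s IHs].
  have -> : (fun y => \sum_(i <- [::]) u i y) = fun=> 0 by apply/funext => y'; rewrite big_nil.
  exact: cont_at_cst.
have -> : (fun y => \sum_(j <- i :: s) u j y) = fun y => u i y + \sum_(j <- s) u j y.
  by apply/funext => y'; rewrite big_cons.
exact: cont_atD.
Qed.

(** Besides continuity of [f], this needs that being an arrow is locally constant, because [at_pair]
    jumps to 0 elsewhere. *)
Lemma cont_at_pair y f x z : Cc f ->
  forall e : R, 0 < e -> exists w, forall y', cut (rng y) w `<=` rng y' ->
    cmod (at_pair f (translate (rng y') x, translate (rng y') z) -
          at_pair f (translate (rng y) x, translate (rng y) z)) < e.
Proof.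
move=> [/(continuousRP F hS hA hd) cf _] e e0.
have D0 := D_ge0 F.
pose w0 := `|x| + `|z| + 2 * D + 1.
have same y' v : `|v| <= `|x| + `|z| -> cut (rng y) w0 `<=` rng y' ->
    Omega_punc S (translate (rng y) v) <-> Omega_punc S (translate (rng y') v).
  move=> vxz c; rewrite !(punc_tile_shift F hS); try exact: rng_punc.
  split=> -[j hj]; exists j.
    by apply: c; split=> //; exists j, (- v); split=> //; rewrite normrN /w0; lra.
  apply: (@agree_sym _ (rng y') w0) => //; [by case: (rng_punc y)|by case: (rng_punc y')|].
  by rewrite normrN /w0; lra.
have xle : `|x| <= `|x| + `|z| by rewrite lerDl.
have zle : `|z| <= `|x| + `|z| by rewrite lerDr.
have pair T : Rset S (translate T x, translate T z) <->
    Omega_punc S (translate T x) /\ Omega_punc S (translate T z).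
  split=> [[]//|[h1 h2]]; split=> //; exists (z - x) => /=.
  by rewrite translateD addrCA subrr addr0.
have [hR|nR] := pselect (Rset S (translate (rng y) x, translate (rng y) z)); last first.
  exists w0 => y' c; rewrite !at_pair_out ?subrr ?cmod0//.
  by move=> /pair[h1 h2]; apply: nR; apply/pair; split; [apply/(same y' x)|apply/(same y' z)].
have [w1 hw1] := cf (rpack hR) e e0.
pose w := Num.max w0 (w1 + `|x|).
exists w => y' c.
have c0 : cut (rng y) w0 `<=` rng y'.
  move=> t [Tt [k [v [ek vw]]]]; apply: c; split=> //; exists k, v; split=> //.
  by rewrite lt_max vw.
have hR' : Rset S (translate (rng y') x, translate (rng y') z).
  by have /pair[h1 h2] := hR; apply/pair; split; [apply/(same y' x)|apply/(same y' z)].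
rewrite (at_pair_rpack _ hR) (at_pair_rpack _ hR'); apply: hw1.
have o (T : set (tile R d L)) : translate T z = translate (translate T x) (z - x).
  by rewrite translateD addrCA subrr addr0.
split; last first.
  have -> : off (rpack hR') = z - x by apply: (off_uniq F hS hA hd); exact: o.
  by apply/esym; apply: (off_uniq F hS hA hd); exact: o.
move=> t [ht [k [v [ek vw]]]]; subst t.
change (translate (rng y') x (tl k v)); change (translate (rng y) x (tl k v)) in ht.
move: ht; rewrite !translateE translate_tl => ht; apply: c; split=> //.
exists k, (v - x); split=> //; rewrite lt_max; apply/orP; right.
by apply: le_lt_trans (ler_normB _ _) _; rewrite ltrD2r.
Qed.

Lemma Cc_fset f : Cc f -> exists X : {fset V}, offsets_in [set` X] f.
Proof.
move=> /(Cc_offsets F hS hA hd)[X fX oX]; exists (fset_set X) => y /oX h1.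
by rewrite /= in_fset_set// inE.
Qed.

Lemma Cc_convol f h : Cc f -> Cc h -> Cc (convol f h).
Proof.
move=> cf ch; have [X oX] := Cc_fset cf; have [Y oY] := Cc_fset ch.
have eq y : convol f h y = \sum_(z <- X) at_pair f (translate (rng y) 0, translate (rng y) z) *
    at_pair h (translate (rng y) z, translate (rng y) (off y)).
  by rewrite (convolE _ _ oX); apply: eq_bigr => z _; rewrite translate0 -offE.
apply: (Cc_intro (F := F) hS hA hd (X := [set p.1 + p.2 | p in [set` X] `*` [set` Y]])).
- by apply: finite_image; apply: finite_setX; exact: finite_fset.
- move=> y; rewrite (convolE _ _ oX) => nz.
  have [z zX hz] : exists2 z, z \in X & at_pair f (rng y, translate (rng y) z) *
      at_pair h (translate (rng y) z, src y) != 0.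
    apply: contrapT => none; move: nz; rewrite big_seq big1 ?eqxx// => z zX.
    by apply/eqP; apply: contra_notT none => nz; exists z.
  have h0 : at_pair h (translate (rng y) z, src y) != 0.
    by apply: contraNneq hz => ->; rewrite mulr0.
  exists (z, off y - z); last by rewrite /= addrCA subrr addr0.
  split=> //=; apply: (at_pair_off (T := translate (rng y) z) oY).
  by rewrite translateD addrCA subrr addr0 -offE.
- move=> y e e0.
  have [|w hw] := @cont_at_sum y _ (enum_fset X) (fun z y' =>
     at_pair f (translate (rng y') 0, translate (rng y') z) *
     at_pair h (translate (rng y') z, translate (rng y') (off y))) _ e e0.
    move=> z; apply: cont_atM => e' e'0.
      by have [w hw] := cont_at_pair y 0 z cf e'0; exists w => y' [c _]; exact: hw.
    by have [w hw] := cont_at_pair y z (off y) ch e'0; exists w => y' [c _]; exact: hw.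
  exists w => y' Wy; rewrite !eq; have [_ ->] := Wy; exact: hw.
Qed.

Lemma Cc_involution f : Cc f -> Cc (involution_Cc f).
Proof.
move=> cf; have [X oX] := Cc_fset cf.
apply: (Cc_intro (F := F) hS hA hd (X := [set - x | x in [set` X]])).
- exact/finite_image/finite_fset.
- move=> y; rewrite /involution_Cc => nz; exists (- off y); last by rewrite opprK.
  apply: (at_pair_off (T := src y) oX); rewrite {2}offE translateK.
  by apply: contraNneq nz => ->; rewrite conjc0.
- move=> y e e0; have [w hw] := cont_at_pair y (off y) 0 cf e0.
  exists w => y' [c o]; rewrite /involution_Cc -rmorphB /= cmodJ !offE o.
  by have := hw y' c; rewrite !translate0.
Qed.

Lemma Cc_lin (c : R[i]) f h : Cc f -> Cc h -> Cc (fun y => c * f y + h y).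
Proof.
move=> cf ch; have [X fX oX] := Cc_offsets F hS hA hd cf; have [Y fY oY] := Cc_offsets F hS hA hd ch.
apply: (Cc_intro (F := F) hS hA hd (X := X `|` Y)); first by rewrite finite_setU.
- move=> y nz; have [f0|/oX] := eqVneq (f y) 0; last by left.
  by right; apply: oY; apply: contraNneq nz => h0; rewrite f0 h0 mulr0 addr0.
- move=> y; apply: cont_atD; first apply: cont_atM; first exact: cont_at_cst.
    by case: cf => /(continuousRP F hS hA hd) cf' _ e; exact: cf'.
  by case: ch => /(continuousRP F hS hA hd) ch' _ e; exact: ch'.
Qed.

End Convolution.

(** * Norm estimates *)

Section CnormFacts.
Context {R : realType} {A : cstarAlgType R}.
Implicit Types a b : A.

Lemma cnorm0 : cnorm (0 : A) = 0.
Proof. by rewrite -(scale0r (0 : A)) cnormZ cmod0 mul0r. Qed.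

Lemma cnormN a : cnorm (- a) = cnorm a.
Proof. by rewrite -scaleN1r cnormZ cmodN cmod1 mul1r. Qed.

Lemma cnorm_ge0 a : 0 <= cnorm a.
Proof.
have : 0 <= cnorm a + cnorm a by rewrite -{2}cnormN -cnorm0 -(subrr a) cnormD.
lra.
Qed.

Lemma cnormB a b : cnorm (a - b) <= cnorm a + cnorm b.
Proof. by rewrite -(cnormN b) cnormD. Qed.

Lemma cnorm_star_eq a : cnorm (star a) = cnorm a.
Proof.
have le b : cnorm b <= cnorm (star b).
  have [->|b0] := eqVneq (cnorm b) 0; first exact: cnorm_ge0.
  have bp : 0 < cnorm b by rewrite lt_neqAle eq_sym b0 cnorm_ge0.
  by rewrite -(ler_pM2r bp) -expr2 -cnorm_star cnormM.
by apply/eqP; rewrite eq_le le -{2}(starK a) le.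
Qed.

End CnormFacts.

Section L2.
Context {R : realType} {d : nat} {L : Type} {S : tiling_data R d L}.
Implicit Types (T : set (tile R d L)) (xi : Rpunc S -> R[i]).

Lemma l2sq_le T xi (M : R) :
  (forall s : seq (Rpunc S), uniq s -> (forall y, y \in s -> src y = T) ->
    \sum_(y <- s) cmod (xi y) ^+ 2 <= M) -> (l2sq T xi <= M%:E)%E.
Proof.
move=> hM; apply: ge_ereal_sup => _ [X [fX sX] <-].
rewrite fsbig_finite//= sumEFin lee_fin; apply: hM; first exact: fset_uniq.
by move=> y; rewrite -[_ \in _]/(y \in fset_set X) in_fset_set// inE => /sX.
Qed.

Lemma l2sq_ge T xi (s : seq (Rpunc S)) : uniq s -> (forall y, y \in s -> src y = T) ->
  ((\sum_(y <- s) cmod (xi y) ^+ 2)%:E <= l2sq T xi)%E.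
Proof.
move=> us sT; apply: ereal_sup_ubound; exists [set` s]; first by split; [exact: finite_seq|].
by rewrite -fsbig_seq// sumEFin.
Qed.

End L2.

Lemma sqr_sum_le (R : realType) (I : Type) (s : seq I) (c : I -> R) :
  (\sum_(i <- s) c i) ^+ 2 <= (size s)%:R * \sum_(i <- s) c i ^+ 2.
Proof.
rewrite expr2 big_distrlr /=.
apply: (@le_trans _ _ (\sum_(i <- s) \sum_(j <- s) (c i ^+ 2 + c j ^+ 2) / 2)).
  apply: ler_sum => i _; apply: ler_sum => j _.
  by rewrite ler_pdivlMr//; have := sqr_ge0 (c i - c j); rewrite sqrrB; lra.
have cst (a : R) : \sum_(j <- s) a = (size s)%:R * a.
  by rewrite big_const_seq count_predT iter_addr addr0 mulr_natl.
have -> : \sum_(i <- s) \sum_(j <- s) (c i ^+ 2 + c j ^+ 2) / 2 =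
    \sum_(i <- s) ((size s)%:R * c i ^+ 2 + \sum_(j <- s) c j ^+ 2) / 2.
  by apply: eq_bigr => i _; rewrite -mulr_suml big_split /= cst.
rewrite -mulr_suml big_split /= -mulr_sumr cst ler_pdivrMr//.
lra.
Qed.

Lemma big_fset_single (W : nmodType) (K : choiceType) (X : {fset K}) (z0 : K) (g : K -> W) :
  (forall z, z != z0 -> g z = 0) -> (z0 \notin X -> g z0 = 0) -> \sum_(z <- X) g z = g z0.
Proof.
move=> h1 h2; have [zX|nX] := boolP (z0 \in X).
  by rewrite (big_fsetD1 z0) //= big_seq big1 ?addr0// => z; rewrite !inE => /andP[/h1].
rewrite h2// big_seq big1// => z zX; apply: h1.
by apply: contraNneq nX => <-.
Qed.

Section ReducedNorm.
Context {R : realType} {d : nat} {L : Type} {S : tiling_data R d L}.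
Context (F : frame S) (hS : substitution_tiling_system S).
Context (hA : standing_assumptions S) (hd : (1 <= d)%N).
Local Notation V := 'cV[R]_d.
Local Notation Rp := (Rpunc S).
Implicit Types (T : set (tile R d L)) (x z : V) (y : Rpunc S) (f h xi : Rpunc S -> R[i]).

(** Translating the range is injective on arrows with source [T], so no coordinate of [xi] is
    counted twice. *)
Lemma l2sq_translate T xi z (s : seq Rp) : (l2sq T xi <= 1)%E -> uniq s ->
  (forall y, y \in s -> src y = T) ->
  \sum_(y <- s) cmod (at_pair xi (translate (rng y) z, T)) ^+ 2 <= 1.
Proof.
move=> xi1 us sT.
pose e y : Rp := insubd y (translate (rng y) z, T).
pose p y := `[< Rset S (translate (rng y) z, T) >].
have eP y : p y -> rng (e y) = translate (rng y) z /\ src (e y) = T.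
  by move=> /asboolP/mem_set hR; rewrite /rng /src /set_val /= insubdK.
rewrite (bigID p) /= [X in _ + X]big1 ?addr0; last first.
  by move=> y /asboolPn nR; rewrite at_pair_out// cmod0 expr0n.
rewrite -big_filter.
have -> : \sum_(y <- [seq y <- s | p y]) cmod (at_pair xi (translate (rng y) z, T)) ^+ 2 =
    \sum_(y <- [seq e y | y <- s & p y]) cmod (xi y) ^+ 2.
  rewrite big_map; apply: eq_big_seq => y; rewrite mem_filter => /andP[/eP[h1 h2] _].
  by rewrite (at_pairE _ h1 h2).
rewrite -lee_fin; apply: le_trans xi1; apply: l2sq_ge.
  rewrite map_inj_in_uniq ?filter_uniq// => y y'.
  rewrite !mem_filter => /andP[/eP[a1 a2] ys] /andP[/eP[b1 b2] ys'] ee.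
  apply: Rpunc_ext; last by rewrite !sT.
  by rewrite -(translateK (rng y) z) -a1 ee b1 translateK.
by move=> _ /mapP[y + ->]; rewrite mem_filter => /andP[/eP[]].
Qed.

(** Such a function is a sum of [size X] partial translations with coefficients bounded by [B], each
    a contraction up to the factor [B]. *)
Lemma reduced_norm_le k (X : {fset V}) (B : R) : 0 <= B -> offsets_in [set` X] k ->
  (forall y, cmod (k y) <= B) -> (reduced_norm k <= ((size X)%:R * B)%:E)%E.
Proof.
move=> B0 oX kB; apply: ge_ereal_sup => _ [T [xi [OT xi1 ->]]].
have N0 : 0 <= (size X)%:R :> R by [].
apply: (@le_trans _ _ (sqrte (((size X)%:R * B) ^+ 2)%:E)); last first.
  by rewrite /= sqrtr_sqr ger0_norm// mulr_ge0.
rewrite lee_sqrt; last by rewrite lee_fin sqr_ge0.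
apply: l2sq_le => s us sT.
pose c z y := cmod (at_pair xi (translate (rng y) z, T)).
apply: (@le_trans _ _ (\sum_(y <- s) B ^+ 2 * ((size X)%:R * \sum_(z <- X) c z y ^+ 2))).
  rewrite big_seq [leRHS]big_seq; apply: ler_sum => y ys.
  apply: (@le_trans _ _ (B ^+ 2 * (\sum_(z <- X) c z y) ^+ 2)); last first.
    by rewrite ler_wpM2l ?sqr_ge0// sqr_sum_le.
  rewrite -exprMn lerXn2r ?nnegrE ?cmod_ge0//.
    by rewrite mulr_ge0// sumr_ge0// => z _; exact: cmod_ge0.
  rewrite (convolE F hS hA hd _ _ oX) mulr_sumr.
  apply: le_trans (cmod_sum _ _) _; apply: ler_sum => z _.
  rewrite cmodM /c sT// ler_wpM2r ?cmod_ge0//.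
  have [hR|nR] := pselect (Rset S (rng y, translate (rng y) z)).
    by rewrite (at_pair_rpack _ hR).
  by rewrite at_pair_out// cmod0.
rewrite -mulr_sumr -mulr_sumr exchange_big /=.
have le : \sum_(z <- X) \sum_(y <- s) c z y ^+ 2 <= (size X)%:R.
  apply: (@le_trans _ _ (\sum_(z <- X) 1)).
    by apply: ler_sum => z _; exact: l2sq_translate.
  by rewrite big_const_seq count_predT iter_addr addr0.
have -> : ((size X)%:R * B) ^+ 2 = B ^+ 2 * ((size X)%:R * (size X)%:R) by ring.
by rewrite ler_wpM2l ?sqr_ge0// ler_wpM2l.
Qed.

Context {A : cstarAlgType R} {iota : (Rpunc S -> R[i]) -> A}.
Context (hI : is_reduced_algebra iota).

Lemma cnorm_iota_le k (X : {fset V}) (B : R) : Cc k -> 0 <= B -> offsets_in [set` X] k ->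
  (forall y, cmod (k y) <= B) -> cnorm (iota k) <= (size X)%:R * B.
Proof.
by move=> ck B0 oX kB; rewrite -lee_fin (iota_norm hI ck) reduced_norm_le.
Qed.

Lemma Rset_diag T : Omega_punc S T -> Rset S (T, T).
Proof. by move=> OT; split=> //; exists 0; rewrite translate0. Qed.

(** Test the regular representation on the unit vector at the identity arrow of [src y]: the image
    takes the value [f y] at [y]. *)
Lemma cmod_le_cnorm f y : Cc f -> cmod (f y) <= cnorm (iota f).
Proof.
move=> cf; rewrite -lee_fin (iota_norm hI cf).
have [X oX] := Cc_fset F hS hA hd cf.
pose u := rpack (Rset_diag (src_punc y)).
pose dl (y' : Rp) : R[i] := (y' == u)%:R.
have convdl : convol f dl y = f y.
  rewrite (convolE F hS hA hd _ _ oX) (big_fset_single (z0 := off y)).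
  - rewrite -offE at_pair_val (at_pair_rpack _ (Rset_diag (src_punc y))).
    by rewrite /dl eqxx mulr1.
  - move=> z zo; rewrite [X in _ * X](_ : _ = 0) ?mulr0//.
    apply/eqP; apply: contraNT zo => /at_pair_neq0[y' [/= e1 _]].
    rewrite /dl; have [ey _|_] := eqVneq y' u; last by rewrite eqxx.
    apply/eqP; apply: (translate_inj F hS hA hd (rng_punc y).1).
    by rewrite -offE -e1 ey.
  - move=> nX; rewrite [X in X * _](_ : _ = 0) ?mul0r//.
    by apply/eqP; apply: contraNT nX; rewrite -offE at_pair_val => /oX.
apply: (@le_trans _ _ (sqrte (l2sq (src y) (convol f dl)))).
  have -> : (cmod (f y))%:E = sqrte (cmod (f y) ^+ 2)%:E.
    by rewrite /= sqrtr_sqr ger0_norm// cmod_ge0.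
  have hge : ((cmod (f y) ^+ 2)%:E <= l2sq (src y) (convol f dl))%E.
    have := @l2sq_ge _ _ _ _ (src y) (convol f dl) [:: y] isT.
    rewrite big_seq1 convdl; apply=> y'; by rewrite inE => /eqP ->.
  by rewrite lee_sqrt//; apply: le_trans hge; rewrite lee_fin sqr_ge0.
apply: ereal_sup_ubound; exists (src y), dl; split=> //; first exact: src_punc.
apply: l2sq_le => s us _.
have -> : \sum_(y' <- s) cmod (dl y') ^+ 2 = (count_mem u s)%:R.
  rewrite -sum1_count [in RHS]big_mkcond natr_sum; apply: eq_bigr => y' _.
  by rewrite /dl /=; case: (y' == u); rewrite /= ?cmod1 ?cmod0 ?expr1n ?expr0n.
by rewrite lern1 count_uniq_mem//; case: (u \in s).
Qed.

Lemma iota_sub f h : Cc f -> Cc h -> iota f - iota h = iota (fun y => f y - h y).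
Proof.
move=> cf ch; have := iota_linear hI (-1) ch cf.
rewrite scaleN1r addrC => <-; congr iota; apply/funext => y.
by rewrite mulN1r addrC.
Qed.

End ReducedNorm.

(** * Functions of the address and traces *)

Section Towers.
Context {R : realType} {d : nat} {L : Type} {S : tiling_data R d L}.
Context (F : frame S) (hS : substitution_tiling_system S).
Context (hA : standing_assumptions S) (hd : (1 <= d)%N).
Local Notation V := 'cV[R]_d.
Local Notation lam := (scale S).
Local Notation om := (@om R d L S).
Local Notation tl := (@tl R d L S F).
Local Notation Lam := (@Lam R d L S F).
Local Notation addresses := (@addresses R d L S F).
Local Notation address := ('I_(fm F) * V)%type.
Implicit Types (T : set (tile R d L)) (x z : V) (y : Rpunc S) (f h : Rpunc S -> R[i]).
Implicit Types (psi : 'I_(fm F) * 'cV[R]_d -> R[i]).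

Definition addr n T : address := xget (Ordinal (fm_gt0 F), 0) [set a | Addr n T a].

Lemma addrP n T : Omega_punc S T -> Addr n T (addr n T).
Proof.
move=> OT; rewrite /addr; case: xgetP => [a _ //|none].
by have [a ha] := Addr_exists F hS hA hd n OT; exfalso; exact: none a ha.
Qed.

Lemma addr_eq n T a : Omega_punc S T -> Addr n T a -> addr n T = a.
Proof. by move=> OT; exact: Addr_uniq (addrP n OT). Qed.

(* The function [T |-> psi (addr n T)] carried by the graph of [T |-> T + z]. *)
Definition Ef n psi z y : R[i] := if off y == z then psi (addr n (rng y)) else 0.

Lemma Ef_neq0 n psi z y : Ef n psi z y != 0 -> off y = z.
Proof. by rewrite /Ef; have [->|_] := eqVneq (off y) z; rewrite ?eqxx. Qed.

Lemma Ef_offsets n psi z : offsets_in [set` [fset z]%fset] (Ef n psi z).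
Proof. by move=> y /Ef_neq0 ->; rewrite /= inE. Qed.

(** Recognizability makes the address locally constant, which gives continuity. *)
Lemma Cc_Ef n psi z : Cc (Ef n psi z).
Proof.
apply: (Cc_intro (F := F) hS hA hd) (@Ef_offsets n psi z) _; first exact: finite_fset.
move=> y e e0; have [w hw] := recognizability F hS hA hd n.
exists w => y' [c o].
rewrite /Ef o; have -> : addr n (rng y') = addr n (rng y).
  apply: addr_eq; first exact: rng_punc.
  by apply: hw c (addrP n (rng_punc y)); exact: rng_punc.
by rewrite subrr cmod0.
Qed.

Lemma at_pair_Ef n psi z T : Omega_punc S T -> Omega_punc S (translate T z) ->
  at_pair (Ef n psi z) (T, translate T z) = psi (addr n T).
Proof.
move=> OT OTz; rewrite (at_pair_rpack _ (Rset_intro OT OTz)) /Ef.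
by rewrite (off_uniq F hS hA hd (x := z)) ?eqxx.
Qed.

Lemma at_pair_Ef0 n psi T : Omega_punc S T -> at_pair (Ef n psi 0) (T, T) = psi (addr n T).
Proof. by move=> OT; rewrite -{2}(translate0 T) at_pair_Ef ?translate0. Qed.

Lemma convol_Ef_l n psi h y : convol (Ef n psi 0) h y = psi (addr n (rng y)) * h y.
Proof.
rewrite (convolE F hS hA hd _ _ (@Ef_offsets n psi 0)) big_seq_fset1.
rewrite translate0 at_pair_Ef0 ?at_pair_val//; exact: rng_punc.
Qed.

Lemma convol_Ef_r n psi f y : Cc f -> convol f (Ef n psi 0) y = f y * psi (addr n (src y)).
Proof.
move=> cf; have [X oX] := Cc_fset F hS hA hd cf.
rewrite (convolE F hS hA hd _ _ oX) (big_fset_single (z0 := off y)).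
- rewrite -offE at_pair_val at_pair_Ef0//; exact: src_punc.
- move=> z zo; rewrite [X in _ * X](_ : _ = 0) ?mulr0//.
  apply/eqP; apply: contraNT zo => /at_pair_neq0[y' [/= e1 e2]].
  move=> /Ef_neq0 eo; apply/eqP/(translate_inj F hS hA hd (rng_punc y).1).
  by rewrite -e1 -offE -e2 offE eo translate0.
- move=> nX; rewrite [X in X * _](_ : _ = 0) ?mul0r//.
  by apply/eqP; apply: contraNT nX; rewrite -offE at_pair_val => /oX.
Qed.

Lemma convol_Ef_diag n psi psi' :
  convol (Ef n psi 0) (Ef n psi' 0) = Ef n (fun a => psi a * psi' a) 0.
Proof.
apply/funext => y; rewrite convol_Ef_l /Ef; case: eqP => // _.
by rewrite mulr0.
Qed.

Lemma involution_Ef n psi : involution_Cc (Ef n psi 0) = Ef n (fun a => conjc (psi a)) 0.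
Proof.
apply/funext => y; rewrite /involution_Cc {2}/Ef; case: eqP => eo.
  rewrite offE eo translate0 at_pair_Ef0//; exact: rng_punc.
rewrite [X in conjc X](_ : _ = 0) ?conjc0//.
apply/eqP; apply: contra_notT eo => /at_pair_neq0[y' [/= e1 e2 /Ef_neq0 eo]].
apply: (off_uniq F hS hA hd); rewrite translate0 -e1 -e2.
by rewrite offE eo translate0.
Qed.

Lemma Addr_shift n T i x x' : Omega S T -> Addr n T (i, x) -> addresses n (i, x') ->
  Omega_punc S (translate T (x - x')) /\ Addr n (translate T (x - x')) (i, x').
Proof.
move=> OT [T1 [OT1 e1 /= h1 _]] [j Lj].
have OTz : Omega S (translate T (x - x')) by exact: (Omega_translate F hS).
split.
  apply/(Omega_puncE F hS); split=> //; exists j.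
  rewrite translateE translate_tl add0r opprB -e1.
  apply/(omE hS _ _ (fun t => Omega_tl F OT1)).
  by exists i, (- (lam ^- n *: x)), (j, x'); rewrite scalerN (lamXK hS).
exists (translate T1 (lam ^- n *: (x - x'))); split=> /=.
- exact: (Omega_translate F hS).
- rewrite (om_translate (F := F) hS) ?(lamXK hS) ?e1// => t; exact: (Omega_tl F OT1).
- rewrite translateE translate_tl; congr (T1 (tl _ _)): h1.
  by rewrite scalerBr opprB addrA addNr add0r.
- by exists j.
Qed.

Definition dirac (a : address) : address -> R[i] := fun b => (b == a)%:R.

(** The two factors are the matrix units with range and source at the positions [x], [x'] and [x'],
    [x] of a supertile of type [i]; their product is the diagonal unit at [x]. *)
Lemma convol_dirac n i x x' : addresses n (i, x) -> addresses n (i, x') ->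
  convol (Ef n (dirac (i, x)) (x - x')) (Ef n (dirac (i, x')) (x' - x)) = Ef n (dirac (i, x)) 0.
Proof.
move=> ax ax'; apply/funext => y.
rewrite (convolE F hS hA hd _ _ (@Ef_offsets n _ (x - x'))) big_seq_fset1.
have OT := rng_punc y.
have [e|ne] := eqVneq (addr n (rng y)) (i, x); last first.
  rewrite [X in X * _](_ : _ = 0) ?mul0r.
    by rewrite /Ef /dirac (negbTE ne); case: eqP.
  apply/eqP; apply: contraNT ne => /at_pair_neq0[y' [/= e1 _]].
  by rewrite /Ef e1 /dirac; case: (addr n (rng y) == _); rewrite //= if_same eqxx.
have [Oz Az] : Omega_punc S (translate (rng y) (x - x')) /\ Addr n (translate (rng y) (x - x')) (i, x').
  by apply: Addr_shift => //; [case: OT|rewrite -e; exact: addrP].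
rewrite at_pair_Ef// e /dirac eqxx mul1r.
have back T : translate (translate T (x - x')) (x' - x) = T.
  by rewrite translateD addrA subrK subrr translate0.
rewrite {2}/Ef e eqxx; case: eqP => eo.
  rewrite offE eo translate0 -{2}(back (rng y)) at_pair_Ef//; last by rewrite back.
  by rewrite (addr_eq Oz Az) eqxx.
apply/eqP; apply: contra_notT eo => /at_pair_neq0[y' [/= e1 e2 /Ef_neq0 eo]].
by apply: (off_uniq F hS hA hd); rewrite translate0 -e2 offE eo e1 back.
Qed.

Definition adrF n : {fset address} := fset_set (addresses n).

Lemma in_adrF n a : a \in adrF n <-> addresses n a.
Proof. by rewrite in_fset_set ?inE//; exact: addresses_finite. Qed.

Lemma big_adrF (W : nmodType) n (g : address -> W) :
  \sum_(a <- adrF n) g a = \sum_i \sum_(b <- LamF n i) g (i, b.2).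
Proof.
transitivity (\sum_(a <- [seq (i, b.2) | i <- enum 'I_(fm F), b <- LamF n i]) g a).
  apply: perm_big; apply: uniq_perm; first exact: fset_uniq.
    apply: allpairs_uniq_dep; [exact: enum_uniq|by move=> i _; exact: fset_uniq|].
    move=> [i b] [i' b'] /allpairsPdep[i1 [b1 [_ /(LamFP hS) Lb /= [? ?]]]].
    move=> /allpairsPdep[i2 [b2 [_ /(LamFP hS) Lb' /= [? ?]]]] [e1 e2]; subst.
    have [|||eb _] := Pstar_sep hS (Pstar_supertile hS n i2) (i := b1.1) (x := b1.2) (j := b2.1) (y := b2.2).
    - exact: Lb.
    - exact: Lb'.
    - by rewrite e2 subrr normr0; exact: fr_gt0.
    by case: b1 b2 eb e2 {Lb Lb'} => [? ?] [? ?] /= -> ->.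
  move=> a; apply/idP/allpairsPdep => [/in_adrF[j La]|].
    exists a.1, (j, a.2); split; [by rewrite mem_enum|exact/(LamFP hS)|].
    by case: (a).
  by move=> [i [[j x] [_ /(LamFP hS) Lb ->]]]; apply/in_adrF; exists j.
by rewrite big_allpairs_dep big_enum.
Qed.

(* The level-n address determined by a level-(n+k) address. *)
Definition descend n k (c : address) : address :=
  xget c [set q | exists a b, [/\ Lam k c.1 a, Lam n a.1 b,
    c.2 = b.2 + lam ^+ n *: a.2 & q = (a.1, b.2)]].

Lemma descendE n k j a b : Lam k j a -> Lam n a.1 b ->
  descend n k (j, b.2 + lam ^+ n *: a.2) = (a.1, b.2).
Proof.
move=> La Lb; rewrite /descend; case: xgetP => [q _ [a' [b' [/= La' Lb' e ->]]]|none]; last first.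
  by exfalso; apply: (none (a.1, b.2)); exists a, b.
have h1 : Lam (n + k) j (b.1, b.2 + lam ^+ n *: a.2) by apply/(Lam_add hS); exists a, b.
have h2 : Lam (n + k) j (b'.1, b.2 + lam ^+ n *: a.2) by apply/(Lam_add hS); exists a', b'; rewrite -e.
have [e1 _] : b.1 = b'.1 /\ b.2 + lam ^+ n *: a.2 = b.2 + lam ^+ n *: a.2.
  apply: (Pstar_sep hS (Pstar_supertile hS (n + k) j) h1 h2).
  by rewrite subrr normr0; exact: fr_gt0.
by have [-> ->] := Lam_add_inj hS La Lb La' Lb' e1 e.
Qed.

Lemma addr_descend n k T : Omega_punc S T -> addr n T = descend n k (addr (n + k) T).
Proof.
move=> OT; have [T1 [OT1 e1 h1 [l Ll]]] := addrP (n + k) OT.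
case: (addr (n + k) T) h1 Ll => j x' /= h1 /(Lam_add hS)[a [b [La Lb [el ex]]]].
rewrite ex descendE//; apply: addr_eq => //.
exists (om k T1); split=> /=.
- exact: (Omega_om F hS).
- by rewrite -omD.
- apply/(omE hS _ _ (fun t => Omega_tl F OT1)).
  exists j, (- (lam ^- (n + k) *: x')), a; split=> //; congr tl.
  have -> : lam ^+ k *: - (lam ^- (n + k) *: x') = - (lam ^- n *: x').
    by rewrite scalerN exprD invfM mulrC -scalerA (lamXK hS).
  by rewrite ex scalerDr (lamXVK hS) opprD addrCA subrr addr0.
- by exists b.1; case: (b) Lb.
Qed.

Lemma sum_descend (W : nmodType) n k j (g : address -> W) :
  \sum_(c <- LamF (n + k) j) g (descend n k (j, c.2)) =
  \sum_(a <- LamF k j) \sum_(b <- LamF n a.1) g (a.1, b.2).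
Proof.
rewrite (big_LamF_add hS (fun c => g (descend n k (j, c.2)))).
apply: eq_big_seq => a /(LamFP hS) La; apply: eq_big_seq => b /(LamFP hS) Lb /=.
by rewrite descendE.
Qed.

Lemma Ef_descend n k psi : Ef n psi 0 = Ef (n + k) (psi \o descend n k) 0.
Proof.
by apply/funext => y; rewrite /Ef /= (addr_descend n k (rng_punc y)).
Qed.

Context {A : cstarAlgType R} {iota : (Rpunc S -> R[i]) -> A}.
Context (hI : is_reduced_algebra iota).

Lemma iota_Ef_lin n (c : R[i]) psi psi' :
  iota (Ef n (fun a => c * psi a + psi' a) 0) = c *: iota (Ef n psi 0) + iota (Ef n psi' 0).
Proof.
rewrite -(iota_linear hI); try exact: Cc_Ef.
congr iota; apply/funext => y.
by rewrite /Ef; case: eqP; rewrite ?mulr0 ?addr0.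
Qed.

Lemma iota_Ef0 n : iota (Ef n (fun=> 0) 0) = 0.
Proof.
have := iota_Ef_lin n (-1) (fun=> 0) (fun=> 0).
have -> : (fun a : address => -1 * 0 + 0) = fun=> 0 :> R[i] by apply/funext => a; rewrite mulr0 addr0.
by rewrite scaleN1r addNr.
Qed.

Lemma iota_EfM n psi psi' :
  iota (Ef n psi 0) * iota (Ef n psi' 0) = iota (Ef n (fun a => psi a * psi' a) 0).
Proof. by rewrite -(iota_conv hI) ?convol_Ef_diag//; exact: Cc_Ef. Qed.

Lemma iota_Ef_star n psi : star (iota (Ef n psi 0)) = iota (Ef n (fun a => conjc (psi a)) 0).
Proof. by rewrite -(iota_star hI) ?involution_Ef//; exact: Cc_Ef. Qed.

(** The element [u] fixes every [iota f] from the left, and some [iota f] is within 1/2 of 1, so the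
    norm of [u - 1] is at most half of itself. *)
Lemma iota_Ef1 n : iota (Ef n (fun=> 1) 0) = 1.
Proof.
set u := iota _; have uf f : Cc f -> u * iota f = iota f.
  move=> cf; rewrite /u -(iota_conv hI)//; last exact: Cc_Ef.
  by congr iota; apply/funext => y; rewrite convol_Ef_l mul1r.
apply/eqP; rewrite -subr_eq0; apply/eqP/cnorm0_eq0/eqP.
have [f cf hf] := iota_dense hI (1 : A) (e := 2^-1) ltac:(by rewrite invr_gt0).
have e : u - 1 = (u - 1) * (1 - iota f).
  by rewrite mulrBr mulr1 mulrBl uf// mul1r subrr subr0.
have := cnormM (u - 1) (1 - iota f); rewrite -e => h1.
have h2 := cnorm_ge0 (u - 1).
have : cnorm (u - 1) <= cnorm (u - 1) * 2^-1.
  by apply: le_trans h1 _; rewrite ler_wpM2l// ltW.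
by move=> h3; rewrite eq_le h2 andbT; lra.
Qed.

Lemma iota_Ef_norm n psi (B : R) : 0 <= B -> (forall a, cmod (psi a) <= B) ->
  cnorm (iota (Ef n psi 0)) <= B.
Proof.
move=> B0 hB; have := cnorm_iota_le F hS hA hd hI (X := [fset 0]%fset) (Cc_Ef n psi 0) B0 (@Ef_offsets n psi 0).
rewrite cardfs1 mul1r; apply=> y; rewrite /Ef; case: eqP => _ //.
by rewrite cmod0.
Qed.

Lemma iota_Ef_positive n (psi : address -> R) : (forall a, 0 <= psi a) ->
  cpositive (iota (Ef n (fun a => (psi a)%:C) 0)).
Proof.
move=> p0; exists (iota (Ef n (fun a => (Num.sqrt (psi a))%:C) 0)).
rewrite iota_Ef_star iota_EfM; congr iota; congr Ef; apply/funext => a.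
by rewrite conjc_real -rmorphM /= -expr2 sqr_sqrtr.
Qed.

Section Weights.
Variable tau : A -> R[i].
Hypothesis tau_lin : forall (c : R[i]) a b, tau (c *: a + b) = c * tau a + tau b.
Hypothesis tau_pos : forall a, 0 <= tau (star a * a).
Hypothesis tau_tr : forall a b, tau (a * b) = tau (b * a).
Hypothesis tau_1 : tau 1 = 1.

Lemma tau0 : tau 0 = 0.
Proof. by have := tau_lin (-1) 0 0; rewrite scaleN1r addNr mulN1r addNr. Qed.

Definition base n i : address := xget (i, 0) [set a | addresses n a /\ a.1 = i].

Lemma baseP n i : addresses n (base n i) /\ (base n i).1 = i.
Proof.
rewrite /base; case: xgetP => [a _ //|none].
have : (0 < hgt n i)%N by exact: hgt_gt0.
rewrite cardfs_gt0 => /fset0Pn[[j x] /(LamFP hS) Lx].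
by exfalso; apply: (none (i, x)); split=> //; exists j.
Qed.

(** Here [tau] is a bare function rather than a bundled linear form, so that the results also apply
    to [tau \o alpha g]. *)
Definition weight n i : R := complex.Re (tau (iota (Ef n (dirac (base n i)) 0))).

Lemma tau_dirac_ge0 n a : 0 <= tau (iota (Ef n (dirac a) 0)).
Proof.
have -> : iota (Ef n (dirac a) 0) = star (iota (Ef n (dirac a) 0)) * iota (Ef n (dirac a) 0).
  rewrite iota_Ef_star iota_EfM; congr iota; congr Ef; apply/funext => b.
  by rewrite /dirac; case: eqP => _; rewrite ?conjc1 ?mulr1// mulr0.
exact: tau_pos.
Qed.

Lemma real_of_ge0 (z : R[i]) : 0 <= z -> z = (complex.Re z)%:C /\ 0 <= complex.Re z.
Proof. by case: z => a b; rewrite lecE /= => /andP[/eqP -> ->]. Qed.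

(* By [convol_dirac] the projections given by two addresses of the same type are
   equivalent, so the choice of [base] is immaterial. *)
Lemma tau_dirac n a : addresses n a -> tau (iota (Ef n (dirac a) 0)) = (weight n a.1)%:C.
Proof.
case: a => i x /= ax.
have [ab eb] := baseP n i; rewrite /weight -(real_of_ge0 (tau_dirac_ge0 n (base n i))).1.
case: (base n i) ab eb => i' x' /= ab eb; subst i'.
rewrite -{1}(convol_dirac ax ab) -(convol_dirac ab ax).
by rewrite !(iota_conv hI) ?(tau_tr (iota (Ef _ _ (x - x'))))//; exact: Cc_Ef.
Qed.

Lemma weight_ge0 n i : 0 <= weight n i.
Proof. exact: (real_of_ge0 (tau_dirac_ge0 n (base n i))).2. Qed.

Lemma tau_Ef n psi : tau (iota (Ef n psi 0)) = \sum_(a <- adrF n) psi a * (weight n a.1)%:C.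
Proof.
(* Expands [psi] in Dirac functions, one address at a time; the list [adrF n] contains every address
   that occurs. *)
have part (s : seq address) : uniq s -> {subset s <= adrF n} ->
    tau (iota (Ef n (fun a => if a \in s then psi a else 0) 0)) =
    \sum_(a <- s) psi a * (weight n a.1)%:C.
  elim: s => [_ _|a s IHs /= /andP[nas us] sub].
    by rewrite big_nil iota_Ef0 tau0.
  rewrite big_cons -IHs//; last by move=> b bs; apply: sub; rewrite inE bs orbT.
  rewrite -(tau_dirac (n := n)); last by apply/in_adrF/sub; rewrite mem_head.
  rewrite -tau_lin -iota_Ef_lin; congr (tau (iota (Ef _ _ _))); apply/funext => b.
  rewrite inE /dirac; case: eqP => [->|_] /=; first by rewrite (negbTE nas) mulr1 addr0.
  by rewrite mulr0 add0r.
rewrite -part ?fset_uniq//; congr (tau (iota _)); apply/funext => y.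
rewrite /Ef; case: eqP => // _; rewrite ifT//.
by apply/in_adrF/(Addr_addresses (T := rng y))/addrP/rng_punc.
Qed.

Lemma tau_Ef_type n psi : tau (iota (Ef n psi 0)) =
  \sum_i (\sum_(b <- LamF n i) psi (i, b.2)) * (weight n i)%:C.
Proof.
by rewrite tau_Ef big_adrF; apply: eq_bigr => i _; rewrite mulr_suml.
Qed.

Lemma weight_total n : \sum_i (hgt n i)%:R * weight n i = 1.
Proof.
apply: complexI; rewrite rmorph_sum /=.
have h1 := tau_Ef_type n (fun=> 1); rewrite iota_Ef1 tau_1 in h1.
rewrite -[RHS]/(1 : R[i]) h1.
apply: eq_bigr => i _; rewrite rmorphM /=; congr (_ * _).
by rewrite big_const_seq count_predT iter_addr addr0 rmorph_nat.
Qed.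

(** The indicator of type [i] at level [n] is evaluated by [tau] at level [n] and at level [n + k];
    both results carry the factor [hgt n i], which is cancelled. *)
Lemma weight_step n k i : weight n i = \sum_j (mult k i j)%:R * weight (n + k) j.
Proof.
have h0 : (hgt n i)%:R != 0 :> R by rewrite pnatr_eq0 -lt0n; exact: hgt_gt0.
apply: (mulfI h0); apply: complexI.
pose psi (a : address) : R[i] := (a.1 == i)%:R.
have cst j m (s : {fset address}) : \sum_(b <- s) (psi (j, m b)) = ((j == i)%:R * (size s)%:R :> R)%:C.
  rewrite /psi /=; case: (j == i); rewrite big_const_seq count_predT iter_addr addr0.
    by rewrite mul1r rmorph_nat.
  by rewrite mul0r mul0rn.
have -> : ((hgt n i)%:R * weight n i)%:C = tau (iota (Ef n psi 0)).
  rewrite tau_Ef_type (bigD1 i) //= [X in _ = _ + X]big1 ?addr0; last first.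
    by move=> j /negbTE ji; rewrite (cst j) ji mul0r mul0r.
  by rewrite (cst i) eqxx mul1r rmorphM.
rewrite (Ef_descend n k) tau_Ef_type mulr_sumr rmorph_sum /=.
apply: eq_bigr => j _; rewrite (sum_descend n k j psi).
rewrite (eq_bigr (fun a => ((a.1 == i)%:R * (hgt n a.1)%:R :> R)%:C)); last by move=> a _; rewrite cst.
rewrite -rmorph_sum /= (sum_by_type (fun l => ((l == i)%:R * (hgt n l)%:R : R))).
rewrite (bigD1 i) //= big1 ?addr0; last by move=> l /negbTE li; rewrite li mul0r mul0rn.
by rewrite eqxx mul1r mulrA -rmorphM /= mulr_natr.
Qed.

End Weights.

End Towers.

(** Reindexing cancels all terms that stay in [s] under the shift. The non-zero terms left in either
    sum satisfy [bd], which explains the factor 2. *)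
Lemma shift_sum_le (R : realType) (V : zmodType) (s : seq V) (g : V -> R[i]) (z : V)
    (C : R) (bd : pred V) : uniq s -> 0 <= C -> (forall x, cmod (g x) <= C) ->
  (forall x, x \in s -> g x != 0 -> (x - z \in s) || bd x) ->
  (forall x, x \in s -> g (x + z) != 0 -> (x + z \in s) || bd x) ->
  cmod (\sum_(x <- s) g x - \sum_(x <- s) g (x + z)) <= (count bd s)%:R * C *+ 2.
Proof.
move=> us C0 gC h1 h2.
rewrite (bigID (fun x => x - z \in s)) /= [X in _ - X](bigID (fun x => x + z \in s)) /=.
have -> : \sum_(x <- s | x - z \in s) g x = \sum_(x <- s | x + z \in s) g (x + z).
  rewrite -big_filter -[RHS]big_filter -(big_map (fun x => x + z) xpredT g).
  apply: perm_big; apply: uniq_perm; first exact: filter_uniq.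
    by rewrite map_inj_uniq ?filter_uniq//; exact: addIr.
  move=> x; rewrite mem_filter; apply/andP/mapP => [[xz xs]|[y + ->]].
    by exists (x - z); rewrite ?mem_filter subrK ?xs.
  by rewrite mem_filter addrK => /andP[].
rewrite opprD addrACA subrr add0r.
have rest (g' : V -> R[i]) (P : pred V) : (forall x, cmod (g' x) <= C) ->
    (forall x, x \in s -> g' x != 0 -> P x || bd x) ->
    cmod (\sum_(x <- s | ~~ P x) g' x) <= (count bd s)%:R * C.
  move=> gC' hg; rewrite -big_filter; apply: le_trans (cmod_sum _ _) _.
  rewrite big_filter big_mkcond /= -sum1_count natr_sum mulr_suml [leRHS]big_mkcond /=.
  rewrite big_seq [leRHS]big_seq; apply: ler_sum => x xs; rewrite mul1r.
  case Px: (P x) => /=; first by case: ifP.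
  have [e|/hg] := eqVneq (g' x) 0; first by rewrite e cmod0; case: ifP.
  by rewrite Px xs /= => /(_ isT) ->.
by rewrite mulr2n; apply: le_trans (cmodB _ _) _; apply: lerD; exact: rest.
Qed.

(** * Existence of a trace *)

Section Averages.
Context {R : realType} {d : nat} {L : Type} {S : tiling_data R d L}.
Context (F : frame S) (hS : substitution_tiling_system S).
Context (hA : standing_assumptions S) (hd : (1 <= d)%N).
Local Notation V := 'cV[R]_d.
Local Notation lam := (scale S).
Local Notation tl := (@tl R d L S F).
Local Notation Lam := (@Lam R d L S F).
Local Notation LamF := (@LamF R d L S F).
Local Notation Rp := (Rpunc S).
Implicit Types (T : set (tile R d L)) (x z : V) (f h : Rpunc S -> R[i]).

(** A small ball about [x] lies in the supertile, so one of its tiles overlaps [tl k x]; both belong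
    to [T] and hence coincide. *)
Lemma Lam_of_inside T n i k x : Pstar S T -> supertile S n (fP F i) `<=` T ->
  T (tl k x) -> ~ outer n i x -> Lam n i (k, x).
Proof.
move=> PT sub Tx /contrapT /interior_ballP[e e0 eP].
have l0 := lamX_gt0 hS n.
have w0 : 0 < Num.min (fr F) (lam ^+ n * e) by rewrite lt_min fr_gt0 mulr_gt0.
have [|||j [y [z [Ly xz yz]]]] := open_meets_tile F hS (O := ball x (Num.min (fr F) (lam ^+ n * e))) (Pstar_supertile hS n i).
- by apply: ball_open.
- by exists x; exact: ballxx.
- move=> u; rewrite -ball_normE /= lt_min => /andP[_ ue].
  apply/(supp_supertile hS)/eP.
  by rewrite -scalerBr normrZ gtr0_norm ?invr_gt0// ltr_pdivrMl.
suff e1 : tl j y = tl k x by rewrite /Lam /adr /= -e1.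
apply: (Pstar_meet PT (sub _ Ly) Tx yz); apply: tl_ball.
by move: xz; rewrite -ball_normE /= lt_min distrC => /andP[].
Qed.

Context {A : cstarAlgType R} {iota : (Rpunc S -> R[i]) -> A}.
Context (hI : is_reduced_algebra iota).

(** Without punctured tilings the supremum in [reduced_norm] would be -oo, whereas [iota_norm] makes
    it a real number. *)
Lemma Omega_punc_nonempty : Omega_punc S !=set0.
Proof.
apply: contrapT => none.
have Cc0 : Cc (fun _ : Rp => 0 : R[i]).
  split; first exact: cst_continuous.
  rewrite (_ : [set y | _] = set0) ?closure0; first exact: compact0.
  by rewrite -subset0 => y /=; rewrite eqxx.
have := iota_norm hI Cc0; rewrite /reduced_norm.
rewrite (_ : [set z | _] = set0) ?ereal_sup0// -subset0 => z [T [xi [OT _ _]]].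
by apply: none; exists T.
Qed.

Section Fixed.
Variables (n : nat) (i : 'I_(fm F)) (T : set (tile R d L)).
Hypotheses (OT : Omega S T) (sub : supertile S n (fP F i) `<=` T).

Definition diag f x : R[i] := at_pair f (translate T (- x), translate T (- x)).

(** A positive normalized functional, the mean of the diagonal values of [f] over the tiles of one
    supertile; by [average_tr] it is nearly tracial at high levels. *)
Definition average f : R[i] := (hgt n i)%:R^-1 * \sum_(a <- LamF n i) diag f a.2.

Lemma punc_at k x : T (tl k x) -> Omega_punc S (translate T (- x)).
Proof.
move=> Tx; apply/(Omega_puncE F hS); split; first exact: (Omega_translate F hS).
by exists k; rewrite translateE translate_tl opprK add0r.
Qed.

Lemma punc_Lam a : Lam n i a -> Omega_punc S (translate T (- a.2)).
Proof. by move=> La; apply: (@punc_at a.1); exact: sub. Qed.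

Lemma punc_mem x : Omega_punc S (translate T (- x)) ->
  x \in map snd (LamF n i) \/ outer n i x.
Proof.
move=> /(Omega_puncE F hS)[_ [k]]; rewrite translateE translate_tl opprK add0r => Tx.
have [hx|hx] := pselect (outer n i x); [by right|left].
by apply/mapP; exists (k, x) => //; apply/LamFP => //; exact: (Lam_of_inside (Omega_Pstar OT)).
Qed.

Lemma average_lin (c : R[i]) f h :
  average (fun y => c * f y + h y) = c * average f + average h.
Proof.
rewrite /average mulrCA -mulrDr; congr (_ * _); rewrite mulr_sumr -big_split /=.
apply: eq_big_seq => a /(LamFP hS) La.
by rewrite /diag !(at_pair_rpack _ (Rset_diag (punc_Lam La))).
Qed.

Let h0 : 0 < (hgt n i)%:R :> R.
Proof. by rewrite ltr0n; exact: hgt_gt0. Qed.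

Lemma average_le f (B : R) : (forall a, Lam n i a -> cmod (diag f a.2) <= B) -> cmod (average f) <= B.
Proof.
move=> hB; rewrite /average cmodM.
have -> : cmod ((hgt n i)%:R^-1 : R[i]) = (hgt n i)%:R^-1.
  by rewrite -(rmorph_nat (real_complex R)) -fmorphV cmod_real ger0_norm// invr_ge0 ltW.
rewrite ler_pdivrMl// hgtE mulr_suml; apply: le_trans (cmod_sum _ _) _.
rewrite big_seq [leRHS]big_seq; apply: ler_sum => a /(LamFP hS) La.
by rewrite mul1r; exact: hB.
Qed.

Lemma average_norm f : Cc f -> cmod (average f) <= cnorm (iota f).
Proof.
move=> cf; apply: average_le => a La.
rewrite /diag (at_pair_rpack _ (Rset_diag (punc_Lam La))).
exact: (cmod_le_cnorm F hS hA hd hI).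
Qed.

Lemma average_one : average (Ef (F := F) 0 (fun=> 1) 0) = 1.
Proof.
rewrite /average (eq_big_seq (fun=> 1)); last first.
  move=> a /(LamFP hS) La; rewrite /diag at_pair_Ef0//; exact: punc_Lam.
rewrite big_const_seq count_predT iter_addr addr0 mulVf//.
by rewrite -(rmorph_nat (real_complex R)) fmorph_eq0 lt0r_neq0.
Qed.

Lemma average_pos f : Cc f -> 0 <= average (convol (involution_Cc f) f).
Proof.
move=> cf; rewrite /average mulr_ge0//.
rewrite big_seq; apply: sumr_ge0 => a /(LamFP hS) La.
have hR := Rset_diag (punc_Lam La).
rewrite /diag (at_pair_rpack _ hR).
have [X oX] := Cc_fset F hS hA hd (Cc_involution F hS hA hd cf).
rewrite (convolE F hS hA hd _ _ oX); apply: sumr_ge0 => z _.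
rewrite /rng /src /=.
set T1 := translate T (- a.2).
have [hz|nz] := pselect (Rset S (translate T1 z, T1)); last first.
  by rewrite (at_pair_out _ nz) mulr0.
have hz' : Rset S (T1, translate T1 z).
  case: hz => /= o1 o2 _; split=> //; by exists z.
rewrite (at_pair_rpack _ hz') (at_pair_rpack _ hz) /involution_Cc /rng /src /=.
by rewrite (at_pair_rpack _ hz) conjc_mul lecR sqr_ge0.
Qed.

End Fixed.

Lemma uniq_Lam n i : uniq (map snd (LamF n i)).
Proof.
rewrite map_inj_in_uniq ?fset_uniq// => -[j x] [k y] /(LamFP hS) La /(LamFP hS) Lb /= xy.
have [|/= -> ->//] := Pstar_sep hS (Pstar_supertile hS n i) La Lb.
by rewrite /= xy subrr normr0; exact: fr_gt0.
Qed.

(** Both averages sum the same products [g z], at [x] for one order and at [x + z] for the other.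
    They differ only by tiles within a bounded distance of the supertile boundary, which [few_bad]
    makes negligible. *)
Lemma average_tr f h (e : R) : Cc f -> Cc h -> 0 < e ->
  exists n0, forall n, (n0 <= n)%N -> forall i T, Omega S T -> supertile S n (fP F i) `<=` T ->
  cmod (average n i T (convol f h) - average n i T (convol h f)) <= e.
Proof.
move=> cf ch e0; have [X oX] := Cc_fset F hS hA hd cf; have [Y oY] := Cc_fset F hS hA hd ch.
(* Over a diagonal arrow the second factor runs back along the first, so offsets of [h] enter with
   the opposite sign. *)
pose Z := (X `|` [fset - z | z in Y])%fset.
have oZ : offsets_in [set` Z] f by move=> y /oX; rewrite /= inE => ->.
have oZ' : offsets_in [set` [fset - z | z in Z]%fset] h.
  move=> y /oY /= hy; apply/imfsetP; exists (- off y); last by rewrite opprK.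
  by rewrite /= inE; apply/orP; right; apply/imfsetP; exists (off y).
have [w hw] := seq_upper_bound Z (fun z => `|z|).
pose C := cnorm (iota f) * cnorm (iota h).
have C0 : 0 <= C by rewrite mulr_ge0// cnorm_ge0.
pose e' := e / ((size Z)%:R * C *+ 2 + 1).
have q0 : 0 < (size Z)%:R * C *+ 2 + 1 by rewrite ltr_pwDr// mulrn_wge0// mulr_ge0.
have e'0 : 0 < e' by rewrite divr_gt0.
have [n0 hn0] := few_bad F hS hd (w + 1) e'0.
exists n0 => n /hn0{}hn0 i T OT sub.
pose g z u := at_pair f (translate T (- u), translate (translate T (- u)) z) *
   at_pair h (translate (translate T (- u)) z, translate T (- u)).
have gC z u : cmod (g z u) <= C.
  rewrite cmodM; apply: ler_pM; rewrite ?cmod_ge0// /at_pair; case: insub => /= [y|].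
  - exact: (cmod_le_cnorm F hS hA hd hI).
  - by rewrite cmod0 cnorm_ge0.
  - exact: (cmod_le_cnorm F hS hA hd hI).
  - by rewrite cmod0 cnorm_ge0.
pose s := map snd (LamF n i).
have Es : average n i T (convol f h) - average n i T (convol h f) =
    (hgt n i)%:R^-1 * \sum_(z <- Z) (\sum_(x <- s) g z x - \sum_(x <- s) g z (x + z)).
  rewrite /average -mulrBr; congr (_ * _); rewrite sumrB.
  rewrite [X in _ = X - _]exchange_big [X in _ = _ - X]exchange_big /= /s !big_map.
  congr (_ - _); apply: eq_big_seq => a /(LamFP hS) La;
    rewrite /diag (at_pair_rpack _ (Rset_diag (punc_Lam OT sub La))).
    by rewrite (convolE F hS hA hd _ _ oZ).
  rewrite (convolE F hS hA hd _ _ oZ') big_imfset /=; last by move=> u v _ _; exact: oppr_inj.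
  apply: eq_bigr => z _; rewrite /rng /src /= /g mulrC.
  by rewrite !translateD opprD subrK.
have bs z : z \in Z -> cmod (\sum_(x <- s) g z x - \sum_(x <- s) g z (x + z)) <=
    (#|` fset_set (bad n i (w + 1))|)%:R * C *+ 2.
  move=> zZ; pose bd x := `[< exists z', outer n i z' /\ `|x - z'| < w + 1 >].
  have zw : `|z| < w + 1 by rewrite (le_lt_trans (hw z zZ))// ltrDl.
  have gp u : g z u != 0 -> Omega_punc S (translate T (- u)) /\ Omega_punc S (translate T (- (u - z))).
    rewrite mulf_eq0 negb_or => /andP[/at_pair_neq0[y [/= e1 e2 _]] _].
    split; first by rewrite -e1; exact: rng_punc.
    by rewrite opprB addrC -translateD -e2; exact: src_punc.
  apply: (le_trans (shift_sum_le (bd := bd) (uniq_Lam n i) C0 (gC z) _ _)).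
  - move=> x xs /gp[_ /(punc_mem OT sub)[->//|ox]]; apply/orP; right; apply/asboolP.
    by exists (x - z); split=> //; rewrite opprB addrC subrK.
  - move=> x xs /gp[/(punc_mem OT sub)[->//|ox] _]; apply/orP; right; apply/asboolP.
    by exists (x + z); split=> //; rewrite opprD addrA subrr add0r normrN.
  rewrite lerMn2r /= ler_wpM2r// ler_nat /s count_map -size_filter.
  apply: uniq_leq_size; first by rewrite filter_uniq// fset_uniq.
  move=> a; rewrite mem_filter => /andP[/asboolP ba /(LamFP hS) La].
  rewrite in_fset_set ?inE//; apply: sub_finite_set (Lam_finite hS n i) => b [] //.
rewrite Es cmodM.
have h0 : 0 < (hgt n i)%:R :> R by rewrite ltr0n; exact: hgt_gt0.
have -> : cmod ((hgt n i)%:R^-1 : R[i]) = (hgt n i)%:R^-1.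
  by rewrite -(rmorph_nat (real_complex R)) -fmorphV cmod_real ger0_norm// invr_ge0 ltW.
rewrite ler_pdivrMl//.
apply: (@le_trans _ _ ((size Z)%:R * ((#|` fset_set (bad n i (w + 1))|)%:R * C *+ 2))).
  apply: le_trans (cmod_sum _ _) _.
  have -> : (size Z)%:R = \sum_(z <- Z) 1 :> R by rewrite big_const_seq count_predT iter_addr addr0.
  by rewrite mulr_suml big_seq [leRHS]big_seq; apply: ler_sum => z /bs; rewrite mul1r.
rewrite mulrnAr mulrCA -mulrnAr.
apply: le_trans (ler_wpM2r _ (hn0 i)) _; first by rewrite mulrn_wge0// mulr_ge0.
rewrite mulrAC mulrC ler_wpM2l// ?(ltW h0)// /e' mulrAC ler_pdivrMr// ler_wpM2l// ?(ltW e0)//.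
by rewrite lerDl.
Qed.

End Averages.

Lemma ultra_cv (R : realType) (U : set_system nat) (u : nat -> R) (B : R) :
  UltraFilter U -> (forall n, `|u n| <= B) ->
  exists l, forall e : R, 0 < e -> U [set n | `|u n - l| < e].
Proof.
move=> UU uB.
have [|l [_ cl]] := @segment_compact R (- B) B (u @ U) _.
  suff : U (u @^-1` `[- B, B]) by [].
  by apply: filterE => n; rewrite /= in_itv /= -ler_norml; exact: uB.
exists l => e e0; have [//|Uc] := in_ultra_setVsetC [set n | `|u n - l| < e] UU.
have [|_ [[n hn <-]]] := cl (u @` ~` [set n | `|u n - l| < e]) _ _ (nbhsx_ballx l e e0).
  suff : U (u @^-1` (u @` ~` [set n | `|u n - l| < e])) by [].
  by apply: filterS Uc => n hn; exists n.
by rewrite -ball_normE /= distrC.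
Qed.

Section ReIm.
Context {R : realType}.
Implicit Types a b : R[i].

Lemma Re_le_cmod a : `|complex.Re a| <= cmod a.
Proof. by rewrite -lecR -cmodE; exact: normc_ge_Re. Qed.

Lemma Im_le_cmod a : `|complex.Im a| <= cmod a.
Proof. by rewrite /cmod normc_def /= -sqrtr_sqr ler_wsqrtr// lerDr sqr_ge0. Qed.

Lemma cmod_le_ReIm a : cmod a <= `|complex.Re a| + `|complex.Im a|.
Proof.
case: a => x y /=; rewrite [X in cmod X]complexE; apply: le_trans (cmodD _ _) _.
rewrite cmodM !cmod_real /=; suff -> : cmod ('i%C : R[i]) = 1 by rewrite mul1r.
by rewrite /cmod normc_def /= expr0n add0r expr1n sqrtr1.
Qed.

Lemma ReB a b : complex.Re (a - b) = complex.Re a - complex.Re b.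
Proof. by case: a b => ? ? [? ?]. Qed.

Lemma ImB a b : complex.Im (a - b) = complex.Im a - complex.Im b.
Proof. by case: a b => ? ? [? ?]. Qed.

Lemma cmod_small a : (forall e : R, 0 < e -> cmod a < e) -> a = 0.
Proof.
move=> h; apply: cmod_eq0; apply/eqP; rewrite eq_le cmod_ge0 andbT leNgt.
by apply/negP => a0; have := h _ a0; rewrite ltxx.
Qed.

Lemma ge0_of_near a : (forall e : R, 0 < e -> exists2 b, 0 <= b & cmod (b - a) < e) -> 0 <= a.
Proof.
move=> h; rewrite lecE; apply/andP; split.
  rewrite -normr_le0 leNgt; apply/negP => /h[b]; rewrite lecE /= => /andP[/eqP b0 _].
  by move=> /(le_lt_trans (Im_le_cmod _)); rewrite ImB b0 sub0r normrN ltxx.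
rewrite leNgt /=; apply/negP => a0; have /h[b] : 0 < - complex.Re a by rewrite oppr_gt0.
rewrite lecE /= => /andP[_ b0] /(le_lt_trans (Re_le_cmod _)); rewrite ReB.
by move/(le_lt_trans (ler_norm _)); lra.
Qed.

Lemma ultra_cv_complex (U : set_system nat) (u : nat -> R[i]) (B : R) :
  UltraFilter U -> (forall n, cmod (u n) <= B) ->
  exists l, forall e : R, 0 < e -> U [set n | cmod (u n - l) < e].
Proof.
move=> UU uB.
have [x hx] := @ultra_cv R U (fun n => complex.Re (u n)) B UU (fun n => le_trans (Re_le_cmod _) (uB n)).
have [y hy] := @ultra_cv R U (fun n => complex.Im (u n)) B UU (fun n => le_trans (Im_le_cmod _) (uB n)).
exists (x +i* y) => e e0; have e2 : 0 < e / 2 by rewrite divr_gt0.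
apply: filterS (filterI (hx _ e2) (hy _ e2)) => n [/= h1 h2].
apply: le_lt_trans (cmod_le_ReIm _) _; rewrite ReB ImB /=.
by rewrite [e]splitr ltrD.
Qed.

End ReIm.

Lemma starB (R : realType) (A : cstarAlgType R) (a b : A) : star (a - b) = star a - star b.
Proof. by apply: (addIr (star b)); rewrite -starD !subrK. Qed.

(** * Passage from approximate traces on functions to a trace on the completion *)

Section Limit.
Context {R : realType} {d : nat} {L : Type} {S : tiling_data R d L}.
Context (F : frame S) (hS : substitution_tiling_system S).
Context (hA : standing_assumptions S) (hd : (1 <= d)%N).
Context {A : cstarAlgType R} {iota : (Rpunc S -> R[i]) -> A}.
Context (hI : is_reduced_algebra iota).
Variable t : nat -> (Rpunc S -> R[i]) -> R[i].
Hypothesis t_lin : forall n (c : R[i]) f h, t n (fun y => c * f y + h y) = c * t n f + t n h.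
Hypothesis t_norm : forall n f, Cc f -> cmod (t n f) <= cnorm (iota f).
Hypothesis t_pos : forall n f, Cc f -> 0 <= t n (convol (involution_Cc f) f).
Hypothesis t_one : forall n, t n (Ef (F := F) 0 (fun=> 1) 0) = 1.
Hypothesis t_tr : forall f h (e : R), Cc f -> Cc h -> 0 < e ->
  exists n0, forall n, (n0 <= n)%N -> cmod (t n (convol f h) - t n (convol h f)) <= e.
Variable U : set_system nat.
Hypotheses (UU : UltraFilter U) (Uoo : forall n, U [set k | (n <= k)%N]).

Let tB n f h : t n (fun y => f y - h y) = t n f - t n h.
Proof.
have := t_lin n (-1) h f; rewrite mulN1r addrC => <-; congr t; apply/funext => y.
by rewrite mulN1r addrC.
Qed.

Let t_dist n f h : Cc f -> Cc h -> cmod (t n f - t n h) <= cnorm (iota f - iota h).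
Proof.
move=> cf ch; rewrite -tB (iota_sub hI cf ch); apply: t_norm.
have := Cc_lin F hS hA hd (-1) ch cf; congr Cc; apply/funext => y.
by rewrite mulN1r addrC.
Qed.

(** Characterizes the value at [a] through all approximants at once, so that each property of
    [limit] follows from one choice of functions and one common index [n]. *)
Definition is_limit (a : A) (l : R[i]) := forall f (e : R), Cc f -> cnorm (a - iota f) < e ->
  U [set n | cmod (t n f - l) < e].

(** The value is the ultralimit of the diagonal sequence [t n (g n)], where [iota (g n)] tends to
    [a]. Any other approximant is compared with [g n] by [t_dist]. *)
Lemma is_limit_exists a : exists l, is_limit a l.
Proof.
have /choice[g hg] : forall n : nat, exists f, Cc f /\ cnorm (a - iota f) < n.+1%:R^-1.
  by move=> n; have [|f cf hf] := iota_dense hI a (e := n.+1%:R^-1); [rewrite invr_gt0|exists f].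
have [n|l hl] := ultra_cv_complex (u := fun n => t n (g n)) (B := cnorm a + 1) UU.
  apply: le_trans (t_norm n (hg n).1) _; rewrite -[iota _](subKr a).
  apply: le_trans (cnormB _ _) _; rewrite lerD2l; apply: le_trans (ltW (hg n).2) _.
  by rewrite invf_le1 ?ler1n.
exists l => f e cf hf; pose e' := (e - cnorm (a - iota f)) / 2.
have e'0 : 0 < e' by rewrite divr_gt0// subr_gt0.
have [n0 hn0] : exists n0, forall n, (n0 <= n)%N -> n.+1%:R^-1 < e'.
  have [n0 _ hn0] := near_infty_natSinv_lt (PosNum e'0); exists n0 => n /hn0; exact.
apply: filterS (filterI (hl e' e'0) (Uoo n0)) => n [/= h1 /hn0 h2].
rewrite -(subrKA (t n (g n))); apply: le_lt_trans (cmodD _ _) _.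
have := t_dist n cf (hg n).1.
rewrite -(subrKA a) -opprB => /le_trans/(_ (cnormD _ _)); rewrite cnormN.
have h3 := lt_trans (hg n).2 h2; have h4 : e' + e' = e - cnorm (a - iota f) by rewrite /e' -splitr.
have lin (p q r s e1 : R) : p <= q + r -> r < e1 -> s < e1 -> e1 + e1 = e - q -> p + s < e by lra.
by move=> h5; exact: lin h5 h3 h1 h4.
Qed.

Definition limit a : R[i] := xget 0 [set l | is_limit a l].

Lemma limit_near a f (e : R) : Cc f -> cnorm (a - iota f) < e ->
  U [set n | cmod (t n f - limit a) < e].
Proof.
move=> cf hf; rewrite /limit; case: xgetP => [l _ hl|none]; first exact: hl.
by have [l hl] := is_limit_exists a; case: (none l).
Qed.

Lemma limit_lin (c : R[i]) a b : limit (c *: a + b) = c * limit a + limit b.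
Proof.
apply/eqP; rewrite -subr_eq0; apply/eqP/cmod_small => e e0.
pose e' := e / (2 * (cmod c + 2)).
have c0 := cmod_ge0 c.
have e'0 : 0 < e' by rewrite divr_gt0// mulr_gt0//; lra.
have [f cf hf] := iota_dense hI a e'0; have [h ch hh] := iota_dense hI b e'0.
have hfh : cnorm (c *: a + b - iota (fun y => c * f y + h y)) < (cmod c + 1) * e'.
  rewrite (iota_linear hI)// opprD addrACA -scalerBr; apply: le_lt_trans (cnormD _ _) _.
  by rewrite cnormZ mulrDl mul1r ler_ltD// ler_wpM2l// ltW.
have cfh := Cc_lin F hS hA hd c cf ch.
have [n [[/= h1 h2] h3]] := filter_ex (filterI (filterI (limit_near cf hf) (limit_near ch hh)) (limit_near cfh hfh)).
have -> : limit (c *: a + b) - (c * limit a + limit b) =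
  (c * (t n f - limit a) + (t n h - limit b)) - (t n (fun y => c * f y + h y) - limit (c *: a + b)).
  rewrite t_lin; ring.
apply: le_lt_trans (cmodB _ _) _; apply: le_lt_trans (lerD (cmodD _ _) (lexx _)) _.
rewrite cmodM.
have : cmod c * cmod (t n f - limit a) <= cmod c * e' by rewrite ler_wpM2l// ltW.
have <- : 2 * (cmod c + 2) * e' = e by rewrite /e' mulrC divfK// mulf_neq0//; lra.
by move: h2 h3; set p := cmod c * e'; nra.
Qed.

Lemma limit_one : limit 1 = 1.
Proof.
apply/eqP; rewrite -subr_eq0; apply/eqP/cmod_small => e e0.
have h1 : cnorm (1 - iota (Ef (F := F) 0 (fun=> 1) 0)) < e.
  by rewrite (iota_Ef1 F hS hA hd hI) subrr cnorm0.
have [n /=] := filter_ex (limit_near (Cc_Ef hS hA hd 0 _ 0) h1).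
by rewrite t_one cmod_distC.
Qed.

Let mul_near (a b : A) (e : R) : 0 < e -> exists2 e' : R, 0 < e' & forall a' b' : A,
  cnorm (a - a') < e' -> cnorm (b - b') < e' -> cnorm (a * b - a' * b') < e.
Proof.
move=> e0; pose K := cnorm a + cnorm b + 1; have a0 := cnorm_ge0 a; have b0 := cnorm_ge0 b.
have K0 : 0 < K by rewrite /K; lra.
exists (Num.min 1 (e / (2 * K))); first by rewrite lt_min ltr01 divr_gt0// mulr_gt0.
move=> a' b'; rewrite !lt_min => /andP[a1 a2] /andP[b1 b2].
have -> : a * b - a' * b' = a * (b - b') + (a - a') * b'.
  by rewrite mulrBr mulrBl addrA subrK.
apply: le_lt_trans (cnormD _ _) _; apply: le_lt_trans (lerD (cnormM _ _) (cnormM _ _)) _.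
have b'K : cnorm b' <= cnorm b + 1.
  by rewrite -[b'](subKr b); apply: le_trans (cnormB _ _) _; rewrite lerD2l ltW.
have e1 : K * (2 * (e / (2 * K))) = e by field; lra.
have := cnorm_ge0 (b - b'); have := cnorm_ge0 (a - a'); have := cnorm_ge0 b'.
move: a2 b2 e1; rewrite /K; set q := e / _; nra.
Qed.

Lemma limit_tr a b : limit (a * b) = limit (b * a).
Proof.
apply/eqP; rewrite -subr_eq0; apply/eqP/cmod_small => e e0; have e3 : 0 < e / 4 by rewrite divr_gt0.
have [e1 e10 h1] := mul_near a b e3; have [e2 e20 h2] := mul_near b a e3.
have m0 : 0 < Num.min e1 e2 by rewrite lt_min e10.
have [f cf] := iota_dense hI a m0; have [h ch] := iota_dense hI b m0.
rewrite !lt_min => /andP[b1 b2] /andP[a1 a2].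
have := h1 _ _ a1 b1; rewrite -(iota_conv hI)// => g1.
have := h2 _ _ b2 a2; rewrite -(iota_conv hI)// => g2.
have [n0 hn0] := t_tr cf ch e3.
have [n [[/= k1 k2] /hn0 k3]] := filter_ex (filterI (filterI
  (limit_near (Cc_convol F hS hA hd cf ch) g1) (limit_near (Cc_convol F hS hA hd ch cf) g2)) (Uoo n0)).
have -> : limit (a * b) - limit (b * a) = (t n (convol f h) - t n (convol h f)) -
   (t n (convol f h) - limit (a * b)) + (t n (convol h f) - limit (b * a)) by ring.
apply: le_lt_trans (cmodD _ _) _; apply: le_lt_trans (lerD (cmodB _ _) (lexx _)) _.
lra.
Qed.

Lemma limit_pos a : 0 <= limit (star a * a).
Proof.
apply: ge0_of_near => e e0.
have [e1 e10 h1] := mul_near (star a) a e0.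
have [f cf hf] := iota_dense hI a e10.
have sf : cnorm (star a - star (iota f)) < e1.
  have -> : star a - star (iota f) = star (a - iota f).
    by rewrite starB.
  by rewrite cnorm_star_eq.
have := h1 _ _ sf hf; rewrite -(iota_star hI)// -(iota_conv hI)//; last exact: Cc_involution.
move=> g1; have [n /= hn] := filter_ex (limit_near (Cc_convol F hS hA hd (Cc_involution F hS hA hd cf) cf) g1).
by exists (t n (convol (involution_Cc f) f)) => //; exact: t_pos.
Qed.

HB.instance Definition _ := GRing.isLinear.Build R[i] A R[i] *%R limit limit_lin.

Lemma limit_trace : exists tau : {scalar A}, normalized_traces tau.
Proof.
exists limit; split; [exact: limit_pos|exact: limit_tr|exact: limit_one].
Qed.

End Limit.

Lemma trace_exists (R : realType) (d : nat) (L : Type) (S : tiling_data R d L)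
    (A : cstarAlgType R) (iota : (Rpunc S -> R[i]) -> A) (F : frame S) :
  substitution_tiling_system S -> standing_assumptions S -> (1 <= d)%N ->
  is_reduced_algebra iota -> exists tau : {scalar A}, normalized_traces tau.
Proof.
move=> hS hA hd hI; have [T0 [OT0 _]] := Omega_punc_nonempty hI.
pose i := Ordinal (fm_gt0 F).
have /choice[T hT] : forall n, exists T, Omega S T /\ supertile S n (fP F i) `<=` T.
  move=> n; have [y hy] := supertile_in hS hA hd n i OT0.
  exists (translate T0 (- y)); split; first exact: (Omega_translate F hS).
  by move=> t ht; rewrite translateE opprK; apply: hy; exists t.
have [U [UU Uoo]] := ultra_nat.
apply: (@limit_trace _ _ _ _ F hS hA hd A iota hI (fun n => average n i (T n)) _ _ _ _ _ U UU Uoo).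
- by move=> n c f h; apply: average_lin => //; case: (hT n).
- by move=> n f cf; apply: average_norm => //; case: (hT n).
- by move=> n f cf; apply: average_pos => //; case: (hT n).
- by move=> n; apply: average_one => //; case: (hT n).
- move=> f h e cf ch e0; have [n0 hn0] := average_tr F hS hA hd hI cf ch e0.
  by exists n0 => n /hn0; apply; case: (hT n).
Qed.

(** * The approximate Rokhlin towers *)

Section Rokhlin.
Context {R : realType} {d : nat} {L : Type} {S : tiling_data R d L}.
Context (F : frame S) (hS : substitution_tiling_system S).
Context (hA : standing_assumptions S) (hd : (1 <= d)%N).
Context (lact : 'M[R]_d -> L -> L) (G : set 'M[R]_d).
Context (hG : symmetry_group S lact G) (hfree : acts_freely S lact G).
Context {A : cstarAlgType R} {iota : (Rpunc S -> R[i]) -> A}.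
Context (hI : is_reduced_algebra iota).
Context (alpha : 'M[R]_d -> A -> A) (hal : is_symmetry_action iota lact G alpha).
Local Notation V := 'cV[R]_d.
Local Notation address := ('I_(fm F) * V)%type.
Local Notation gact := (@gact R d L S F lact).
Local Notation is_rep := (@is_rep R d L S F lact G).
Implicit Types (T : set (tile R d L)) (g h : 'M[R]_d) (f : Rpunc S -> R[i]).
Implicit Types (psi : 'I_(fm F) * 'cV[R]_d -> R[i]).

Definition lift g (a : address) : address := (gact g a.1, g *m a.2).

Lemma gfun_Ef g n psi : G g -> gfun lact g (Ef n psi 0) = Ef n (psi \o lift (invmx g)) 0.
Proof.
move=> Gg; apply/funext => y; have Gh := GV hG Gg.
have OT := rng_punc y; have OT' := Omega_punc_gtiling F hS hG Gh OT.
rewrite /gfun {2}/Ef; case: eqP => eo.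
  rewrite offE eo translate0 at_pair_Ef0//=; congr psi.
  apply: addr_eq => //; exact: (Addr_gtiling hS hG Gh (addrP F hS hA hd n OT)).
apply/eqP; apply: contra_notT eo => /at_pair_neq0[y' [/= e1 e2 /Ef_neq0 eo]].
apply: (off_uniq F hS hA hd); rewrite translate0.
have hT T : Omega_punc S T -> forall t, T t -> exists (i : 'I_(fm F)) x, t = tl i x.
  by move=> [OT1 _] t; exact: (Omega_tl F OT1).
rewrite -(gtilingKV hS hG Gg (hT _ (src_punc y))) -(gtilingKV hS hG Gg (hT _ OT)).
by rewrite -e1 -e2 offE eo translate0.
Qed.

Lemma alpha_Ef g n psi : G g ->
  alpha g (iota (Ef n psi 0)) = iota (Ef n (psi \o lift (invmx g)) 0).
Proof. by move=> Gg; rewrite (act_iota hal Gg) ?gfun_Ef//; exact: Cc_Ef. Qed.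

Lemma alpha_one g : G g -> alpha g 1 = 1.
Proof.
move=> Gg; have au := act_aut hal Gg; have [b _ bK] := aut_bij au.
by rewrite -[LHS]mulr1 -{2}(bK 1) -(aut_mul au) mul1r bK.
Qed.

Lemma lift_dirac g a : G g -> dirac a \o lift (invmx g) = dirac (lift g a) :> (address -> R[i]).
Proof.
move=> Gg; apply/funext => -[j z]; case: a => i x; rewrite /dirac /lift /=.
congr ((_ : bool)%:R); apply/eqP/eqP => [[<- <-]|[-> ->]].
  by rewrite (gactKV hG)// (GmulKV hG).
by rewrite (gactVK hG)// (GmulVK hG).
Qed.

Section Trace.
Variable tau : {scalar A}.
Hypothesis htau : normalized_traces tau.

Let tau_lin (c : R[i]) (a b : A) : tau (c *: a + b) = c * tau a + tau b.
Proof. exact: linearP. Qed.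
Let tau_pos (a : A) : 0 <= tau (star a * a). Proof. by case: htau. Qed.
Let tau_tr (a b : A) : tau (a * b) = tau (b * a). Proof. by case: htau. Qed.
Let tau_1 : tau 1 = 1. Proof. by case: htau. Qed.

Lemma weight_alpha g n (i : 'I_(fm F)) : G g ->
  weight (F := F) (iota := iota) (tau \o alpha g) n i = weight (iota := iota) tau n (gact g i).
Proof.
move=> Gg; have [ab eb] := baseP hS n i.
rewrite /weight /= alpha_Ef// lift_dirac//.
have ax : addresses n (lift g (base n i)).
  case: ab => j Lj; exists (gact g j); move: Lj; case: (base n i) => k x /=.
  exact: (Lam_gact hS hG Gg).
by rewrite (tau_dirac hS hA hd hI tau_pos tau_tr ax) /= eb.
Qed.

(** The functional [tau \o alpha g] is again a normalized trace, so [weights_unique] applies to the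
    pair; primitivity supplies multiplicities at least 1. *)
Lemma weight_invariant N n g (i : 'I_(fm F)) :
  (forall p q, proto S p -> proto S q -> exists x, supertile S N p (translate_tile q x)) ->
  (N <= n)%N -> G g ->
  weight (iota := iota) tau n (gact g i) = weight (iota := iota) tau n i.
Proof.
move=> hN Nn Gg; rewrite -weight_alpha//.
have au := act_aut hal Gg.
have lin' (c : R[i]) (a b : A) : (tau \o alpha g) (c *: a + b) = c * (tau \o alpha g) a + (tau \o alpha g) b.
  by rewrite /= (aut_linear au) tau_lin.
have pos' (a : A) : 0 <= (tau \o alpha g) (star a * a).
  by rewrite /= (aut_mul au) (aut_star au).
have tr' (a b : A) : (tau \o alpha g) (a * b) = (tau \o alpha g) (b * a).
  by rewrite /= !(aut_mul au) tau_tr.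
have one' : (tau \o alpha g) 1 = 1 by rewrite /= alpha_one.
apply: (@weights_unique R (fm F) N (fun n i => (hgt n i)%:R) (fun i j => (mult N i j)%:R)) => //.
- by move=> k j; rewrite ltr0n; exact: hgt_gt0.
- by move=> k j; rewrite ler1n; apply: mult_ge1 => //; exact: hN (fP_proto F j) (fP_proto F k).
- by move=> k j; exact: hgt_add.
- by move=> k j; exact: weight_ge0.
- by move=> k j; exact: weight_ge0.
- by move=> k; exact: weight_total.
- by move=> k; exact: weight_total.
- by move=> k j; exact: weight_step.
- by move=> k j; exact: weight_step.
Qed.

(** Heights and weights are constant on orbits, so the total mass 1 splits into [#G] equal
    shares. *)
Lemma weight_reps N n :
  (forall p q, proto S p -> proto S q -> exists x, supertile S N p (translate_tile q x)) ->
  (N <= n)%N ->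
  \sum_(i | is_rep i) (hgt n i)%:R * weight (F := F) (iota := iota) tau n i = (#|` fset_set G|)%:R^-1.
Proof.
move=> hN Nn; have := weight_total F hS hA hd hI tau_lin tau_pos tau_tr tau_1 n.
rewrite (sum_reps hG hfree) => [e|g i Gg]; last by rewrite (weight_invariant i hN Nn Gg) (hgt_gact hS hG).
have G0 : (#|` fset_set G|)%:R != 0 :> R.
  by apply/eqP => e0; move: e; rewrite e0 mul0r => /esym/eqP; rewrite oner_eq0.
by apply: (mulfI G0); rewrite e divff.
Qed.

End Trace.

Definition bump_weight n (w : R) (a : address) : R := if is_rep a.1 then ramp n w a else 0.

Section Bump.
Variables (n : nat) (w : R).
Hypothesis w0 : 0 < w.
Local Notation rho := (bump_weight n w).

Lemma bump_weight_ge0 a : 0 <= rho a.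
Proof. by rewrite /bump_weight; case: ifP => // _; exact: ramp_ge0. Qed.

Lemma bump_weight_le1 a : rho a <= 1.
Proof. by rewrite /bump_weight; case: ifP => // _; exact: ramp_le1. Qed.

Lemma bump_weight_outer a z : outer n a.1 z -> rho a <= `|a.2 - z| / w.
Proof.
move=> oz; rewrite /bump_weight; case: ifP => _; first exact: ramp_outer.
by rewrite divr_ge0// ltW.
Qed.

Lemma bump_weight_lipschitz i x y : rho (i, x) <= rho (i, y) + `|x - y| / w.
Proof.
rewrite /bump_weight /=; case: ifP => _; first exact: ramp_lipschitz.
by rewrite add0r divr_ge0// ltW.
Qed.

(** Within one supertile this is the Lipschitz bound. Otherwise each of the two tiles is within the
    norm of [z] of a point outside its own supertile interior, so both values are already small. *)
Lemma bump_weight_slow T z : Omega_punc S T -> Omega_punc S (translate T z) ->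
  `|rho (addr F n T) - rho (addr F n (translate T z))| <= `|z| / w.
Proof.
move=> OT OTz; have Aa := addrP F hS hA hd n OT; have Ab := addrP F hS hA hd n OTz.
set a := addr F n T in Aa *; set b := addr F n (translate T z) in Ab *.
have back : translate (translate T z) (- z) = T by rewrite translateD subrr translate0.
have same : a.1 = b.1 -> b.2 = a.2 - z -> `|rho a - rho b| <= `|z| / w.
  case: (a) (b) => i x [j y] /= <- ->; rewrite ler_norml lerBlDr lerNl opprB lerBlDr.
  have h1 := bump_weight_lipschitz i x (x - z); rewrite subKr addrC in h1.
  have h2 := bump_weight_lipschitz i (x - z) x; rewrite distrC subKr [leRHS]addrC in h2.
  by rewrite h1 h2.
have [[e1 e2]|oa] := Addr_translate hS hA OT.1 Aa Ab; first exact: same.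
(* Going back by [- z] gives the estimate at the other end, where the supertile may have another
   type. *)
have [|[e1 e2]|ob] := @Addr_translate _ _ _ _ F hS hA n (translate T z) (- z) b a OTz.1 Ab.
- by rewrite back.
- by apply: same => //; rewrite e2 opprK addrK.
have := bump_weight_outer oa; have := bump_weight_outer ob.
rewrite !subKr normrN => hb ha.
rewrite ler_norml lerBlDr lerNl opprB lerBlDr; apply/andP; split.
  by rewrite (le_trans hb)// lerDl bump_weight_ge0.
by rewrite (le_trans ha)// lerDl bump_weight_ge0.
Qed.

Definition bump : A := iota (Ef n (fun a => (rho a)%:C) 0).

Lemma bump_positive : cpositive bump.
Proof. by apply: iota_Ef_positive => //; exact: bump_weight_ge0. Qed.

Lemma bump_compl_positive : cpositive (1 - bump).
Proof.
have -> : 1 - bump = iota (Ef n (fun a => (1 - rho a)%:C) 0).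
  rewrite -(iota_Ef1 F hS hA hd hI n) addrC -scaleN1r /bump -(iota_Ef_lin hS hA hd hI).
  by congr (iota (Ef _ _ _)); apply/funext => a; rewrite mulN1r addrC rmorphB.
by apply: iota_Ef_positive => // a; rewrite subr_ge0 bump_weight_le1.
Qed.

Lemma bump_norm : cnorm bump <= 1.
Proof.
rewrite /bump; apply: (iota_Ef_norm hS hA hd hI) => // a.
by rewrite cmod_real ger0_norm ?bump_weight_ge0 ?bump_weight_le1.
Qed.

(** The product vanishes exactly: no type is carried to a representative of its orbit by two
    different group elements. *)
Lemma bump_orthogonal g h : G g -> G h -> g <> h -> alpha g bump * alpha h bump = 0.
Proof.
move=> Gg Gh gh; rewrite !alpha_Ef// (iota_EfM hS hA hd hI).
rewrite -(iota_Ef0 F hS hA hd hI n); congr (iota (Ef _ _ _)); apply/funext => -[i x] /=.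
rewrite -rmorphM /= /bump_weight /lift /=.
case rg: (is_rep (gact (invmx g) i)); last by rewrite mul0r.
case rh: (is_rep (gact (invmx h) i)); last by rewrite mulr0.
have Gk : G (invmx h *m g) by apply: (GM hG) => //; exact: (GV hG).
exfalso; apply: gh; have : invmx h *m g = 1%:M.
  apply: (rep_uniq hG hfree Gk rg); rewrite (gactM hG)//; last exact: (GV hG).
  by rewrite (gactKV hG).
move=> /(congr1 (mulmx h)); rewrite mulmxA mulmxV ?mul1mx ?mulmx1//.
exact: (G_unit hG).
Qed.

(** The commutator is [f] multiplied pointwise by the difference of the ramp at range and source,
    which [bump_weight_slow] bounds by [m / w]. *)
Lemma bump_commutator f (X : {fset V}) (m : R) : Cc f -> offsets_in [set` X] f ->
  (forall z, z \in X -> `|z| <= m) -> 0 <= m ->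
  cnorm (bump * iota f - iota f * bump) <= (size X)%:R * (m / w * cnorm (iota f)).
Proof.
move=> cf oX hm m0; have cE := Cc_Ef hS hA hd n (fun a => (rho a)%:C) 0.
rewrite /bump -!(iota_conv hI)//.
have c1 := Cc_convol F hS hA hd cE cf; have c2 := Cc_convol F hS hA hd cf cE.
rewrite (iota_sub hI c1 c2).
have ek y : convol (Ef n (fun a => (rho a)%:C) 0) f y - convol f (Ef n (fun a => (rho a)%:C) 0) y =
    (rho (addr F n (rng y)) - rho (addr F n (src y)))%:C * f y.
  by rewrite (convol_Ef_l hS hA hd) (convol_Ef_r hS hA hd)// rmorphB mulrBl [f y * _]mulrC.
apply: (cnorm_iota_le F hS hA hd hI).
- have := Cc_lin F hS hA hd (-1) c2 c1; congr Cc; apply/funext => y.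
  by rewrite mulN1r addrC.
- by rewrite mulr_ge0 ?cnorm_ge0// divr_ge0// ltW.
- by move=> y; rewrite ek mulf_eq0 negb_or => /andP[_ /oX].
move=> y; rewrite ek cmodM cmod_real.
have [f0|/oX /= oy] := eqVneq (f y) 0.
  by rewrite f0 cmod0 mulr0 mulr_ge0 ?cnorm_ge0// divr_ge0// ltW.
apply: ler_pM => //; rewrite ?cmod_ge0//; last exact: (cmod_le_cnorm F hS hA hd hI).
have OT := src_punc y; rewrite offE in OT *.
apply: le_trans (bump_weight_slow (rng_punc y) OT) _.
by rewrite ler_pM2r ?invr_gt0// hm.
Qed.

(** A constant 1 on the chosen types would have trace exactly [1 / #G]; by [ramp_sum] the ramp loses
    at most the proportion [e] in each chosen tower. *)
Lemma bump_trace (tau : {scalar A}) (e : R) : normalized_traces tau ->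
  (forall i : 'I_(fm F), (#|` fset_set (bad n i w)|)%:R <= e * (hgt n i)%:R) ->
  \sum_(i | is_rep i) (hgt n i)%:R * weight (F := F) (iota := iota) tau n i = (#|` fset_set G|)%:R^-1 ->
  0 <= e -> cmod (tau bump - (#|` fset_set G|)%:R^-1) <= e.
Proof.
move=> [tau_pos tau_tr tau_1] hbad hw e0.
pose s i := \sum_(b <- LamF n i) rho (i, b.2).
have et : tau bump = (\sum_(i | is_rep i) s i * weight (F := F) (iota := iota) tau n i)%:C.
  rewrite /bump (tau_Ef_type hS hA hd hI (linearP tau) tau_pos tau_tr).
  rewrite rmorph_sum /= [RHS]big_mkcond; apply: eq_bigr => i _.
  case: ifP => ri; first by rewrite rmorphM rmorph_sum.
  by rewrite big1 ?mul0r// => b _; rewrite /bump_weight /= ri.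
have q : (#|` fset_set G|%:R^-1 : R[i]) = (#|` fset_set G|%:R^-1 : R)%:C.
  by rewrite fmorphV rmorph_nat.
rewrite et q -rmorphB cmod_real -hw -sumrB.
have wg i : 0 <= weight (F := F) (iota := iota) tau n i by exact: weight_ge0.
apply: (@le_trans _ _ (\sum_(i | is_rep i) e * ((hgt n i)%:R * weight (F := F) (iota := iota) tau n i))).
  apply: le_trans (ler_norm_sum _ _ _) _; apply: ler_sum => i ri.
  rewrite -mulrBl normrM (ger0_norm (wg i)) mulrA ler_wpM2r//.
  have := ramp_sum hS hd w0 (hbad i).
  rewrite (_ : \sum_(a <- _) _ = s i); last first.
    by apply: eq_bigr => b _; rewrite /bump_weight /= ri.
  move=> /andP[h1 h2]; rewrite ler_norml; apply/andP; split; first by lra.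
  by rewrite (@le_trans _ _ 0)// ?subr_le0// mulr_ge0.
rewrite -mulr_sumr hw ler_piMr//.
have [->|n0] := eqVneq (#|` fset_set G|) 0%N; first by rewrite invr0.
by rewrite invf_le1 ?ler1n ?ltr0n lt0n.
Qed.

End Bump.
End Rokhlin.

Theorem theorem7p7 (R : realType) (d : nat) (L : Type)
    (S : tiling_data R d L) (lact : 'M[R]_d -> L -> L) (G : set 'M[R]_d)
    (A : cstarAlgType R) (iota : (Rpunc S -> R[i]) -> A)
    (alpha : 'M[R]_d -> A -> A) :
  (1 <= d)%N ->
  substitution_tiling_system S ->
  standing_assumptions S ->
  symmetry_group S lact G ->
  acts_freely S lact G ->
  is_reduced_algebra iota ->
  is_symmetry_action iota lact G alpha ->
  weak_Rokhlin_property G alpha.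
Proof.
move=> hd hS hA hG hfree hI hal; have [F _] := frame_exists hS.
have [tau0 htau0] := trace_exists F hS hA hd hI.
have small (e : R) : 0 < e -> exists n0 : nat, forall n, (n0 <= n)%N -> n.+1%:R^-1 < e.
  by move=> e0; have [n0 _ hn0] := near_infty_natSinv_lt (PosNum e0); exists n0 => n /hn0; exact.
(* For the width [k.+1] the level is taken so high that bad tiles have proportion at most
   [1 / k.+1], and at least [N] so that the weights are invariant. The level does not depend on
   [tau]. *)
have /choice[lv hlv] : forall k : nat, exists n,
    (forall i : 'I_(fm F), (#|` fset_set (bad n i k.+1%:R)|)%:R <= k.+1%:R^-1 * (hgt n i)%:R :> R) /\
    forall tau : {scalar A}, normalized_traces tau ->
    \sum_(i | is_rep (F := F) lact G i) (hgt n i)%:R * weight (F := F) (iota := iota) tau n i =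
      (#|` fset_set G|)%:R^-1.
  move=> k; have [n0 hn0] := few_bad F hS hd (k.+1%:R : R) (e := k.+1%:R^-1) ltac:(by rewrite invr_gt0).
  have [[N hN] _ _ _] := hA.
  exists (maxn n0 N); split; first by apply: hn0; rewrite leq_maxl.
  by move=> tau htau; apply: (weight_reps F hS hA hd hG hfree hI hal htau hN); rewrite leq_maxr.
have w0 k : 0 < k.+1%:R :> R by [].
pose b k := bump F lact G (iota := iota) (lv k) k.+1%:R.
exists b; split.
- move=> a; apply/cvgrPdist_lt => e e0.
  (* As [b k] has norm at most 1, replacing [a] by [iota f] costs at most twice [e / 4]; the other
     half of [e] is left for the commutator with [iota f]. *)
  have e4 : 0 < e / 4 by rewrite divr_gt0.
  have [f cf hf] := iota_dense hI a e4.
  have [X oX] := Cc_fset F hS hA hd cf.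
  have [m0 hm0] := seq_upper_bound X (fun z => `|z|).
  pose m := Num.max 0 m0; have m_ge0 : 0 <= m by rewrite le_max lexx.
  have hm z : z \in X -> `|z| <= m by move=> /hm0 h; rewrite le_max h orbT.
  pose K := (size X)%:R * (m * cnorm (iota f)).
  have K0 : 0 <= K by rewrite !mulr_ge0 ?cnorm_ge0.
  (* The summand 1 avoids dividing by 0 when [K] vanishes. *)
  have [|n0 hn0] := small (e / 2 / (K + 1)); first by rewrite !divr_gt0// ltr_pwDr.
  exists n0 => // k /hn0 hk /=; rewrite sub0r normrN ger0_norm ?cnorm_ge0//.
  have -> : b k * a - a * b k = (b k * iota f - iota f * b k) + (b k * (a - iota f) - (a - iota f) * b k).
    by rewrite mulrBr mulrBl opprB addrACA [b k * iota f + _]addrC subrK addKr.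
  apply: le_lt_trans (cnormD _ _) _; rewrite [e]splitr; apply: ltr_leD.
    apply: le_lt_trans (bump_commutator F hS hA hd lact G hI _ (w0 k) cf oX hm m_ge0) _.
    have -> : (size X)%:R * (m / k.+1%:R * cnorm (iota f)) = K * k.+1%:R^-1 by rewrite /K; ring.
    apply: (@le_lt_trans _ _ ((K + 1) * k.+1%:R^-1)).
      by rewrite ler_wpM2r ?invr_ge0// lerDl.
    by rewrite -ltr_pdivlMl ?ltr_pwDr// mulrC.
  have bk : cnorm (b k) <= 1 by exact: bump_norm.
  apply: le_trans (cnormB _ _) _; apply: le_trans (lerD (cnormM _ _) (cnormM _ _)) _.
  have := cnorm_ge0 (a - iota f); have := cnorm_ge0 (b k); move: (ltW hf) bk.
  nra.
- by move=> k; split; [exact: bump_positive|exact: bump_compl_positive].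
- move=> g h Gg Gh gh.
  rewrite (_ : (fun _ => _) = fun=> 0); first exact: cvg_cst.
  by apply/funext => k; rewrite (bump_orthogonal F hS hA hd hG hfree hI hal _ _ Gg Gh gh) cnorm0.
apply: (@squeeze_cvge _ _ _ _ (fun=> 0%E) _ (fun k => (k.+1%:R^-1)%:E)).
- apply: nearW => k; apply/andP; split.
    (* One existing trace is enough to bound the supremum below by 0. *)
    apply: (@le_trans _ _ (cmod (tau0 (b k) - (#|` fset_set G|%:R)^-1))%:E).
      by rewrite lee_fin cmod_ge0.
    by apply: ereal_sup_ubound; exists tau0.
  apply: ub_ereal_sup => _ [tau htau <-]; rewrite lee_fin.
  have [hb hw] := hlv k; apply: bump_trace => //; first exact: hw.
- exact: cvg_cst.
- apply: cvg_EFin; first exact: nearW.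
  apply/cvgrPdist_lt => e /small[n0 hn0]; exists n0 => // k /hn0 hk /=.
  by rewrite sub0r normrN ger0_norm.
Qed.
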